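(* Let $C_0\ge1$, $C_1>0$, $s>1/2$. There exists a constant $C_{C_0,C_1,s}$, depending only on $(C_0,C_1,s)$, such that, for every integer $N\ge2$ and every real $\alpha>0$, under the privatization mechanism $K_{1:N}^{\mathrm{Lap},\alpha}$, the estimator $\hat f_{H^*}$ satisfies $$\sup_{f\in\mathcal F(C_0,C_1,s)}\mathbb E_{f,K_{1:N}^{\mathrm{Lap},\alpha}}\left[\|\hat f_{H^*}-f\|^2\right]\ \le\ C_{C_0,C_1,s}\left(1\wedge\left[(\alpha^4\wedge1)N\right]^{-\frac{2s}{2s+1}}\right).$$
   Context: Notation: $u\wedge v=\min\{u,v\}$, $u\vee v=\max\{u,v\}$; $[N]=\{1,\dots,N\}$; $\|\cdot\|$ is the norm of $L^2([-\pi,\pi])$; $\Phi$ is the standard Gaussian distribution function. A spectral density is a nonnegative, integrable, even function $f$ on $[-\pi,\pi]$; $\gamma_f(h)=\int_{-\pi}^{\pi}f(\lambda)e^{ih\lambda}\,d\lambda$, $h\in\mathbb Z$, and $\rho_f(h)=\gamma_f(h)/\gamma_f(0)$ when $\gamma_f(0)>0$. $\mathcal F(C_0,C_1,s)$ is the set of spectral densities $f$ with $\gamma_f(0)\in[C_0^{-1},C_0]$ and $\sum_{h\in\mathbb Z\setminus\{0\}}|h|^{2s}|\rho_f(h)|^2\le C_1^2$. $X=(X_t)_{t\in\mathbb Z}$ is a centered real stationary Gaussian process with spectral density $f$, i.e. $\operatorname{Cov}(X_0,X_h)=\gamma_f(h)$. Mechanism $K_{1:N}^{\mathrm{Lap},\alpha}$: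 for $i\in[N]$, $Z_i=(Z_{i,1},Z_{i,2})$ with $Z_{i,1}=\mathbf 1_{\{|X_i|>C_0\}}+\frac3\alpha W_{i,1}$ and $Z_{i,2}=\operatorname{sgn}(X_i)+\frac3\alpha W_{i,2}$, where the $W_{i,j}$ are i.i.d. centered standard Laplace random variables (density $\frac12e^{-|w|}$), independent of $X$. $\mathbb E_{f,K_{1:N}^{\mathrm{Lap},\alpha}}$ is expectation under the resulting joint law of $(X,Z)$. Variance estimator: with $I_{C_0}=[2(1-\Phi(C_0^{3/2})),\,2(1-\Phi(C_0^{1/2}))]$ and $\Pi_{[a,b]}(x)=(x\wedge b)\vee a$, set $\hat p_f=\Pi_{I_{C_0}}\big(\frac1N\sum_{i=1}^NZ_{i,1}\big)$ and $\hat\gamma(0)=\big(C_0/\Phi^{-1}(1-\hat p_f/2)\big)^2$. Reduced spectral density estimator: for $h\in[N-1]$, $\hat\rho(h)=\sin\big(\frac{\pi}{2N}\sum_{j=1}^{N-h}Z_{j,2}Z_{j+h,2}\big)$; for $H\in\{0,\dots,N-1\}$, $\hat f_{\mathrm{red},H}(\lambda)=\frac1{2\pi}\big(1+2\sum_{h=1}^H\hat\rho(h)\cos(h\lambda)\big)$ (empty sum $=0$). The cutoff is $H^*=\lfloor((1\wedge\alpha^4)N)^{1/(2s+1)}\rfloor$. Spectral density estimator: $\hat f_{H^*}(\lambda)=\hat\gamma(0)\,\hat f_{\mathrm{red},H^*}(\lambda)$, $\lambda\in[-\pi,\pi]$. *)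

(* Defs.v *)
From HB Require Import structures.
From mathcomp Require Export all_boot all_order all_algebra finmap.
From mathcomp Require Export all_classical all_reals all_analysis.
From mathcomp Require Export complex.

Set Implicit Arguments.
Unset Strict Implicit.
Unset Printing Implicit Defensive.

Export Order.TTheory GRing.Theory Num.Theory.
Export numFieldNormedType.Exports.

Global Open Scope classical_set_scope.
Global Open Scope ring_scope.
Global Open Scope complex_scope.

Section spectral_densities.
Context {R : realType}.
Implicit Types (f g : R -> R) (h : int).

Definition circle : set R := `[- pi, pi]%classic.

(* The norm of L^2([-pi, pi]), with value +oo outside of L^2; g \_ D is g on D
   and 0 elsewhere. *)
Definition L2norm g : \bar R :=
  ('N[ lebesgue_measure ]_(2%:E) [ EFin \o (g \_ circle) ])%E.

(* Only the values of f on [-pi, pi] matter. *)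
Definition spectral_density f : Prop :=
  [/\ {in circle, forall x, 0 <= f x},
      {in circle, forall x, f (- x) = f x} &
      (@lebesgue_measure R).-integrable circle (EFin \o f)].

Definition cexp (x : R) : R[i] := cos x +i* sin x.

Definition cintegral (u : R -> R[i]) : R[i] :=
  (\int[lebesgue_measure]_(x in circle) complex.Re (u x)) +i*
  (\int[lebesgue_measure]_(x in circle) complex.Im (u x)).

Definition autocov f h : R[i] :=
  cintegral (fun x => (f x)%:C * cexp (h%:~R * x)).

Definition autocorr f h : R[i] := autocov f h / autocov f 0.

(* The order of R[i] only compares numbers with equal imaginary parts, so the
   second clause says that autocov f 0 is a real number in [C0^-1, C0]. *)
Definition spectral_class (C0 C1 s : R) f : Prop :=
  [/\ spectral_density f,
      (C0^-1)%:C <= autocov f 0 <= C0%:C &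
      (\esum_(h in [set h | h != 0%R])
         (`|h|%:~R `^ (2 * s) * Normc.normc (autocorr f h) ^+ 2)%:E
       <= (C1 ^+ 2)%:E)%E].

End spectral_densities.

Section probabilistic_model.
Context {R : realType} {d : measure_display} {T : measurableType d}.
Variable P : probability T R.

(* The degenerate case is separate because normal_prob m 0 is not a Dirac mass
   in the library. *)
Definition gaussian_variable (Y : T -> R) : Prop :=
  exists m sigma : R, 0 <= sigma /\
    forall A : set R, measurable A ->
      P (Y @^-1` A) = if sigma == 0 then \d_m A else normal_prob m sigma A.

Definition gaussian_process (X : int -> {RV P >-> R}) : Prop :=
  forall (J : {fset int}) (a : int -> R),
    gaussian_variable (fun w => \sum_(t <- J) a t * X t w).

(* For a centered Gaussian process, invariance of the covariances under shifts
   is stationarity. *)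
Definition centered_stationary_gaussian (f : R -> R)
    (X : int -> {RV P >-> R}) : Prop :=
  [/\ gaussian_process X,
      forall t : int, ('E_P[X t] = 0)%E,
      forall t h : int,
        covariance P (X t) (X (t + h)) = covariance P (X 0) (X h) &
      forall h : int, (fine (covariance P (X 0) (X h)))%:C = autocov f h].

Definition mutually_independent (I : choiceType) (D : set I)
    (V : I -> {RV P >-> R}) : Prop :=
  forall (J : {fset I}) (B : I -> set R),
    [set` J] `<=` D -> (forall k, measurable (B k)) ->
    P (\bigcap_(k in [set` J]) (V k @^-1` B k)) =
    (\prod_(k <- J) P (V k @^-1` B k))%E.

Definition generated_sigma_algebra (I : Type) (D : set I)
    (V : I -> {RV P >-> R}) : set (set T) :=
  <<s [set E | exists2 k, D k &
        exists2 B : set R, measurable B & E = V k @^-1` B] >>.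

Definition independent_sigma_algebras (G H : set (set T)) : Prop :=
  forall E F, G E -> H F -> P (E `&` F) = (P E * P F)%E.

Definition standard_laplace (Y : {RV P >-> R}) : Prop :=
  forall A : set R, measurable A ->
    distribution P Y A =
    (\int[lebesgue_measure]_(w in A) (2^-1 * expR (- `|w|))%:E)%E.

(* Index (i, j) stands for W_{i,j}, with i in {1, ..., N} and j in {1, 2};
   the variables at other indices are irrelevant. *)
Definition noise_index (N : nat) : set (nat * nat) :=
  [set k | (1 <= k.1 <= N)%N /\ (1 <= k.2 <= 2)%N].

Definition laplace_noise (N : nat) (X : int -> {RV P >-> R})
    (W : nat * nat -> {RV P >-> R}) : Prop :=
  [/\ forall k, noise_index N k -> standard_laplace (W k),
      mutually_independent (noise_index N) W &
      independent_sigma_algebras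
        (generated_sigma_algebra [set: int] X)
        (generated_sigma_algebra (noise_index N) W)].

End probabilistic_model.

Section estimators.
Context {R : realType}.
Implicit Types (alpha s lambda : R) (N h H : nat).
Implicit Types (x : nat -> R) (w z : nat * nat -> R).

(* z (i, j) is Z_{i,j}, computed from the data x and the noise w. *)
Definition privatize (C0 : R) alpha x w : nat * nat -> R := fun k =>
  (if k.2 == 1%N then (if C0 < `|x k.1| then 1 else 0) else Num.sg (x k.1))
  + 3 / alpha * w k.

Definition Phi (x : R) : R := fine (normal_prob 0 1 `]-oo, x]%classic).

(* The inverse of Phi : R -> ]0, 1[; arbitrary outside of ]0, 1[. *)
Definition Phi_inv (p : R) : R := xget 0 [set x | Phi x = p].

Definition projection (a b x : R) : R := Num.max (Num.min x b) a.

Definition p_hat (C0 : R) N z : R :=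
  projection (2 * (1 - Phi (C0 `^ (3 / 2)))) (2 * (1 - Phi (C0 `^ (1 / 2))))
    (N%:R^-1 * \sum_(1 <= i < N.+1) z (i, 1%N)).

Definition gamma_hat (C0 : R) N z : R :=
  (C0 / Phi_inv (1 - p_hat C0 N z / 2)) ^+ 2.

Definition rho_hat N z h : R :=
  sin (pi / (2 * N%:R) *
       \sum_(1 <= j < (N - h).+1) z (j, 2%N) * z ((j + h)%N, 2%N)).

Definition f_red_hat N H z lambda : R :=
  1 / (2 * pi) *
  (1 + 2 * \sum_(1 <= h < H.+1) rho_hat N z h * cos (h%:R * lambda)).

Definition cutoff s N alpha : nat :=
  Num.truncn ((Num.min 1 (alpha ^+ 4) * N%:R) `^ (1 / (2 * s + 1))).

Definition f_hat (C0 : R) N H z lambda : R := gamma_hat C0 N z * f_red_hat N H z lambda.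

End estimators.

(* Main.v *)
(* By Parseval's inequality the quadratic loss is at most a constant times the sum of the
   squared error of [gamma_hat], of the squared errors of the [rho_hat h] with [h <= H], and
   of the tail [\sum_(h > H) rho h ^ 2 <= C1 ^ 2 * (H + 1) ^ (- 2 * s)].

   Sheppard's formula [E (sgn U * sgn V) = 1 - 2 / pi * acos (E (U * V))] for unit Gaussian
   variables accounts for the sine in [rho_hat]. As the sine, and the normal quantile function
   away from 0 and 1, are Lipschitz, it suffices to bound the variances of the averages of the
   privatized indicators and of the products of privatized signs. The Laplace noise contributes
   orthogonal sums. The covariance of two exceedance indicators is [O(`|rho|)]: two unit
   Gaussians differ by a rotation, and an exceedance changes under a rotation by [x] with
   probability at most [2 * x / pi]. For two products of signs, one pair is replaced by its
   residuals after regression on the other pair, which are independent of the latter; this is a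
   small perturbation provided that [rho h] stays away from [1] and [-1], which follows from
   [1 - cos (k * x) <= k ^ 2 * (1 - cos x)] and the Sobolev bound. Finally [2 * s > 1] makes
   [\sum_h `|rho h|] bounded, so that all variances are [O(1 / N)] up to powers of [1 / alpha]. *)

Require Import Defs.
From mathcomp Require Import ring lra zify measurable_realfun.

Set Implicit Arguments.
Unset Strict Implicit.
Unset Printing Implicit Defensive.

(** * Bounded pointwise limits and real-valued integrals *)

Section bounded_pointwise_closure.
Import HBNNSimple HBSimple.
Context {R : realType} {X : Type}.
Implicit Types (D : set X) (V B : set (X -> R)) (f g : X -> R).

Inductive lspan B : set (X -> R) :=
| lspan_base f : B f -> lspan B f
| lspan_add f g : lspan B f -> lspan B g -> lspan B (fun x => f x + g x)
| lspan_scale (c : R) f : lspan B f -> lspan B (fun x => c * f x).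

Inductive bpc D V : set (X -> R) :=
| bpc_base f : V f -> bpc D V f
| bpc_lim (u : nat -> X -> R) f (M : R) : (forall n, bpc D V (u n)) ->
    (forall n x, D x -> `|u n x| <= M) ->
    (forall x, D x -> u n x @[n --> \oo] --> f x) -> bpc D V f.

Lemma bpc_eq D V f g : bpc D V f -> (forall x, D x -> f x = g x) ->
  (exists M : R, forall x, D x -> `|f x| <= M) -> bpc D V g.
Proof.
move=> Vf fg [M fM]; apply: (@bpc_lim _ _ (fun=> f) _ M) => // x Dx.
by rewrite fg //; exact: cvg_cst.
Qed.

Lemma lspan_mul B : (forall f g, B f -> B g -> lspan B (fun x => f x * g x)) ->
  forall f g, lspan B f -> lspan B g -> lspan B (fun x => f x * g x).
Proof.
move=> BB f g; elim=> {f} [f Bf|f1 f2 _ h1 _ h2 Sg|c f _ h Sg].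
- elim=> {g} [g Bg|g1 g2 _ h1 _ h2|c g _ h]; first exact: BB.
  + rewrite (_ : (fun x => _) = fun x => f x * g1 x + f x * g2 x).
      exact: lspan_add.
    by apply/funext => x; rewrite mulrDr.
  + rewrite (_ : (fun x => _) = fun x => c * (f x * g x)).
      exact: lspan_scale.
    by apply/funext => x; rewrite mulrCA.
- rewrite (_ : (fun x => _) = fun x => f1 x * g x + f2 x * g x).
    by apply: lspan_add; [exact: h1|exact: h2].
  by apply/funext => x; rewrite mulrDl.
- rewrite (_ : (fun x => _) = fun x => c * (f x * g x)).
    by apply: lspan_scale; exact: h.
  by apply/funext => x; rewrite mulrA.
Qed.

Context (D : set X) (V : set (X -> R)).
Hypotheses (V_add : forall f g, V f -> V g -> V (fun x => f x + g x))
  (V_scale : forall c f, V f -> V (fun x => c * f x))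
  (V_mul : forall f g, V f -> V g -> V (fun x => f x * g x))
  (V_one : V (fun=> 1))
  (V_bounded : forall f, V f -> exists M : R, forall x, D x -> `|f x| <= M).
Local Notation bp := (bpc D V).

Lemma cvg_norm_le (v : nat -> R) l M : v n @[n --> \oo] --> l ->
  (forall n, `|v n| <= M) -> `|l| <= M.
Proof.
move=> vl vM; rewrite -(cvg_lim (@Rhausdorff R) (cvg_norm vl)).
by apply: limr_le; [apply/cvg_ex; exists `|l|; exact: cvg_norm|exact: nearW].
Qed.

Lemma bpc_bounded f : bp f -> exists M : R, forall x, D x -> `|f x| <= M.
Proof.
elim=> {f} [f /V_bounded//|u f M _ _ uM uf]; exists M => x Dx.
by apply: (cvg_norm_le (uf x Dx)) => n; exact: uM.
Qed.

Lemma bpc_scale c f : bp f -> bp (fun x => c * f x).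
Proof.
elim=> {f} [f Vf|u f M _ h uM uf]; first exact/bpc_base/V_scale.
apply: (bpc_lim (u := fun n x => c * u n x) (M := `|c| * M)) => //.
  by move=> n x Dx; rewrite normrM ler_wpM2l ?uM.
by move=> x Dx; apply: cvgM; [exact: cvg_cst|exact: uf].
Qed.

Lemma bpc_add f g : bp f -> bp g -> bp (fun x => f x + g x).
Proof.
move=> + bg; elim=> {f} [f Vf|u f M bu h uM uf].
- elim: bg => {g} [g Vg|u g M bu h uM uf]; first exact/bpc_base/V_add.
  have [K fK] := V_bounded Vf.
  apply: (bpc_lim (u := fun n x => f x + u n x) (M := K + M)) => //.
    by move=> n x Dx; rewrite (le_trans (ler_normD _ _))// lerD ?uM ?fK.
  by move=> x Dx; apply: cvgD; [exact: cvg_cst|exact: uf].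
- have [K gK] := bpc_bounded bg.
  apply: (bpc_lim (u := fun n x => u n x + g x) (M := M + K)) => //.
    by move=> n x Dx; rewrite (le_trans (ler_normD _ _))// lerD ?uM ?gK.
  by move=> x Dx; apply: cvgD; [exact: uf|exact: cvg_cst].
Qed.

Lemma bpc_mul f g : bp f -> bp g -> bp (fun x => f x * g x).
Proof.
move=> + bg; elim=> {f} [f Vf|u f M bu h uM uf].
- elim: bg => {g} [g Vg|u g M bu h uM uf]; first exact/bpc_base/V_mul.
  have [K fK] := V_bounded Vf.
  apply: (bpc_lim (u := fun n x => f x * u n x) (M := K * M)) => //.
    by move=> n x Dx; rewrite normrM ler_pM ?uM ?fK.
  by move=> x Dx; apply: cvgM; [exact: cvg_cst|exact: uf].
- have [K gK] := bpc_bounded bg.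
  apply: (bpc_lim (u := fun n x => u n x * g x) (M := M * K)) => //.
    by move=> n x Dx; rewrite normrM ler_pM ?uM ?gK.
  by move=> x Dx; apply: cvgM; [exact: uf|exact: cvg_cst].
Qed.

Lemma bpc_cst c : bp (fun=> c).
Proof.
rewrite (_ : (fun=> _) = fun=> c * 1); last by rewrite mulr1.
exact/bpc_scale/bpc_base.
Qed.

Lemma bpc_sum (I : Type) (s : seq I) (F : I -> X -> R) :
  (forall i, bp (F i)) -> bp (fun x => \sum_(i <- s) F i x).
Proof.
move=> bF; elim: s => [|i s ih].
  by rewrite (_ : (fun=> _) = fun=> 0); [exact: bpc_cst|apply/funext => x; rewrite big_nil].
rewrite (_ : (fun=> _) = fun x => F i x + \sum_(i <- s) F i x); first exact: bpc_add.
by apply/funext => x; rewrite big_cons.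
Qed.

(* The iterates of this polynomial converge to [sgn] pointwise on [[-1, 1]]. *)
Let q (y : R) := (3 * y - y ^+ 3) / 2.

Let qN y : q (- y) = - q y. Proof. by rewrite /q; field. Qed.

Let iterqN n y : iter n q (- y) = - iter n q y.
Proof. by elim: n => // n ih; rewrite !iterS ih qN. Qed.

Let iterq_bounds n (y : R) : 0 <= y <= 1 ->
  y <= iter n q y <= 1 /\ 1 - iter n q y <= (1 - y / 2) ^+ n.
Proof.
move=> /andP[y0 y1]; elim: n => [|n [/andP[ih1 ih2] ih3]].
  by rewrite /= lexx expr0; split=> //; lra.
rewrite iterS; set z := iter n q y in ih1 ih2 ih3 *.
have qz : q z = z + z * (1 - z) * (1 + z) / 2 by rewrite /q; field.
have qz' : 1 - q z = (1 - z) * (1 - (z + z ^+ 2) / 2) by rewrite /q; field.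
have z0 : 0 <= z by lra.
have z20 : 0 <= z ^+ 2 by rewrite sqr_ge0.
have z21 : z ^+ 2 <= 1 by rewrite expr_le1.
split.
  apply/andP; split.
    by rewrite qz; nra.
  by rewrite -subr_ge0 qz'; apply: mulr_ge0; lra.
rewrite qz' [X in _ <= X]exprSr.
have z1 : 0 <= 1 - z by lra.
have : (1 - z) * (1 - (z + z ^+ 2) / 2) <= (1 - z) * (1 - y / 2).
  by rewrite ler_wpM2l//; lra.
by move=> h; apply: (le_trans h); apply: (ler_wpM2r _ ih3); lra.
Qed.

Lemma cvg_iterq y : `|y| <= 1 -> iter n q y @[n --> \oo] --> Num.sg y.
Proof.
have pos z : 0 < z -> z <= 1 -> iter n q z @[n --> \oo] --> (1 : R).
  move=> z0 z1.
  apply: (@squeeze_cvgr _ _ _ _ (fun n => 1 - (1 - z / 2) ^+ n) (fun=> 1)).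
  - apply: nearW => n; have [|/andP[_ h1] h2] := @iterq_bounds n z.
      by rewrite ltW.
    by rewrite h1 andbT; lra.
  - rewrite -[X in _ --> X]subr0; apply: cvgB; first exact: cvg_cst.
    apply: cvg_expr; rewrite ger0_norm; lra.
  - exact: cvg_cst.
move=> y1; case: (ltgtP 0 y) => [y0|y0|<-].
- rewrite gtr0_sg//; apply: pos => //; exact: le_trans (ler_norm _) y1.
- rewrite ltr0_sg// -(opprK y).
  under eq_fun do rewrite iterqN.
  apply: cvgN; apply: pos; first lra.
  by rewrite (le_trans (ler_norm _))// normrN.
- rewrite sgr0 (_ : (fun _ => _) = fun=> 0); first exact: cvg_cst.
  apply/funext; elim=> // n ih; rewrite iterS ih /q; lra.
Qed.

Lemma bpc_sg g : bp g -> bp (fun x => Num.sg (g x)).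
Proof.
move=> bg; have [K gK] := bpc_bounded bg.
set K' := `|K| + 1; have K'0 : 0 < K' by rewrite ltr_wpDl.
pose h x := K'^-1 * g x.
have hle x : D x -> `|h x| <= 1.
  move=> Dx; rewrite normrM normfV (gtr0_norm K'0) mulrC ler_pdivrMr// mul1r.
  by rewrite (le_trans (gK _ Dx))// (le_trans (ler_norm _))// lerDl.
apply: (bpc_lim (u := fun n x => iter n q (h x)) (M := 1)).
- elim=> [|n ih]; first exact: bpc_scale.
  rewrite (_ : (fun x => _) = fun x => 2^-1 * (3 * iter n q (h x) + -1 *
    (iter n q (h x) * (iter n q (h x) * iter n q (h x))))).
    apply: bpc_scale; apply: bpc_add; first exact: bpc_scale.
    by apply: bpc_scale; do 2 apply: bpc_mul => //.
  by apply/funext => x; rewrite iterS {1}/q; field.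
- move=> n x Dx.
  have := hle _ Dx; set z := h x => z1.
  have pos y : 0 <= y -> y <= 1 -> `|iter n q y| <= 1.
    move=> y0 y1; have [|/andP[h1 h2] _] := @iterq_bounds n y; first by rewrite y0.
    by rewrite ger0_norm// (le_trans y0).
  have [z0|z0] := leP 0 z; first by apply: pos => //; exact: le_trans (ler_norm _) z1.
  rewrite -(opprK z) iterqN normrN; apply: pos; first lra.
  by rewrite (le_trans (ler_norm _))// normrN.
- move=> x Dx; rewrite (_ : Num.sg (g x) = Num.sg (h x)); last first.
    by rewrite sgrM (gtr0_sg (x := K'^-1)) ?invr_gt0// mul1r.
  exact/cvg_iterq/hle.
Qed.

Lemma bpc_borel_indic (g : X -> R) (A : set R) :
  (forall t, bp (fun x => Num.sg (g x - t))) -> measurable A ->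
  bp (fun x => \1_A (g x)).
Proof.
move=> bg; rewrite [measurable](RGenOInfty.measurableE R).
move: A; apply: (smallest_sub (X := fun A => bp (fun x => \1_A (g x)))).
  have bC A : bp (fun x => \1_A (g x)) -> bp (fun x => \1_(~` A) (g x)).
    move=> bA; rewrite (_ : (fun=> _) = fun x => 1 + -1 * \1_A (g x)).
      by apply: bpc_add; [exact: bpc_cst|exact: bpc_scale].
    apply/funext => x; rewrite !indicE in_setC.
    by case: (_ \in _) => /=; lra.
  split.
  - rewrite (_ : (fun x => _) = fun=> 0); first exact: bpc_cst.
    by apply/funext => x; rewrite indic0.
  - by move=> A bA; rewrite setTD; exact: bC.
  - move=> F bF; rewrite -[\bigcup__ _]setCK; apply: (bC); rewrite setC_bigcup.
    apply: (bpc_lim (u := fun n x => \prod_(i < n) \1_(~` F i) (g x)) (M := 1)).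
    + elim=> [|n ih].
        by rewrite (_ : (fun=> _) = fun=> 1); [exact: bpc_cst|apply/funext => x; rewrite big_ord0].
      rewrite (_ : (fun=> _) = fun x => (\prod_(i < n) \1_(~` F i) (g x)) * \1_(~` F n) (g x)).
        by apply: bpc_mul => //; exact: bC.
      by apply/funext => x; rewrite big_ord_recr.
    + move=> n x _; rewrite ger0_norm; last by apply: prodr_ge0 => i _; rewrite indicE ler0n.
      by apply: prodr_ile1 => i _; rewrite indicE ler0n /= lern1 leq_b1.
    + move=> x _; have [h|h] := pselect ((\bigcap_i ~` F i) (g x)).
        rewrite indicE mem_set//.
        rewrite (_ : (fun _ => _) = fun=> 1); first exact: cvg_cst.
        apply/funext => n; rewrite big1// => i _; rewrite indicE mem_set//; exact: h.
      rewrite indicE memNset//.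
      have [i Fi] : exists i, F i (g x).
        apply: contrapT => /forallNP hn; apply: h => i _; exact: hn.
      apply: cvg_near_cst; exists i.+1 => // n /= ni.
      rewrite (bigD1 (Ordinal ni))//= indicE memNset ?mul0r//.
move=> _ [t ->].
rewrite (_ : (fun x => _) = fun x => 2^-1 * (Num.sg (g x - t) * Num.sg (g x - t) + Num.sg (g x - t))).
  apply: bpc_scale; apply: bpc_add => //; exact: bpc_mul.
apply/funext => x; rewrite indicE mem_setE in_itv/= andbT.
case: (ltgtP t (g x)) => [h|h|->].
- by rewrite gtr0_sg ?subr_gt0//=; lra.
- by rewrite ltr0_sg ?subr_lt0//=; lra.
- by rewrite subrr sgr0/=; lra.
Qed.

Lemma bpc_borel (g : X -> R) (psi : R -> R) (M : R) :
  (forall t, bp (fun x => Num.sg (g x - t))) ->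
  measurable_fun setT psi -> (forall y, `|psi y| <= M) ->
  bp (fun x => psi (g x)).
Proof.
move=> bg mpsi psiM.
pose p y := psi y + M.
have p0 y : 0 <= p y.
  by have := psiM y; rewrite ler_norml /p => /andP[? _]; lra.
have mp : measurable_fun setT (EFin \o p).
  by apply/measurable_EFinP; apply: measurable_funD.
rewrite (_ : (fun x => _) = fun x => p (g x) + - M); last first.
  by apply/funext => x; rewrite /p addrK.
apply: bpc_add; last exact: bpc_cst.
have p0E y : setT y -> (0 <= (EFin \o p) y)%E by rewrite lee_fin.
pose s := nnsfun_approx measurableT mp.
have sp y : s n y @[n --> \oo] --> p y.
  have := @cvg_nnsfun_approx _ _ _ _ measurableT _ mp p0E y I.
  by move/fine_cvgP => [_]; apply.
have s_le n y : s n y <= p y.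
  have nds : nondecreasing_seq (fun n => s n y).
    by move=> i j ij; have /lefP := nd_nnsfun_approx measurableT mp ij; apply.
  rewrite -(cvg_lim (@Rhausdorff R) (sp y)); apply: nondecreasing_cvgn_le => //.
  by apply/cvg_ex; exists (p y).
apply: (bpc_lim (u := fun n x => s n (g x)) (M := M + M)).
- move=> n; rewrite (_ : (fun x => _) = fun x =>
    \sum_(y <- fset_set (range (s n))) y * \1_(s n @^-1` [set y]) (g x)).
    apply: bpc_sum => y; apply: bpc_scale; apply: bpc_borel_indic => //.
  by apply/funext => x; rewrite fimfunE fsbig_finite.
- move=> n x Dx; rewrite ger0_norm; last exact: fun_ge0.
  rewrite (le_trans (s_le n (g x)))// /p lerD2r.
  exact: le_trans (ler_norm _) (psiM _).
- by move=> x Dx; exact: sp.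
Qed.

End bounded_pointwise_closure.

Section real_integrals.
Import HBNNSimple HBSimple.
Context {d : measure_display} {T : measurableType d} {R : realType}.
Variables (mu : {measure set T -> \bar R}) (D : set T).
Hypothesis mD : measurable D.
Implicit Types f g : T -> R.
Local Notation intg f := (mu.-integrable D (EFin \o f)).

Lemma intg_measurable f : intg f -> measurable_fun D f.
Proof. by move=> /integrableP[/measurable_EFinP]. Qed.

Lemma intg_eq f g : (forall x, D x -> f x = g x) -> intg f -> intg g.
Proof.
by move=> fg; apply: eq_integrable => // x; rewrite inE /= => Dx; rewrite fg.
Qed.

Lemma intg_le f g : measurable_fun D f -> (forall x, D x -> `|f x| <= g x) ->
  intg g -> intg f.
Proof.
move=> mf fg; apply: le_integrable => //; first exact/measurable_EFinP.
by move=> x Dx /=; rewrite lee_fin (le_trans (fg _ Dx)) ?ler_norm.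
Qed.

Lemma intg_add f g : intg f -> intg g -> intg (fun x => f x + g x).
Proof. exact: integrableD. Qed.

Lemma intg_sub f g : intg f -> intg g -> intg (fun x => f x - g x).
Proof. exact: integrableB. Qed.

Lemma intg_scale (c : R) f : intg f -> intg (fun x => c * f x).
Proof. exact: integrableZl. Qed.

Lemma intg_norm f : intg f -> intg (fun x => `|f x|).
Proof. exact: integrable_norm. Qed.

Lemma intg_sum (I : Type) (s : seq I) (F : I -> T -> R) :
  (forall i, intg (F i)) -> intg (fun x => \sum_(i <- s) F i x).
Proof.
move=> h; elim: s => [|i s ih].
  apply: (intg_eq (f := fun=> 0)) => [x _|]; first by rewrite big_nil.
  exact: integrable0.
apply: (intg_eq (f := fun x => F i x + \sum_(i <- s) F i x)) => [x _|].
  by rewrite big_cons.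
exact: intg_add.
Qed.

Lemma Rintegral_sum (I : Type) (s : seq I) (F : I -> T -> R) :
  (forall i, intg (F i)) ->
  \int[mu]_(x in D) (\sum_(i <- s) F i x) = \sum_(i <- s) \int[mu]_(x in D) F i x.
Proof.
move=> h; elim: s => [|i s ih].
  rewrite big_nil (eq_Rintegral _ (g := fun=> 0)) ?/Rintegral ?integral0//.
  by move=> x _; rewrite big_nil.
rewrite big_cons -ih -RintegralD//; last exact: intg_sum.
by apply: eq_Rintegral => x _; rewrite big_cons.
Qed.

Lemma Rdominated (u : nat -> T -> R) f g :
  (forall n, measurable_fun D (u n)) ->
  (forall x, D x -> u n x @[n --> \oo] --> f x) ->
  (forall n x, D x -> `|u n x| <= g x) -> intg g ->
  intg f /\ (\int[mu]_(x in D) u n x) @[n --> \oo] --> \int[mu]_(x in D) f x.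
Proof.
move=> mu_ uf ug ig.
have mf : measurable_fun D f by apply: measurable_fun_cvg uf.
have igf : intg f.
  apply: intg_le ig => // x Dx.
  by apply: (cvg_norm_le (uf x Dx)) => n; exact: ug.
split=> //.
have h : (\int[mu]_(x in D) (u n x)%:E)%E @[n --> \oo] --> (\int[mu]_(x in D) (f x)%:E)%E.
  apply: (@dominated_cvg _ _ _ mu D mD _ _ (EFin \o g)) => //.
  - by move=> n; exact/measurable_EFinP.
  - by move=> x Dx; apply: cvg_EFin; [exact: nearW|exact: uf].
apply: fine_cvg.
by rewrite fineK//; exact: integrable_fin_num.
Qed.

Lemma intg_bounded f (M : R) : (mu D < +oo)%E -> measurable_fun D f ->
  (forall x, D x -> `|f x| <= M) -> intg f.
Proof.
move=> muD mf fM; apply: measurable_bounded_integrable => //.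
exists M; split; first exact: num_real.
by move=> N MN x Dx; exact: le_trans (fM x Dx) (ltW MN).
Qed.

Lemma intg_mul_bounded f g (M : R) : intg f -> measurable_fun D g ->
  (forall x, D x -> `|g x| <= M) -> intg (fun x => g x * f x).
Proof.
move=> igf mg gM; apply: (intg_le (g := fun x => M * `|f x|)).
- by apply: measurable_funM => //; exact: intg_measurable.
- by move=> x Dx; rewrite normrM ler_wpM2r ?gM.
- exact/intg_scale/intg_norm.
Qed.

End real_integrals.

Section density.
Import HBNNSimple HBSimple.
Context {d d' : measure_display} {T : measurableType d} {S : measurableType d'}
  {R : realType}.
Variables (P : probability T R) (mu : {measure set S -> \bar R}).
Variables (Y : T -> S) (g : S -> R).
Hypotheses (mY : measurable_fun setT Y) (mg : measurable_fun setT g)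
  (g0 : forall x, 0 <= g x)
  (Yg : forall A, measurable A -> P (Y @^-1` A) = (\int[mu]_(x in A) (g x)%:E)%E).

Let mgE : measurable_fun setT (EFin \o g). Proof. exact/measurable_EFinP. Qed.

Lemma ge0_integral_density (f : S -> R) : measurable_fun setT f ->
  (forall x, 0 <= f x) ->
  (\int[P]_w (f (Y w))%:E = \int[mu]_x (f x * g x)%:E)%E.
Proof.
move=> mf f0.
have mfE : measurable_fun setT (EFin \o f) by exact/measurable_EFinP.
have f0E y : setT y -> (0 <= (EFin \o f) y)%E by rewrite lee_fin.
pose s := nnsfun_approx measurableT mfE.
have sf y : (s n y)%:E @[n --> \oo] --> (f y)%:E.
  exact: (@cvg_nnsfun_approx _ _ _ _ measurableT _ mfE f0E y I).
have nds y : nondecreasing_seq (fun n => s n y).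
  by move=> i j ij; have /lefP := nd_nnsfun_approx measurableT mfE ij; apply.
have step n : (\int[P]_w (s n (Y w))%:E = \int[mu]_x (s n x * g x)%:E)%E.
  have pos r y : 0 <= r * \1_(s n @^-1` [set r]) y.
    rewrite indicE; case: (boolP (y \in _)) => [|_]; last by rewrite mulr0.
    by rewrite inE/= => <-; rewrite mulr1 fun_ge0.
  have sE y : (s n y)%:E =
      (\sum_(r \in range (s n)) (r * \1_(s n @^-1` [set r]) y)%:E)%E.
    by rewrite {1}fimfunE !fsbig_finite//= sumEFin.
  have sgE y : (s n y * g y)%:E =
      (\sum_(r \in range (s n)) (r * \1_(s n @^-1` [set r]) y * g y)%:E)%E.
    by rewrite {1}fimfunE !fsbig_finite//= mulr_suml sumEFin.
  rewrite (eq_integral _ _ (fun w _ => sE (Y w))).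
  rewrite [RHS](eq_integral _ _ (fun x _ => sgE x)).
  rewrite [LHS]ge0_integral_fsum//; last 2 first.
  - move=> r; apply/measurable_EFinP/measurable_funM => //.
    by apply: measurableT_comp mY; exact: measurable_indic.
  - by move=> r x _; rewrite lee_fin pos.
  rewrite [RHS]ge0_integral_fsum//; last 2 first.
  - by move=> r; apply/measurable_EFinP; do 2 apply: measurable_funM => //; exact: measurable_indic.
  - by move=> r x _; rewrite lee_fin mulr_ge0.
  apply: eq_fsbigr => r; rewrite inE/= => -[x0 _ rx0].
  have r0 : 0 <= r by rewrite -rx0 fun_ge0.
  set A := s n @^-1` [set r].
  have mA : measurable A by exact: measurable_sfunP.
  have mYA : measurable (Y @^-1` A) by rewrite -[_ @^-1` _]setTI; exact: mY.
  transitivity (r%:E * P (Y @^-1` A))%E.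
    rewrite (eq_integral (fun w => (r%:E * (\1_(Y @^-1` A) w)%:E)%E))//.
    rewrite ge0_integralZl_EFin//; first by rewrite integral_indic// setIT.
    exact/measurable_EFinP/measurable_indic.
  rewrite (eq_integral (fun x => (r%:E * (\1_A x * g x)%:E)%E)); last first.
    by move=> x _; rewrite -EFinM mulrA.
  rewrite ge0_integralZl_EFin//; last 2 first.
  - by move=> x _; rewrite lee_fin mulr_ge0.
  - by apply/measurable_EFinP/measurable_funM => //; exact: measurable_indic.
  rewrite Yg// integral_mkcond; congr (_ * _)%E; apply: eq_integral => x _.
  by rewrite patchE indicE; case: ifPn => _; rewrite ?mul1r ?mul0r.
have h1 : (\int[P]_w (s n (Y w))%:E)%E @[n --> \oo] --> (\int[P]_w (f (Y w))%:E)%E.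
  rewrite (_ : (\int[P]_w (f (Y w))%:E)%E =
      \int[P]_w (fun w => limn (fun n => (s n (Y w))%:E)) w)%E.
    apply: cvg_monotone_convergence => //.
    - by move=> n; apply/measurable_EFinP; apply: measurableT_comp.
    - by move=> n x _; rewrite lee_fin fun_ge0.
    - by move=> x _ i j ij; rewrite lee_fin nds.
  by apply: eq_integral => w _; apply/esym/cvg_lim => //; exact: sf.
have h2 : (\int[mu]_x (s n x * g x)%:E)%E @[n --> \oo] --> (\int[mu]_x (f x * g x)%:E)%E.
  rewrite (_ : (\int[mu]_x (f x * g x)%:E)%E =
      \int[mu]_x (fun x => limn (fun n => (s n x * g x)%:E)) x)%E.
    apply: cvg_monotone_convergence => //.
    - by move=> n; apply/measurable_EFinP/measurable_funM.
    - by move=> n x _; rewrite lee_fin mulr_ge0// fun_ge0.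
    - by move=> x _ i j ij; rewrite lee_fin ler_wpM2r ?nds.
  apply: eq_integral => w _; apply/esym/cvg_lim => //.
  under eq_fun do rewrite EFinM.
  by rewrite EFinM; apply: cvgeZr => //; exact: sf.
rewrite -(cvg_lim (@ereal_hausdorff R) h1) -(cvg_lim (@ereal_hausdorff R) h2).
by congr (limn _); apply/funext => n; exact: step.
Qed.

Lemma intg_density (f : S -> R) : measurable_fun setT f ->
  mu.-integrable setT (EFin \o (fun x => f x * g x)) ->
  P.-integrable setT (EFin \o (fun w => f (Y w))).
Proof.
move=> mf /integrableP[_ h]; apply/integrableP; split.
  by apply/measurable_EFinP; exact: measurableT_comp mY.
rewrite /= (@ge0_integral_density (fun x => `|f x|))//; last first.
  exact: measurableT_comp.
move: h; congr (_ < _)%E; apply: eq_integral => x _ /=.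
by rewrite normrM (ger0_norm (g0 x)).
Qed.

Lemma Rintegral_density (f : S -> R) : measurable_fun setT f ->
  mu.-integrable setT (EFin \o (fun x => f x * g x)) ->
  \int[P]_w f (Y w) = \int[mu]_x (f x * g x).
Proof.
move=> mf igf.
pose fp x := Num.max (f x) 0; pose fn x := Num.max (- f x) 0.
have fE x : f x = fp x - fn x.
  by rewrite /fp /fn; case: (leP (f x) 0); case: (leP (- f x) 0); lra.
have fp_le x : `|fp x| <= `|f x|.
  by rewrite /fp; case: (leP (f x) 0); rewrite ?normr0// normr_ge0.
have fn_le x : `|fn x| <= `|f x|.
  by rewrite /fn; case: (leP (- f x) 0); rewrite ?normr0 ?normrN// normr_ge0.
have mfp : measurable_fun setT fp by apply: measurable_maxr.
have mfn : measurable_fun setT fn.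
  by apply: measurable_maxr => //; exact: measurableT_comp.
have fp0 x : 0 <= fp x by rewrite /fp le_max lexx orbT.
have fn0 x : 0 <= fn x by rewrite /fn le_max lexx orbT.
have ig (u : S -> R) : measurable_fun setT u -> (forall x, `|u x| <= `|f x|) ->
    mu.-integrable setT (EFin \o (fun x => u x * g x)).
  move=> mu_ ule; apply: (intg_le _ (g := fun x => `|f x * g x|)) => //.
  - exact: measurable_funM.
  - by move=> x _; rewrite !normrM ler_wpM2r.
  - exact: intg_norm.
rewrite (eq_Rintegral _ (g := fun w => fp (Y w) - fn (Y w))); last first.
  by move=> w _; rewrite fE.
rewrite RintegralB//; [|by apply: intg_density => //; exact: ig..].
rewrite (eq_Rintegral _ (g := fun x => fp x * g x - fn x * g x)); last first.
  by move=> w _; rewrite fE mulrBl.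
rewrite RintegralB//; [|exact: ig..].
by rewrite /Rintegral !ge0_integral_density.
Qed.

End density.

(** * Moments of the normal and Laplace laws *)

Section derivatives.
Context {R : realType}.
Implicit Types (F f g : R -> R) (x y : R).
Local Notation leb := (@lebesgue_measure R).

(* Unlike [is_derive], not a type class, so that derivatives can be left to
   unification. *)
Definition has_derive F x a := is_derive x 1 F a.

Lemma has_derive_eq F x a b : has_derive F x a -> a = b -> has_derive F x b.
Proof. by move=> + <-. Qed.

Lemma has_derive_mul f g x a b : has_derive f x a -> has_derive g x b ->
  has_derive (fun y => f y * g y) x (f x * b + g x * a).
Proof. by move=> hf hg; have := is_deriveM hf hg. Qed.

Lemma has_derive_scale f x c a : has_derive f x a ->
  has_derive (fun y => c * f y) x (c * a).
Proof. by move=> hf; have := is_deriveZ c hf. Qed.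

Lemma has_derive_affine c e x : has_derive (fun y => c * y + e) x c.
Proof.
have h : has_derive (fun y => c * y) x (c * 1).
  by apply: has_derive_scale; exact: is_derive_id.
by have := is_deriveD h (is_derive_cst e x 1); rewrite mulr1 addr0.
Qed.

Lemma has_derive_expR F x a : has_derive F x a ->
  has_derive (fun y => expR (F y)) x (expR (F x) * a).
Proof. by move=> h; have := is_derive1_comp (is_derive_expR (F x)) h. Qed.

Lemma has_derive_cos F x a : has_derive F x a ->
  has_derive (fun y => cos (F y)) x (- sin (F x) * a).
Proof. by move=> h; have := is_derive1_comp (is_derive_cos (F x)) h. Qed.

Lemma has_derive_sin F x a : has_derive F x a ->
  has_derive (fun y => sin (F y)) x (cos (F x) * a).
Proof. by move=> h; have := is_derive1_comp (is_derive_sin (F x)) h. Qed.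

Lemma has_derive_continuous F f : (forall x, has_derive F x (f x)) -> continuous F.
Proof.
by move=> h x; apply: differentiable_continuous; apply/derivable1_diffP; case: (h x).
Qed.

Lemma continuous_mul f g : continuous f -> continuous g ->
  continuous (fun x => f x * g x).
Proof. by move=> cf cg x; exact: cvgM (cf x) (cg x). Qed.

Lemma FTC_is_derive F f a b : a < b -> (forall x, has_derive F x (f x)) ->
  continuous f -> \int[leb]_(x in `[a, b]) f x = F b - F a.
Proof.
move=> ab dF cf; have cF := has_derive_continuous dF.
rewrite /Rintegral (@continuous_FTC2 _ _ F)//.
- exact: continuous_subspaceT.
- split; first by move=> x _; case: (dF x).
  + exact/cvg_at_right_filter/cF.
  + exact/cvg_at_left_filter/cF.
- by move=> x _; rewrite derive1E; have [_ ->] := dF x.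
Qed.

Lemma Rintegral_derive_eq0 F f m K : (forall x, has_derive F x (f x)) ->
  continuous f -> leb.-integrable setT (EFin \o f) ->
  (forall x, `|F x| * `|x - m| <= K) -> \int[leb]_x f x = 0.
Proof.
move=> dF cf intf FK.
pose a n := m - n.+1%:R; pose b n := m + n.+1%:R.
have ab n : a n < b n by rewrite /a /b; have := ltr0Sn R n; lra.
pose u n := f \_ (`[a n, b n]%classic).
have [_ h] : leb.-integrable setT (EFin \o f) /\
    (\int[leb]_x u n x) @[n --> \oo] --> \int[leb]_x f x.
  apply: (@Rdominated _ _ _ leb setT measurableT u f (fun x => `|f x|)) => //.
  - move=> n; rewrite /u; apply: (proj1 (measurable_restrictT f (measurable_itv _))).
    exact: measurable_funTS (continuous_measurable_fun cf).
  - move=> x _; apply: cvg_near_cst.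
    have [k /ltW hk] : exists k : nat, `|x - m| < k%:R.
      by exists (Num.trunc `|x - m|).+1; rewrite truncnS_gt.
    exists k => // n /= kn; rewrite /u patchE mem_set//= in_itv/= /a /b.
    have : k%:R <= n.+1%:R :> R by rewrite ler_nat ltnW.
    by move: hk; rewrite ler_norml => /andP[]; lra.
  - by move=> n x _; rewrite /u patchE; case: ifP => _; rewrite ?normr0.
  - exact: intg_norm.
have uE n : \int[leb]_x u n x = F (b n) - F (a n).
  by rewrite -(FTC_is_derive (ab n) dF cf) [RHS]Rintegral_mkcond.
have h0 : (\int[leb]_x u n x) @[n --> \oo] --> 0.
  apply/norm_cvg0P; apply: (@squeeze_cvgr _ _ _ _ (fun=> 0) (fun n => 2 * K * harmonic n)).
  - apply: nearW => n; rewrite normr_ge0/= uE.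
    have n0 : 0 < n.+1%:R :> R by rewrite ltr0Sn.
    have := FK (b n); have := FK (a n).
    rewrite (_ : a n - m = - n.+1%:R) ?normrN; last by rewrite /a; lra.
    rewrite (_ : b n - m = n.+1%:R); last by rewrite /b; lra.
    rewrite (gtr0_norm n0) /harmonic -!ler_pdivlMr// => ha hb.
    rewrite (le_trans (ler_normB _ _))//; move: ha hb => /=; set w := K / _.
    by rewrite -mulrA -/w; lra.
  - exact: cvg_cst.
  - by rewrite -[X in _ --> X](mulr0 (2 * K)); apply: cvgM; [exact: cvg_cst|exact: cvg_harmonic].
by rewrite -(cvg_lim (@Rhausdorff R) h) (cvg_lim (@Rhausdorff R) h0).
Qed.

End derivatives.

Section normal_moments.
Context {R : realType} (m s : R).
Implicit Types (x t b C K F : R).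
Hypothesis s0 : 0 < s.
Local Notation leb := (@lebesgue_measure R).
Local Notation p := (normal_pdf m s).

Let pE x : p x = normal_peak s * expR (- (x - m) ^+ 2 / (s ^+ 2 *+ 2)).
Proof. by rewrite normal_pdfE ?gt_eqF. Qed.

Let p0 x : 0 <= p x. Proof. exact: normal_pdf_ge0. Qed.

Let s20 : 0 < s ^+ 2. Proof. by rewrite exprn_gt0. Qed.

Lemma has_derive_normal_pdf x : has_derive p x (- (x - m) / s ^+ 2 * p x).
Proof.
have -> : p = fun x => normal_peak s * expR ((- (s ^+ 2 *+ 2)^-1 * x + m / (s ^+ 2 *+ 2)) * (x - m)).
  apply/funext => y; rewrite pE; congr (_ * expR _); field.
  by rewrite gt_eqF.
have h : has_derive (fun x => (- (s ^+ 2 *+ 2)^-1 * x + m / (s ^+ 2 *+ 2)) * (1 * x + - m)) x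
    (- (x - m) / s ^+ 2).
  apply: has_derive_eq.
    apply: has_derive_mul; exact: has_derive_affine.
  by rewrite /=; field; rewrite gt_eqF.
have h' : has_derive (fun x => (- (s ^+ 2 *+ 2)^-1 * x + m / (s ^+ 2 *+ 2)) * (x - m)) x
    (- (x - m) / s ^+ 2).
  by move: h; under eq_fun do rewrite mul1r.
apply: has_derive_eq.
  by apply: has_derive_scale; apply: has_derive_expR; exact: h'.
by rewrite /=; ring.
Qed.

Lemma continuous_normal_pdf_pos : continuous p.
Proof. by apply: continuous_normal_pdf; rewrite gt_eqF. Qed.

(* [y exp (- y / 2) <= const * exp (- y / 8)] dominates the second moment by a
   normal density of larger variance. *)
Lemma normal_pdf_sqr_le : exists K, 0 <= K /\ forall x,
  (1 + (x - m) ^+ 2) * p x <= K * normal_pdf m (2 * s) x.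
Proof.
have pk : 0 < normal_peak (2 * s) by apply: normal_peak_gt0; rewrite gt_eqF// mulr_gt0.
exists (normal_peak s / normal_peak (2 * s) * (1 + 8 * s ^+ 2)); split.
  rewrite mulr_ge0 ?divr_ge0 ?normal_peak_ge0// addr_ge0// mulr_ge0// ltW//.
move=> x; rewrite pE (normal_pdfE m (s := 2 * s)) ?gt_eqF ?mulr_gt0// /normal_fun.
set z := (x - m) ^+ 2; have z0 : 0 <= z by rewrite sqr_ge0.
set y := z / (8 * s ^+ 2).
have y0 : 0 <= y by rewrite divr_ge0// mulr_ge0// ltW.
have -> : - z / (s ^+ 2 *+ 2) = - y + (- (3 * y)) by rewrite /y; field; rewrite gt_eqF.
have -> : - z / ((2 * s) ^+ 2 *+ 2) = - y by rewrite /y; field; rewrite gt_eqF.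
have zE : z = 8 * s ^+ 2 * y by rewrite /y; field; rewrite gt_eqF.
rewrite expRD.
have e0 := expR_ge0 (- y).
have e3 : expR (- (3 * y)) <= 1 by rewrite -[leRHS]expR0 ler_expR; lra.
have e30 := expR_ge0 (- (3 * y)).
have ye : y * expR (- (3 * y)) <= 1.
  rewrite expRN ler_pdivrMr ?expR_gt0// mul1r.
  by apply: le_trans (expR_ge1Dx _); lra.
rewrite [leRHS](_ : _ = normal_peak s * expR (- y) * (1 + 8 * s ^+ 2)); last first.
  by rewrite /=; field; rewrite gt_eqF.
rewrite [leLHS](_ : _ = normal_peak s * expR (- y) * ((1 + z) * expR (- (3 * y)))); last by ring.
rewrite ler_wpM2l ?mulr_ge0 ?normal_peak_ge0// zE.
have : 8 * s ^+ 2 * (y * expR (- (3 * y))) <= 8 * s ^+ 2 * 1.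
  by rewrite ler_wpM2l// mulr_ge0// ltW.
by lra.
Qed.

Lemma intg_normal_poly (f : R -> R) (C : R) : continuous f ->
  (forall x, `|f x| <= C * (1 + (x - m) ^+ 2)) ->
  leb.-integrable setT (EFin \o (fun x => f x * p x)).
Proof.
move=> cf fC; have [K [K0 hK]] := normal_pdf_sqr_le.
have C0 : 0 <= C.
  have := le_trans (normr_ge0 _) (fC m).
  by rewrite subrr expr0n/= addr0 mulr1.
apply: (@intg_le _ _ _ leb setT measurableT _ (fun x => C * (K * normal_pdf m (2 * s) x))) => //.
- apply: measurable_funM; first exact: continuous_measurable_fun.
  exact: measurable_normal_pdf.
- move=> x _; rewrite normrM (ger0_norm (p0 x)).
  apply: (@le_trans _ _ (C * (1 + (x - m) ^+ 2) * p x)); first by rewrite ler_wpM2r.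
  by rewrite -mulrA ler_wpM2l.
- by apply: intg_scale => //; apply: intg_scale => //; exact: integrable_normal_pdf.
Qed.

(* Decay of the boundary terms in the integrations by parts below. *)
Let decay (C : R) : exists K, forall x F, `|F| <= C * (1 + `|x - m|) * p x ->
  `|F| * `|x - m| <= K.
Proof.
have [K [K0 hK]] := normal_pdf_sqr_le.
exists (`|C| * 2 * (K * normal_peak (2 * s))) => x F FC.
have pk : normal_pdf m (2 * s) x <= normal_peak (2 * s).
  by apply: normal_pdf_ub; rewrite gt_eqF// mulr_gt0.
have := normr_ge0 (x - m); set z := `|x - m| in FC * => z0.
apply: (@le_trans _ _ (C * (1 + z) * p x * z)); first by rewrite ler_wpM2r.
apply: (@le_trans _ _ (`|C| * (1 + z) * p x * z)).
  by do 2 (rewrite ler_wpM2r//); rewrite ler_wpM2r ?ler_norm//; lra.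
rewrite (_ : _ * z = `|C| * ((1 + z) * z * p x)); last by ring.
rewrite -[leRHS]mulrA ler_wpM2l//.
apply: (@le_trans _ _ (2 * ((1 + (x - m) ^+ 2) * p x))).
  rewrite mulrA ler_wpM2r//.
  have -> : (x - m) ^+ 2 = z ^+ 2 by rewrite -normrX ger0_norm ?sqr_ge0.
  by nra.
rewrite ler_wpM2l// (le_trans (hK x))// ler_wpM2l//.
Qed.

Let cm : continuous (fun x => x - m).
Proof. by move=> x; apply: cvgB; [exact: cvg_id|exact: cvg_cst]. Qed.

Let abs_le x : `|x - m| <= 1 + (x - m) ^+ 2.
Proof.
rewrite -(ger0_norm (sqr_ge0 (x - m))) normrX.
by have := normr_ge0 (x - m); set z := `|_|; nra.
Qed.

Lemma intg_normal1 : leb.-integrable setT (EFin \o (fun x => (x - m) * p x)).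
Proof. by apply: (intg_normal_poly (C := 1)) => // x; rewrite mul1r abs_le. Qed.

Lemma intg_normal2 : leb.-integrable setT (EFin \o (fun x => (x - m) ^+ 2 * p x)).
Proof.
apply: (intg_normal_poly (C := 1)) => [|x].
  by under eq_fun do rewrite expr2; exact: continuous_mul.
by rewrite mul1r ger0_norm ?sqr_ge0//; lra.
Qed.

Lemma Rintegral_normal1 : \int[leb]_x ((x - m) * p x) = 0.
Proof.
have [K hK] := decay (s ^+ 2).
apply: (@Rintegral_derive_eq0 _ (fun x => - s ^+ 2 * p x) _ m K).
- move=> x; apply: has_derive_eq.
    by apply: has_derive_scale; exact: has_derive_normal_pdf.
  by rewrite /=; field; rewrite gt_eqF.
- by move=> x; apply: cvgM; [exact: cm|exact: continuous_normal_pdf_pos].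
- exact: intg_normal1.
- move=> x; apply: hK; rewrite normrM normrN (ger0_norm (ltW s20)) (ger0_norm (p0 x)).
  by rewrite ler_wpM2r// -[leLHS]mulr1 ler_wpM2l ?(ltW s20)// lerDl.
Qed.

Lemma Rintegral_normal_pdf : \int[leb]_x p x = 1.
Proof. by rewrite /Rintegral integral_normal_pdf. Qed.

Lemma Rintegral_normal2 : \int[leb]_x ((x - m) ^+ 2 * p x) = s ^+ 2.
Proof.
have [K hK] := decay (s ^+ 2).
have ip : leb.-integrable setT (EFin \o p) by exact: integrable_normal_pdf.
have : \int[leb]_x ((x - m) ^+ 2 * p x - s ^+ 2 * p x) = 0.
  apply: (@Rintegral_derive_eq0 _ (fun x => - s ^+ 2 * ((1 * x + - m) * p x)) _ m K).
  - move=> x; apply: has_derive_eq.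
      apply: has_derive_scale; apply: has_derive_mul; first exact: has_derive_affine.
      exact: has_derive_normal_pdf.
    by rewrite /=; field; rewrite gt_eqF.
  - move=> x; apply: cvgB; apply: cvgM; try exact: continuous_normal_pdf_pos.
      exact: (continuous_mul cm cm).
    exact: cvg_cst.
  - by apply: intg_sub => //; [exact: intg_normal2|exact: intg_scale].
  - move=> x; apply: hK; rewrite !normrM normrN mul1r (ger0_norm (ltW s20)) (ger0_norm (p0 x)).
    by rewrite mulrA ler_wpM2r// ler_wpM2l ?(ltW s20)// lerDr.
rewrite RintegralB//; [|exact: intg_normal2|exact: intg_scale].
rewrite RintegralZl// Rintegral_normal_pdf; lra.
Qed.

Let trig_arg t b x : has_derive (fun x => t * (x - m) + b) x t.
Proof.
have -> : (fun x => t * (x - m) + b) = fun x => t * x + (b - t * m).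
  by apply/funext => y; ring.
exact: has_derive_affine.
Qed.

Let ccos t b : continuous (fun x => cos (t * (x - m) + b)).
Proof.
move=> x; apply: continuous_comp; last exact: continuous_cos.
exact: (has_derive_continuous (trig_arg t b)).
Qed.

Let csin t b : continuous (fun x => sin (t * (x - m) + b)).
Proof.
move=> x; apply: continuous_comp; last exact: continuous_sin.
exact: (has_derive_continuous (trig_arg t b)).
Qed.

Let norm_cos (x : R) : `|cos x| <= 1. Proof. by rewrite ler_norml cos_geN1 cos_le1. Qed.
Let norm_sin (x : R) : `|sin x| <= 1. Proof. by rewrite ler_norml sin_geN1 sin_le1. Qed.

Lemma intg_normal_cos t b :
  leb.-integrable setT (EFin \o (fun x => cos (t * (x - m) + b) * p x)).
Proof.
apply: (intg_normal_poly (C := 1)) => [|x]; first exact: ccos.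
by rewrite mul1r (le_trans (norm_cos _))// lerDl sqr_ge0.
Qed.

Let intg_xsin t b :
  leb.-integrable setT (EFin \o (fun x => (x - m) * sin (t * (x - m) + b) * p x)).
Proof.
apply: (intg_normal_poly (C := 1)) => [|x].
  exact: (continuous_mul cm (@csin t b)).
by rewrite mul1r normrM (le_trans _ (abs_le x))// ler_piMr.
Qed.

(* The characteristic function solves [g' = - s^2 t g]. *)
Lemma Rintegral_normal_cos t b :
  \int[leb]_x (cos (t * (x - m) + b) * p x) = expR (- (s ^+ 2 * t ^+ 2 / 2)) * cos b.
Proof.
pose g t := \int[leb]_x (cos (t * (x - m) + b) * p x).
pose S t := \int[leb]_x ((x - m) * sin (t * (x - m) + b) * p x).
have SE t' : S t' = s ^+ 2 * t' * g t'.
  have [K hK] := decay (s ^+ 2).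
  have : \int[leb]_x (s ^+ 2 * t' * (cos (t' * (x - m) + b) * p x)
       - (x - m) * sin (t' * (x - m) + b) * p x) = 0.
    apply: (@Rintegral_derive_eq0 _ (fun x => s ^+ 2 * (sin (t' * (x - m) + b) * p x)) _ m K).
    - move=> x; apply: has_derive_eq.
        apply: has_derive_scale; apply: has_derive_mul; last exact: has_derive_normal_pdf.
        by apply: has_derive_sin; exact: trig_arg.
      by rewrite /=; field; rewrite gt_eqF.
    - move=> x; apply: cvgB.
        apply: cvgM; first exact: cvg_cst.
        by apply: cvgM; [exact: ccos|exact: continuous_normal_pdf_pos].
      apply: cvgM; last exact: continuous_normal_pdf_pos.
      exact: (continuous_mul cm (@csin t' b)).
    - apply: intg_sub => //.
      by apply: intg_scale => //; exact: intg_normal_cos.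
    - move=> x; apply: hK; rewrite normrM (ger0_norm (ltW s20)) normrM (ger0_norm (p0 x)).
      rewrite mulrA ler_wpM2r// ler_wpM2l ?(ltW s20)//.
      by rewrite (le_trans (norm_sin _))// lerDl.
  rewrite RintegralB//; last by apply: intg_scale => //; exact: intg_normal_cos.
  by rewrite RintegralZl//; [rewrite -/(g t') -/(S t'); lra|exact: intg_normal_cos].
have dcos x y : has_derive (fun t => cos (t * (y - m) + b) * p y) x
    (- ((y - m) * sin (x * (y - m) + b) * p y)).
  have h : has_derive (fun t => (y - m) * t + b) x (y - m) by exact: has_derive_affine.
  have h2 : has_derive (fun t => p y * cos ((y - m) * t + b)) x
      (p y * (- sin ((y - m) * x + b) * (y - m))).
    by apply: has_derive_scale; exact: has_derive_cos.
  have -> : (fun t => cos (t * (y - m) + b) * p y) = fun t => p y * cos ((y - m) * t + b).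
    by apply/funext => z; rewrite mulrC (mulrC z).
  by apply: (has_derive_eq h2); rewrite (mulrC x); ring.
have dg t' : has_derive g t' (- (s ^+ 2 * t') * g t').
  pose f t y := cos (t * (y - m) + b) * p y.
  have It' : `]t' - 1, t' + 1[%classic t' by rewrite /= in_itv/=; lra.
  pose G y := `|(y - m) * p y|.
  have d1 x y : partial1of2 f x y = - ((y - m) * sin (x * (y - m) + b) * p y).
    by rewrite partial1of2E; have [_ ->] := dcos x y.
  have h1 : forall x, `]t' - 1, t' + 1[%classic x -> leb.-integrable setT (EFin \o f x).
    by move=> x _; exact: intg_normal_cos.
  have h2 : forall x y, `]t' - 1, t' + 1[%classic x -> [set: R] y -> derivable (f ^~ y) x 1.
    by move=> x y _ _; case: (dcos x y).
  have h3 : forall y, 0 <= G y by move=> y; exact: normr_ge0.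
  have h4 : leb.-integrable setT (EFin \o G) by apply: intg_norm => //; exact: intg_normal1.
  have h5 : forall x y, `]t' - 1, t' + 1[%classic x -> [set: R] y -> `|partial1of2 f x y| <= G y.
    move=> x y _ _; rewrite d1 normrN /G.
    rewrite (_ : _ * p y = (y - m) * p y * sin (x * (y - m) + b)); last by ring.
    by rewrite normrM ler_piMr.
  have hd := derivable_under_integral measurableT It' h1 h2 h3 h4 h5.
  have he := differentiation_under_integral measurableT It' h1 h2 h3 h4 h5.
  apply: DeriveDef; first exact: hd.
  rewrite -derive1E.
  transitivity (\int[leb]_y partial1of2 f t' y); first exact: he.
  transitivity (\int[leb]_y (-1 * ((y - m) * sin (t' * (y - m) + b) * p y))).
    by apply: eq_Rintegral => y _; rewrite d1 mulN1r.
  rewrite RintegralZl//.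
  by rewrite -/(S t') SE; ring.
pose h t := expR (s ^+ 2 / 2 * t * t) * g t.
have dh t' : has_derive h t' 0.
  apply: has_derive_eq.
    apply: has_derive_mul; last exact: dg.
    apply: has_derive_expR.
    apply: has_derive_mul; last exact: is_derive_id.
    by apply: has_derive_scale; exact: is_derive_id.
  by rewrite /=; field.
have := is_derive_0_is_cst t 0 dh; rewrite /h !mulr0 expR0 mul1r.
have -> : g 0 = cos b.
  transitivity (\int[leb]_x (cos b * p x)).
    by apply: eq_Rintegral => x _; rewrite mul0r add0r.
  by rewrite RintegralZl ?Rintegral_normal_pdf ?mulr1//; exact: integrable_normal_pdf.
rewrite -/(g t) => <-; rewrite mulrA -expRD (_ : _ + _ = 0) ?expR0 ?mul1r//.
by field.
Qed.

End normal_moments.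

Section laplace_moments.
Context {R : realType}.
Local Notation leb := (@lebesgue_measure R).

Definition laplace_pdf (w : R) : R := 2^-1 * expR (- `|w|).

Let continuous_expN (c : R) : continuous (fun w : R => expR (- (c * `|w|))).
Proof.
move=> w; apply: continuous_comp; last exact: continuous_expR.
apply: cvgN; apply: cvgM; first exact: cvg_cst.
exact: norm_continuous.
Qed.

Let intg_exp_half : leb.-integrable setT (EFin \o (fun w : R => expR (- (2^-1 * `|w|)))).
Proof.
apply/integrableP; split.
  apply/measurable_EFinP; exact: continuous_measurable_fun (@continuous_expN _).
under eq_integral => w _ do rewrite /= ger0_norm ?expR_ge0//.
have e0 (x : R) : 0 <= expR (- (2^-1 * `|x|)) by exact: expR_ge0.
have eN : (fun x : R => expR (- (2^-1 * `|x|))) =1 (fun x : R => expR (- (2^-1 * `|x|))) \o -%R.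
  by move=> x; rewrite /= normrN.
rewrite (ge0_symfun_integralT e0 (@continuous_expN _) eN).
rewrite (_ : [set x : R | 0 <= x] = `[0, +oo[%classic); last by rewrite set_itvE.
have half0 : (0 : R) < 2^-1 by rewrite invr_gt0.
have ie : leb.-integrable `[0, +oo[ (EFin \o exponential_pdf (2^-1)).
  apply: (integrableS measurableT) => //; exact: integrable_exponential_pdf.
have : leb.-integrable `[0, +oo[ (EFin \o (fun w : R => expR (- (2^-1 * `|w|)))).
  apply: (@intg_eq _ _ _ leb `[0, +oo[%classic _ (fun w : R => 2 * exponential_pdf (2^-1) w)) => //.
    move=> x; rewrite /= in_itv/= andbT => x0.
    by rewrite exponential_pdfE// ger0_norm// mulrA divff// mul1r mulNr.
  exact: intg_scale.
move=> /integrable_lty h; rewrite lte_mul_pinfty//; exact: h.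
Qed.

Lemma laplace_pdf_ge0 w : 0 <= laplace_pdf w.
Proof. by rewrite mulr_ge0 ?invr_ge0 ?expR_ge0. Qed.

Lemma measurable_laplace_pdf : measurable_fun setT laplace_pdf.
Proof.
apply: measurable_funM => //.
have := continuous_measurable_fun (@continuous_expN 1).
by under eq_fun do rewrite mul1r.
Qed.

Lemma laplace_pdfN w : laplace_pdf (- w) = laplace_pdf w.
Proof. by rewrite /laplace_pdf normrN. Qed.

Lemma intg_laplace4 (f : R -> R) (C : R) : measurable_fun setT f ->
  (forall x, `|f x| <= C * (1 + x ^+ 4)) ->
  leb.-integrable setT (EFin \o (fun x => f x * laplace_pdf x)).
Proof.
move=> mf fC.
have C0 : 0 <= C.
  by have := le_trans (normr_ge0 _) (fC 0); rewrite expr0n/= addr0 mulr1.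
apply: (@intg_le _ _ _ leb setT measurableT _
  (fun x => C * 2^-1 * (1 + 384) * expR (- (2^-1 * `|x|)))) => //.
- apply: measurable_funM => //; exact: measurable_laplace_pdf.
- move=> x _; rewrite normrM (ger0_norm (laplace_pdf_ge0 x)) /laplace_pdf.
  apply: (@le_trans _ _ (C * (1 + x ^+ 4) * (2^-1 * expR (- `|x|)))).
    by rewrite ler_wpM2r// laplace_pdf_ge0.
  set y := 2^-1 * `|x|; have y0 : 0 <= y by rewrite mulr_ge0 ?invr_ge0.
  have -> : - `|x| = - y + - y by rewrite /y; field.
  have -> : x ^+ 4 = 16 * y ^+ 4.
    rewrite /y exprMn -normrX (ger0_norm (x := x ^+ 4)); last by rewrite exprn_even_ge0.
    by field.
  have e1 : expR (- y) <= 1 by rewrite -[leRHS]expR0 ler_expR; lra.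
  have e0 := expR_ge0 (- y).
  have ye : y ^+ 4 * expR (- y) <= 24.
    rewrite expRN ler_pdivrMr ?expR_gt0//.
    have := expR_ge1Dxn 3 y0; rewrite (_ : 4`! = 24)//; lra.
  rewrite expRD [leLHS](_ : _ = C * 2^-1 * (expR (- y) + 16 * (y ^+ 4 * expR (- y))) * expR (- y)); last by ring.
  rewrite ler_wpM2r// ler_wpM2l ?mulr_ge0 ?invr_ge0//; lra.
- by apply: intg_scale => //; exact: intg_exp_half.
Qed.

Definition laplace_moment4 : R := \int[leb]_x (x ^+ 4 * laplace_pdf x).

Lemma laplace_moment4_ge0 : 0 <= laplace_moment4.
Proof.
apply: Rintegral_ge0 => x _; rewrite mulr_ge0 ?laplace_pdf_ge0//.
by rewrite (_ : 4%N = (2 * 2)%N)// exprM sqr_ge0.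
Qed.

Context {d : measure_display} {T : measurableType d} {P : probability T R}.
Variable W : {RV P >-> R}.
Hypothesis lapW : standard_laplace W.

Let mW : measurable_fun setT (W : T -> R). Proof. exact: measurable_funPT. Qed.

Let lapW' A : measurable A ->
  P ((W : T -> R) @^-1` A) = (\int[leb]_(x in A) (laplace_pdf x)%:E)%E.
Proof. exact: lapW. Qed.

Lemma intg_laplace (f : R -> R) (C : R) : measurable_fun setT f ->
  (forall x, `|f x| <= C * (1 + x ^+ 4)) ->
  P.-integrable setT (EFin \o (fun w => f (W w))).
Proof.
move=> mf fC.
apply: (@intg_density _ _ T (measurableTypeR R) R P leb W laplace_pdf mW measurable_laplace_pdf laplace_pdf_ge0 lapW') => //.
exact: intg_laplace4 fC.
Qed.

Lemma Rintegral_laplace4 : \int[P]_w (W w ^+ 4) = laplace_moment4.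
Proof.
have m4 : measurable_fun setT (fun x : R => x ^+ 4) by exact: exprn_measurable.
apply: (@Rintegral_density _ _ T (measurableTypeR R) R P leb W laplace_pdf mW measurable_laplace_pdf laplace_pdf_ge0 lapW' _ m4).
apply: (intg_laplace4 (C := 1)) => // x.
by rewrite mul1r ger0_norm ?lerDr// exprn_even_ge0.
Qed.

Lemma Rintegral_laplace1 : \int[P]_w W w = 0.
Proof.
have mid : measurable_fun setT (@id R) by exact: measurable_id.
have il : leb.-integrable setT (EFin \o (fun x : R => x * laplace_pdf x)).
  apply: (intg_laplace4 (C := 1)) => // x; rewrite mul1r.
  have -> : x ^+ 4 = `|x| ^+ 4 by rewrite -normrX ger0_norm// exprn_even_ge0.
  by have := normr_ge0 x; set y := `|x| => y0; have : 0 <= y ^+ 4; [exact: exprn_ge0|];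
    have [y1|y1] := leP y 1; [lra|move=> _; have : y <= y ^+ 4; [rewrite ler_eXnr// ltW|lra]].
have E1 : \int[P]_w W w = \int[leb]_x (x * laplace_pdf x).
  exact: (@Rintegral_density _ _ T (measurableTypeR R) R P leb W laplace_pdf mW measurable_laplace_pdf laplace_pdf_ge0 lapW' _ mid il).
have lapNW A : measurable A -> P ((fun w => - W w) @^-1` A) =
    (\int[leb]_(x in A) (laplace_pdf x)%:E)%E.
  move=> mA.
  have mNA : measurable ((-%R : R -> R) @^-1` A).
    by rewrite -[_ @^-1` _]setTI; exact: (oppr_measurable measurableT mA).
  rewrite (_ : _ @^-1` A = (W : T -> R) @^-1` ((-%R : R -> R) @^-1` A))// lapW'//.
  rewrite [RHS](eq_measure_integral (pushforward leb (-%R : _ -> measurableTypeR R)))//; last first.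
    by move=> B mB _; exact/esym/lebesgue_measureN.
  rewrite ge0_integral_pushforward//.
  - by apply: eq_integral => x _ /=; rewrite laplace_pdfN.
  - by apply/measurable_funTS/measurable_EFinP; exact: measurable_laplace_pdf.
  - by move=> x _; rewrite lee_fin laplace_pdf_ge0.
have mNW : measurable_fun setT (fun w => - W w) by exact: measurableT_comp.
have E2 : \int[P]_w (- W w) = \int[leb]_x (x * laplace_pdf x).
  exact: (@Rintegral_density _ _ T (measurableTypeR R) R P leb _ laplace_pdf mNW measurable_laplace_pdf laplace_pdf_ge0 lapNW _ mid il).
have iW : P.-integrable setT (EFin \o (W : T -> R)).
  exact: (@intg_density _ _ T (measurableTypeR R) R P leb W laplace_pdf mW measurable_laplace_pdf laplace_pdf_ge0 lapW' _ mid il).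
have E3 : \int[P]_w (- W w) = - \int[P]_w W w.
  rewrite (eq_Rintegral _ (g := fun w => -1 * W w)); last by move=> w _; rewrite mulN1r.
  by rewrite RintegralZl// mulN1r.
by move: E3; rewrite E2 E1 => /eqP; rewrite -subr_eq0 opprK -mulr2n mulrn_eq0/= => /eqP.
Qed.

End laplace_moments.

(** * Bounded Borel functions *)

Section bounded_measurable.
Context {d : measure_display} {T : measurableType d} {R : realType}.
Implicit Types f g : T -> R.

Definition bm f := measurable_fun setT f /\ exists M : R, forall x, `|f x| <= M.

Lemma bm_cst (c : R) : bm (fun=> c).
Proof. by split; [exact: measurable_cst|exists `|c|]. Qed.

Lemma bm_add f g : bm f -> bm g -> bm (fun x => f x + g x).
Proof.
move=> [mf [M fM]] [mg [N gN]]; split; first exact: measurable_funD.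
by exists (M + N) => x; rewrite (le_trans (ler_normD _ _))// lerD.
Qed.

Lemma bm_mul f g : bm f -> bm g -> bm (fun x => f x * g x).
Proof.
move=> [mf [M fM]] [mg [N gN]]; split; first exact: measurable_funM.
by exists (M * N) => x; rewrite normrM ler_pM.
Qed.

Lemma bm_scale (c : R) f : bm f -> bm (fun x => c * f x).
Proof. by move=> bf; apply: bm_mul => //; exact: bm_cst. Qed.

Lemma bm_sub f g : bm f -> bm g -> bm (fun x => f x - g x).
Proof.
move=> bf bg; have := bm_add bf (bm_scale (-1) bg).
by under eq_fun do rewrite mulN1r.
Qed.

Lemma bm_norm f : bm f -> bm (fun x => `|f x|).
Proof.
move=> [mf [M fM]]; split; first exact: measurableT_comp.
by exists M => x; rewrite normr_id.
Qed.

Lemma bm_lim (u : nat -> T -> R) f (M : R) : (forall n, bm (u n)) ->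
  (forall n x, `|u n x| <= M) -> (forall x, u n x @[n --> \oo] --> f x) -> bm f.
Proof.
move=> bu uM uf; split.
  by apply: (measurable_fun_cvg (h := u)) => [n|x _]; [case: (bu n)|exact: uf].
by exists M => x; apply: (cvg_norm_le (uf x)).
Qed.

Lemma bm_indic (A : set T) : measurable A -> bm (fun x => \1_A x : R).
Proof.
move=> mA; split; first exact: measurable_indic.
by exists 1 => x; rewrite indicE ger0_norm// lern1 leq_b1.
Qed.

Variable P : probability T R.

Lemma intg_bm f : bm f -> P.-integrable setT (EFin \o f).
Proof.
move=> [mf [M fM]]; apply: (@intg_bounded _ _ _ P setT measurableT f M) => //.
by rewrite (_ : _ setT = 1%E) ?ltry//; exact: probability_setT.
Qed.

Lemma ExD f g : bm f -> bm g ->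
  \int[P]_w (f w + g w) = \int[P]_w f w + \int[P]_w g w.
Proof. by move=> bf bg; apply: RintegralD => //; exact: intg_bm. Qed.

Lemma ExB f g : bm f -> bm g ->
  \int[P]_w (f w - g w) = \int[P]_w f w - \int[P]_w g w.
Proof. by move=> bf bg; apply: RintegralB => //; exact: intg_bm. Qed.

Lemma ExZ (c : R) f : bm f -> \int[P]_w (c * f w) = c * \int[P]_w f w.
Proof. by move=> bf; apply: RintegralZl => //; exact: intg_bm. Qed.

Lemma Ex_le f g : bm f -> bm g -> (forall x, f x <= g x) ->
  \int[P]_w f w <= \int[P]_w g w.
Proof.
by move=> bf bg fg; apply: le_Rintegral => //; exact: intg_bm.
Qed.

Lemma Ex_cst (c : R) : \int[P]_w c = c.
Proof. by rewrite Rintegral_cst// (_ : _ setT = 1%E) ?mulr1//; exact: probability_setT. Qed.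

Lemma Ex_norm_le f g : bm f -> bm g -> (forall x, `|f x| <= g x) ->
  `|\int[P]_w f w| <= \int[P]_w g w.
Proof.
move=> bf bg fg; rewrite (le_trans (le_normr_Rintegral _ (intg_bm bf)))//.
by apply: Ex_le => //; exact: bm_norm.
Qed.

Lemma Ex_bound f (M : R) : bm f -> (forall x, `|f x| <= M) -> `|\int[P]_w f w| <= M.
Proof. by move=> bf fM; rewrite -(Ex_cst M); apply: Ex_norm_le => //; exact: bm_cst. Qed.

End bounded_measurable.

Lemma bm_comp {d : measure_display} {T : measurableType d} {R : realType}
  (f : R -> R) (Y : T -> R) : bm f -> measurable_fun setT Y -> bm (fun w => f (Y w)).
Proof.
by move=> [mf [M fM]] mY; split; [exact: measurableT_comp|exists M].
Qed.

Section borel_induction.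
Context {R : realType}.
Implicit Types f g : R -> R.

(* The bounded Borel functions are the closure of [base] under linear combinations and
   bounded pointwise limits. *)
Definition bm_generating (base : set (R -> R)) := forall Q : (R -> R) -> Prop,
  (forall f, base f -> Q f) ->
  (forall f g, bm f -> bm g -> Q f -> Q g -> Q (fun x => f x + g x)) ->
  (forall c f, bm f -> Q f -> Q (fun x => c * f x)) ->
  (forall (u : nat -> R -> R) f (M : R), (forall n, bm (u n)) -> (forall n, Q (u n)) ->
     (forall n x, `|u n x| <= M) -> (forall x, u n x @[n --> \oo] --> f x) -> Q f) ->
  forall f, bm f -> Q f.

Lemma bm_cos (a b : R) : bm (fun x : R => cos (a * x + b)).
Proof.
split; last by exists 1 => x; rewrite ler_norml cos_geN1 cos_le1.
apply: continuous_measurable_fun => x.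
apply: continuous_comp; last exact: continuous_cos.
by apply: cvgD; [apply: cvgM; [exact: cvg_cst|exact: cvg_id]|exact: cvg_cst].
Qed.

Lemma bm_sg : bm (Num.sg : R -> R).
Proof.
split; last first.
  by exists 1 => x; rewrite normr_sg lern1 leq_b1.
have -> : Num.sg = fun x : R => \1_`]0, +oo[ x - \1_`]-oo, 0[ x.
  apply/funext => x; rewrite !indicE !mem_setE !in_itv/= andbT.
  case: (ltgtP x 0) => [x0|x0|->].
  - by rewrite ltr0_sg//=; lra.
  - by rewrite gtr0_sg//=; lra.
  - by rewrite sgr0/=; lra.
by apply: measurable_funB; exact: measurable_indic.
Qed.

Let B : set (R -> R) := [set f | exists a b, f = fun x => cos (a * x + b)].
Let V := lspan B.

Let V_bm f : V f -> bm f.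
Proof.
elim=> {f} [f [a [b ->]]|f g _ bf _ bg|c f _ bf]; first exact: bm_cos.
  exact: bm_add.
exact: bm_scale.
Qed.

Let V_mul f g : V f -> V g -> V (fun x => f x * g x).
Proof.
apply: lspan_mul => {}f {}g [a [b ->]] [a' [b' ->]].
have -> : (fun x => cos (a * x + b) * cos (a' * x + b')) =
    fun x => 2^-1 * (cos ((a + a') * x + (b + b')) + cos ((a - a') * x + (b - b'))).
  apply/funext => x.
  rewrite (_ : (a + a') * x + (b + b') = (a * x + b) + (a' * x + b')); last by ring.
  rewrite (_ : (a - a') * x + (b - b') = (a * x + b) - (a' * x + b')); last by ring.
  by move: (a * x + b) (a' * x + b') => y y'; rewrite cosB cosD; field.
by apply: lspan_scale; apply: lspan_add; apply: lspan_base; do 2 eexists.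
Qed.

Let V_one : V (fun=> 1).
Proof.
apply: lspan_base; exists 0, 0; apply/funext => x.
by rewrite mul0r add0r cos0.
Qed.

Lemma bm_generating_cos : bm_generating [set f | exists a b, f = fun x => cos (a * x + b)].
Proof.
move=> Q Qcos Qadd Qscale Qlim.
have VQ f : bpc setT V f -> bm f /\ Q f.
  elim=> {f} [f Vf|u f M bu h uM uf]; first split; first exact: V_bm.
    elim: Vf => {f} [f Bf|f g Vf Qf Vg Qg|c f Vf Qf]; first exact: Qcos.
      by apply: Qadd => //; exact: V_bm.
    by apply: Qscale => //; exact: V_bm.
  have uM' n x : `|u n x| <= M by exact: uM.
  have uf' x : u n x @[n --> \oo] --> f x by exact: uf.
  split; first by apply: (bm_lim _ uM' uf') => n; case: (h n).
  by apply: (Qlim u f M) => // n; case: (h n).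
have V_bounded f : V f -> exists M : R, forall x, [set: R] x -> `|f x| <= M.
  by move=> /V_bm[_ [M fM]]; exists M => x _.
have V_add f g : V f -> V g -> V (fun x => f x + g x) by exact: lspan_add.
have V_scale c f : V f -> V (fun x => c * f x) by exact: lspan_scale.
move=> f [mf [M fM]].
suff /VQ[] : bpc setT V f by [].
have := @bpc_borel R R setT V V_add V_scale V_mul V_one V_bounded id f M.
apply => // t.
apply: (bpc_lim (u := fun n x => Num.sg (sin (n.+1%:R^-1 * (x - t)))) (M := 1)).
- move=> n.
  apply: (bpc_sg V_add V_scale V_mul V_bounded (g := fun x => sin (n.+1%:R^-1 * (x - t)))).
  apply: bpc_base; apply: lspan_base; exists n.+1%:R^-1, (- (n.+1%:R^-1 * t) - pi / 2).
  apply/funext => x; rewrite addrA cosB cos_pihalf sin_pihalf mulr0 add0r mulr1.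
  by rewrite mulrBr.
- by move=> n x _; rewrite normr_sg lern1 leq_b1.
- move=> x _; apply: cvg_near_cst.
  have [k /ltW hk] : exists k : nat, `|x - t| < k%:R.
    by exists (Num.trunc `|x - t|).+1; rewrite truncnS_gt.
  exists k => // n /= kn.
  have n0 : 0 < n.+1%:R :> R by rewrite ltr0Sn.
  have pi2 : 2 <= pi :> R by exact: pi_ge2.
  have hz : n.+1%:R^-1 * `|x - t| <= 1.
    rewrite mulrC ler_pdivrMr// mul1r (le_trans hk)// ler_nat ltnW//.
  have n1 : 0 < n.+1%:R^-1 :> R by rewrite invr_gt0.
  case: (ltgtP x t) => xt.
  + have xt' : x - t < 0 by rewrite subr_lt0.
    rewrite ltr0_norm// mulrN in hz.
    rewrite [RHS]ltr0_sg// ltr0_sg//.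
    have : n.+1%:R^-1 * (x - t) < 0 by rewrite pmulr_rlt0.
    move: hz; set z := _ * (x - t) => hz z0.
    by rewrite -oppr_gt0 -sinN sin_gt0_pi//; apply/andP; split; lra.
  + have xt' : 0 < x - t by rewrite subr_gt0.
    rewrite gtr0_norm// in hz.
    rewrite [RHS]gtr0_sg// gtr0_sg//.
    have : 0 < n.+1%:R^-1 * (x - t) by rewrite mulr_gt0.
    move: hz; set z := _ * (x - t) => hz z0.
    by rewrite sin_gt0_pi//; apply/andP; split; lra.
  + by rewrite xt subrr mulr0 sin0 sgr0.
Qed.

Context {d : measure_display} {T : measurableType d} (P : probability T R).

Lemma Ex_bm_ext (base : set (R -> R)) (Y Y' A A' : T -> R) (c : R) :
  bm_generating base -> measurable_fun setT Y -> measurable_fun setT Y' -> bm A -> bm A' ->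
  (forall f, base f -> \int[P]_w (f (Y w) * A w) = c * \int[P]_w (f (Y' w) * A' w)) ->
  forall f, bm f -> \int[P]_w (f (Y w) * A w) = c * \int[P]_w (f (Y' w) * A' w).
Proof.
move=> gen mY mY' bA bA' h; apply: gen => //.
- move=> f g bf bg hf hg.
  have e (Z D : T -> R) : measurable_fun setT Z -> bm D ->
      \int[P]_w ((f (Z w) + g (Z w)) * D w) =
      \int[P]_w (f (Z w) * D w) + \int[P]_w (g (Z w) * D w).
    move=> mZ bD; rewrite -ExD; last 2 first.
    - by apply: bm_mul => //; exact: bm_comp mZ.
    - by apply: bm_mul => //; exact: bm_comp mZ.
    by apply: eq_Rintegral => w _; rewrite mulrDl.
  by rewrite !e// hf hg mulrDr.
- move=> k f bf hf.
  have e (Z D : T -> R) : measurable_fun setT Z -> bm D ->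
      \int[P]_w (k * f (Z w) * D w) = k * \int[P]_w (f (Z w) * D w).
    move=> mZ bD; rewrite -ExZ; last by apply: bm_mul => //; exact: bm_comp mZ.
    by apply: eq_Rintegral => w _; rewrite mulrA.
  by rewrite !e// hf mulrCA.
- move=> u f M bu hu uM uf.
  have e (Z D : T -> R) : measurable_fun setT Z -> bm D ->
      \int[P]_w (u n (Z w) * D w) @[n --> \oo] --> \int[P]_w (f (Z w) * D w).
    move=> mZ [mD [K DK]].
    have [] // := @Rdominated _ _ _ P setT measurableT
      (fun n w => u n (Z w) * D w) (fun w => f (Z w) * D w) (fun=> M * K).
    - move=> n; apply: measurable_funM => //.
      by apply: measurableT_comp mZ; case: (bu n).
    - by move=> w _; apply: cvgM; [exact: uf|exact: cvg_cst].
    - by move=> n w _; rewrite normrM ler_pM.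
    - exact/intg_bm/bm_cst.
  have e1 := e Y A mY bA.
  have e2 : \int[P]_w (u n (Y w) * A w) @[n --> \oo] --> c * \int[P]_w (f (Y' w) * A' w).
    under eq_fun do rewrite hu.
    by apply: cvgM; [exact: cvg_cst|exact: e].
  by rewrite -(cvg_lim (@Rhausdorff R) e1) (cvg_lim (@Rhausdorff R) e2).
Qed.

Lemma Ex_cos_ext (Y Y' A A' : T -> R) (c : R) :
  measurable_fun setT Y -> measurable_fun setT Y' -> bm A -> bm A' ->
  (forall a b, \int[P]_w (cos (a * Y w + b) * A w) =
     c * \int[P]_w (cos (a * Y' w + b) * A' w)) ->
  forall f, bm f -> \int[P]_w (f (Y w) * A w) = c * \int[P]_w (f (Y' w) * A' w).
Proof.
move=> mY mY' bA bA' h; apply: (Ex_bm_ext bm_generating_cos) => // _ [a [b ->]].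
exact: h.
Qed.

End borel_induction.

(** * Gaussian spaces *)

Section gaussian_spaces.
Context {d : measure_display} {T : measurableType d} {R : realType}.
Variable P : probability T R.
Implicit Types (Y Z U V X : T -> R) (f g : R -> R).

Definition ip Y Z : R := \int[P]_w (Y w * Z w).

Definition gaussian_space (L : set (T -> R)) : Prop :=
  [/\ forall a b Y Z, L Y -> L Z -> L (fun w => a * Y w + b * Z w),
      forall Y, L Y -> measurable_fun setT Y,
      forall Y, L Y -> P.-integrable setT (EFin \o (fun w => Y w * Y w)),
      forall Y b, L Y -> \int[P]_w cos (Y w + b) = expR (- (ip Y Y / 2)) * cos b &
      forall Y, L Y -> 0 < ip Y Y -> P (Y @^-1` [set 0]) = 0%E].

Variable L : set (T -> R).
Hypothesis GL : gaussian_space L.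

Let L_lin a b Y Z : L Y -> L Z -> L (fun w => a * Y w + b * Z w).
Proof. by case: GL => + _ _ _ _; apply. Qed.

Let L_meas Y : L Y -> measurable_fun setT Y.
Proof. by case: GL => _ + _ _ _; apply. Qed.

Let L_cos Y b : L Y -> \int[P]_w cos (Y w + b) = expR (- (ip Y Y / 2)) * cos b.
Proof. by case: GL => _ _ _ + _; apply. Qed.

Let L_add Y Z : L Y -> L Z -> L (fun w => Y w + Z w).
Proof.
move=> LY LZ; have := L_lin 1 1 LY LZ.
by under eq_fun do rewrite !mul1r.
Qed.

Let L_sub Y Z : L Y -> L Z -> L (fun w => Y w - Z w).
Proof.
move=> LY LZ; have := L_lin 1 (-1) LY LZ.
by under eq_fun do rewrite mul1r mulN1r.
Qed.

Let L_scale a Y : L Y -> L (fun w => a * Y w).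
Proof.
move=> LY; have := L_lin a 0 LY LY.
by under eq_fun do rewrite mul0r addr0.
Qed.

Lemma gaussian_intg_mul Y Z : L Y -> L Z ->
  P.-integrable setT (EFin \o (fun w => Y w * Z w)).
Proof.
case: GL => _ _ h _ _ LY LZ.
apply: (@intg_le _ _ _ P setT measurableT _ (fun w => Y w * Y w + Z w * Z w)).
- by apply: measurable_funM; exact: L_meas.
- move=> w _; rewrite normrM -!expr2 -(ger0_norm (sqr_ge0 (Y w))) -(ger0_norm (sqr_ge0 (Z w))).
  rewrite !normrX; set y := `|Y w|; set z := `|Z w|.
  have : 0 <= (y - z) ^+ 2 by exact: sqr_ge0.
  have : 0 <= (y + z) ^+ 2 by exact: sqr_ge0.
  by nra.
- by apply: intg_add => //; exact: h.
Qed.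

Lemma ipC Y Z : ip Y Z = ip Z Y.
Proof. by apply: eq_Rintegral => w _; rewrite mulrC. Qed.

Lemma ip_linl a b Y Z V : L Y -> L Z -> L V ->
  ip (fun w => a * Y w + b * Z w) V = a * ip Y V + b * ip Z V.
Proof.
move=> LY LZ LV; rewrite /ip.
rewrite -(RintegralZl a measurableT (gaussian_intg_mul LY LV)).
rewrite -(RintegralZl b measurableT (gaussian_intg_mul LZ LV)).
rewrite -RintegralD//; last 2 first.
- by apply: intg_scale => //; exact: gaussian_intg_mul.
- by apply: intg_scale => //; exact: gaussian_intg_mul.
by apply: eq_Rintegral => w _; ring.
Qed.

Lemma ip_linr a b Y Z V : L Y -> L Z -> L V ->
  ip V (fun w => a * Y w + b * Z w) = a * ip V Y + b * ip V Z.
Proof. by move=> *; rewrite ipC ip_linl// ipC (ipC Z). Qed.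

Lemma ip_lin2 a b Y Z : L Y -> L Z ->
  ip (fun w => a * Y w + b * Z w) (fun w => a * Y w + b * Z w) =
  a ^+ 2 * ip Y Y + 2 * a * b * ip Y Z + b ^+ 2 * ip Z Z.
Proof.
move=> LY LZ; have LL := L_lin a b LY LZ.
by rewrite ip_linl// !ip_linr// (ipC Z Y); ring.
Qed.

Lemma ip_ge0 Y : 0 <= ip Y Y.
Proof. by apply: Rintegral_ge0 => w _; rewrite -expr2 sqr_ge0. Qed.

Let bm_cosT Y b : L Y -> bm (fun w => cos (Y w + b)).
Proof.
move=> LY; have := bm_comp (bm_cos 1 b) (L_meas LY).
by under eq_fun do rewrite mul1r.
Qed.

Let cosM (x y : R) : cos x * cos y = 2^-1 * (cos (x + y) + cos (x - y)).
Proof. by rewrite cosB cosD; field. Qed.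

Let Ex_cosM Y Z b c : L Y -> L Z ->
  \int[P]_w (cos (Y w + b) * cos (Z w + c)) =
  2^-1 * (expR (- ((ip Y Y + 2 * ip Y Z + ip Z Z) / 2)) * cos (b + c) +
          expR (- ((ip Y Y - 2 * ip Y Z + ip Z Z) / 2)) * cos (b - c)).
Proof.
move=> LY LZ.
have LD := L_add LY LZ; have LB := L_sub LY LZ.
have qD : ip (fun w => Y w + Z w) (fun w => Y w + Z w) = ip Y Y + 2 * ip Y Z + ip Z Z.
  have := ip_lin2 1 1 LY LZ; under eq_fun do rewrite !mul1r.
  by move=> ->; ring.
have qB : ip (fun w => Y w - Z w) (fun w => Y w - Z w) = ip Y Y - 2 * ip Y Z + ip Z Z.
  have := ip_lin2 1 (-1) LY LZ; under eq_fun do rewrite mul1r mulN1r.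
  by move=> ->; ring.
rewrite -qD -qB -(L_cos (b + c) LD) -(L_cos (b - c) LB).
rewrite -ExD; [|exact: bm_cosT..].
rewrite -ExZ; last by apply: bm_add; exact: bm_cosT.
apply: eq_Rintegral => w _; rewrite cosM.
by congr (_ * (cos _ + cos _)); ring.
Qed.

Let Ex_cos_indep Y Z b c : L Y -> L Z -> ip Y Z = 0 ->
  \int[P]_w (cos (Y w + b) * cos (Z w + c)) =
  \int[P]_w cos (Y w + b) * \int[P]_w cos (Z w + c).
Proof.
move=> LY LZ YZ; rewrite Ex_cosM// YZ mulr0 addr0 subr0 !L_cos//.
rewrite (_ : - ((ip Y Y + ip Z Z) / 2) = - (ip Y Y / 2) + - (ip Z Z / 2)); last by field.
by rewrite expRD -mulrDr cosD cosB; field.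
Qed.

(* The joint law of two members of a Gaussian space depends only on their
   covariances. *)
Lemma gaussian_law Y Z Y' Z' f g : L Y -> L Z -> L Y' -> L Z' ->
  ip Y Y = ip Y' Y' -> ip Y Z = ip Y' Z' -> ip Z Z = ip Z' Z' ->
  bm f -> bm g ->
  \int[P]_w (f (Y w) * g (Z w)) = \int[P]_w (f (Y' w) * g (Z' w)).
Proof.
move=> LY LZ LY' LZ' eYY eYZ eZZ bf bg.
have base a b a' b' : \int[P]_w (cos (a * Y w + b) * cos (a' * Z w + b')) =
    \int[P]_w (cos (a * Y' w + b) * cos (a' * Z' w + b')).
  have e U V : L U -> L V -> \int[P]_w (cos (a * U w + b) * cos (a' * V w + b')) =
      2^-1 * (expR (- ((a ^+ 2 * ip U U + 2 * (a * a' * ip U V) + a' ^+ 2 * ip V V) / 2)) * cos (b + b') +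
          expR (- ((a ^+ 2 * ip U U - 2 * (a * a' * ip U V) + a' ^+ 2 * ip V V) / 2)) * cos (b - b')).
    move=> LU LV; rewrite Ex_cosM; [|exact: L_scale..].
    have s k l A B : L A -> L B -> ip (fun w => k * A w) (fun w => l * B w) = k * l * ip A B.
      move=> LA LB; have := ip_linl k 0 LA LA (L_scale l LB).
      under eq_fun do rewrite mul0r addr0.
      move=> ->; rewrite mul0r addr0; have := ip_linr l 0 LB LB LA.
      under eq_fun do rewrite mul0r addr0.
      by move=> ->; ring.
    by rewrite !s// -!expr2.
  by rewrite !e// eYY eYZ eZZ.
have mY := L_meas LY; have mZ := L_meas LZ.
have mY' := L_meas LY'; have mZ' := L_meas LZ'.
have step1 h a' b' : bm h -> \int[P]_w (h (Y w) * cos (a' * Z w + b')) =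
    1 * \int[P]_w (h (Y' w) * cos (a' * Z' w + b')).
  move=> bh; apply: (Ex_cos_ext (A := fun w => cos (a' * Z w + b'))
    (A' := fun w => cos (a' * Z' w + b'))) => //.
  - exact: bm_comp (bm_cos _ _) mZ.
  - exact: bm_comp (bm_cos _ _) mZ'.
  - by move=> a0 b0; rewrite mul1r base.
have := @Ex_cos_ext _ _ _ P Z Z' (fun w => f (Y w)) (fun w => f (Y' w)) 1 mZ mZ'
  (bm_comp bf mY) (bm_comp bf mY') _ g bg.
rewrite mul1r => h.
under eq_Rintegral do rewrite mulrC.
under [RHS]eq_Rintegral do rewrite mulrC.
apply: h => a b.
under eq_Rintegral do rewrite mulrC.
rewrite step1// !mul1r.
by apply: eq_Rintegral => w _; rewrite mulrC.
Qed.

Lemma gaussian_indep Y1 Y2 Z1 Z2 f1 f2 g1 g2 : L Y1 -> L Y2 -> L Z1 -> L Z2 ->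
  ip Y1 Z1 = 0 -> ip Y1 Z2 = 0 -> ip Y2 Z1 = 0 -> ip Y2 Z2 = 0 ->
  bm f1 -> bm f2 -> bm g1 -> bm g2 ->
  \int[P]_w (f1 (Y1 w) * f2 (Y2 w) * (g1 (Z1 w) * g2 (Z2 w))) =
  \int[P]_w (f1 (Y1 w) * f2 (Y2 w)) * \int[P]_w (g1 (Z1 w) * g2 (Z2 w)).
Proof.
move=> LY1 LY2 LZ1 LZ2 e11 e12 e21 e22 bf1 bf2 bg1 bg2.
have mY1 := L_meas LY1; have mY2 := L_meas LY2.
have mZ1 := L_meas LZ1; have mZ2 := L_meas LZ2.
have bc a b V : measurable_fun setT V -> bm (fun w => cos (a * V w + b)).
  by move=> mV; exact: bm_comp (bm_cos a b) mV.
have base a1 b1 a2 b2 a3 b3 a4 b4 :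
    \int[P]_w (cos (a1 * Y1 w + b1) * cos (a2 * Y2 w + b2) *
               (cos (a3 * Z1 w + b3) * cos (a4 * Z2 w + b4))) =
    \int[P]_w (cos (a1 * Y1 w + b1) * cos (a2 * Y2 w + b2)) *
    \int[P]_w (cos (a3 * Z1 w + b3) * cos (a4 * Z2 w + b4)).
  pose U c w := a1 * Y1 w + c * Y2 w; pose V c w := a3 * Z1 w + c * Z2 w.
  have LU c : L (U c) by exact: L_lin.
  have LV c : L (V c) by exact: L_lin.
  have UV c c' : ip (U c) (V c') = 0.
    rewrite /U /V ip_linl//; last exact: L_lin.
    by rewrite !ip_linr// e11 e12 e21 e22; ring.
  have cE (b c b' c' : R) A B w : cos (b * A w + c) * cos (b' * B w + c') =
      2^-1 * (cos (b * A w + b' * B w + (c + c')) + cos (b * A w + - b' * B w + (c - c'))) :> R.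
    by rewrite cosM; congr (_ * (cos _ + cos _)); ring.
  under eq_Rintegral do rewrite !cE.
  under [X in _ = X * _]eq_Rintegral do rewrite cE.
  under [X in _ = _ * X]eq_Rintegral do rewrite cE.
  rewrite [X in _ = X * _]ExZ; last by apply: bm_add; apply: (bm_cosT _ (Y := U _)).
  rewrite [X in _ = _ * X]ExZ; last by apply: bm_add; apply: (bm_cosT _ (Y := V _)).
  rewrite [X in _ = _ * X * _]ExD; [|apply: (bm_cosT _ (Y := U _)) => //..].
  rewrite [X in _ = _ * (_ * X)]ExD; [|apply: (bm_cosT _ (Y := V _)) => //..].
  transitivity (\int[P]_w (2^-1 * 2^-1 * (
     cos (U a2 w + (b1 + b2)) * cos (V a4 w + (b3 + b4)) +
     cos (U a2 w + (b1 + b2)) * cos (V (- a4) w + (b3 - b4)) +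
     (cos (U (- a2) w + (b1 - b2)) * cos (V a4 w + (b3 + b4)) +
     cos (U (- a2) w + (b1 - b2)) * cos (V (- a4) w + (b3 - b4)))))).
    by apply: eq_Rintegral => w _; rewrite /U /V; ring.
  have b2m c c' k k' : bm (fun w => cos (U c w + k) * cos (V c' w + k')).
    by apply: bm_mul; exact: bm_cosT.
  rewrite ExZ; last by apply: bm_add; apply: bm_add.
  rewrite ExD; [|exact: bm_add..].
  rewrite !ExD//.
  rewrite !Ex_cos_indep//.
  rewrite /U /V; ring.
have s1 a2 b2 a3 b3 a4 b4 :
    \int[P]_w (f1 (Y1 w) * cos (a2 * Y2 w + b2) *
               (cos (a3 * Z1 w + b3) * cos (a4 * Z2 w + b4))) =
    \int[P]_w (f1 (Y1 w) * cos (a2 * Y2 w + b2)) *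
    \int[P]_w (cos (a3 * Z1 w + b3) * cos (a4 * Z2 w + b4)).
  rewrite mulrC; under eq_Rintegral do rewrite -mulrA.
  apply: (Ex_cos_ext (A := fun w => cos (a2 * Y2 w + b2) *
     (cos (a3 * Z1 w + b3) * cos (a4 * Z2 w + b4)))
     (A' := fun w => cos (a2 * Y2 w + b2))) => //.
  - by apply: bm_mul; [exact: bc|apply: bm_mul; exact: bc].
  - exact: bc.
  - by move=> a1 b1; under eq_Rintegral do rewrite mulrA; rewrite base mulrC.
have s2 a3 b3 a4 b4 :
    \int[P]_w (f1 (Y1 w) * f2 (Y2 w) *
               (cos (a3 * Z1 w + b3) * cos (a4 * Z2 w + b4))) =
    \int[P]_w (f1 (Y1 w) * f2 (Y2 w)) *
    \int[P]_w (cos (a3 * Z1 w + b3) * cos (a4 * Z2 w + b4)).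
  rewrite mulrC.
  under eq_Rintegral do rewrite (mulrC (f1 _)) -mulrA.
  under [X in _ = _ * X]eq_Rintegral do rewrite (mulrC (f1 _)).
  apply: (Ex_cos_ext (A := fun w => f1 (Y1 w) *
     (cos (a3 * Z1 w + b3) * cos (a4 * Z2 w + b4)))
     (A' := fun w => f1 (Y1 w))) => //.
  - by apply: bm_mul; [exact: bm_comp mY1|apply: bm_mul; exact: bc].
  - exact: bm_comp mY1.
  - move=> a2 b2; under eq_Rintegral do rewrite mulrA (mulrC _ (f1 _)).
    rewrite s1 mulrC; congr (_ * _).
    by apply: eq_Rintegral => w _; rewrite mulrC.
have bff : bm (fun w => f1 (Y1 w) * f2 (Y2 w)).
  by apply: bm_mul; [exact: bm_comp mY1|exact: bm_comp mY2].
have s3 a4 b4 :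
    \int[P]_w (f1 (Y1 w) * f2 (Y2 w) * (g1 (Z1 w) * cos (a4 * Z2 w + b4))) =
    \int[P]_w (f1 (Y1 w) * f2 (Y2 w)) *
    \int[P]_w (g1 (Z1 w) * cos (a4 * Z2 w + b4)).
  under eq_Rintegral do rewrite mulrCA.
  apply: (Ex_cos_ext (A := fun w => f1 (Y1 w) * f2 (Y2 w) * cos (a4 * Z2 w + b4))
     (A' := fun w => cos (a4 * Z2 w + b4))) => //.
  - by apply: bm_mul => //; exact: bc.
  - exact: bc.
  - by move=> a b; under eq_Rintegral do rewrite mulrCA; rewrite s2.
under eq_Rintegral do rewrite mulrA mulrC.
under [X in _ = _ * X]eq_Rintegral do rewrite mulrC.
apply: (Ex_cos_ext (A := fun w => f1 (Y1 w) * f2 (Y2 w) * g1 (Z1 w))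
     (A' := fun w => g1 (Z1 w))) => //.
- by apply: bm_mul => //; exact: bm_comp mZ1.
- exact: bm_comp mZ1.
- move=> a b; transitivity (\int[P]_w (f1 (Y1 w) * f2 (Y2 w) * (g1 (Z1 w) * cos (a * Z2 w + b)))).
    by apply: eq_Rintegral => w _; ring.
  rewrite s3; congr (_ * _).
  by apply: eq_Rintegral => w _; rewrite mulrC.
Qed.

End gaussian_spaces.

Section elementary.
Context {R : realType}.
Implicit Types x y t : R.

Definition jordan_cst : R := 2 / cos 1.

Lemma jordan_cst_gt0 : 0 < jordan_cst.
Proof. by rewrite divr_gt0// cos1_gt0. Qed.

Lemma cos_anti x y : 0 <= x -> x <= y -> y <= pi -> cos y <= cos x.
Proof.
move=> x0 xy ypi; move: xy; rewrite le_eqVlt => /orP[/eqP->//|xy].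
by apply: ltW; rewrite ltr_cos// in_itv/= ?x0 ?ypi ?andbT ?(le_trans x0 (ltW xy))// (le_trans (ltW xy)).
Qed.

Lemma jordan_le y : 0 <= y -> y <= pi / 2 -> y <= jordan_cst * sin y.
Proof.
move=> y0 y2; have c1 : 0 < cos 1 :> R := cos1_gt0 R.
have pi4 : pi <= 4 :> R by have := pihalf_lt2 R; lra.
have pi2 : 2 <= pi :> R := pi_ge2 R.
suff h : y * cos 1 <= 2 * sin y.
  by rewrite /jordan_cst mulrAC ler_pdivlMr.
have [y1|y1] := leP y 1.
  have [c /[!in_itv]/= /andP[c0 cy]] : exists2 c, c \in `[0, y] & sin y - sin 0 = cos c * (y - 0).
    by apply: MVT_segment => //; apply: continuous_subspaceT; exact: continuous_sin.
  rewrite sin0 !subr0 => ->.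
  have : cos 1 <= cos c by apply: cos_anti => //; [exact: le_trans cy y1|lra].
  by nra.
have -> : sin y = cos (pi / 2 - y) by rewrite cosB cos_pihalf sin_pihalf mul0r add0r mul1r.
have : cos 1 <= cos (pi / 2 - y) by apply: cos_anti; lra.
by nra.
Qed.

Lemma additive_linear (A : R -> R) :
  (forall x y, 0 <= x -> 0 <= y -> x + y <= pi -> A (x + y) = A x + A y) ->
  (forall x, 0 <= x -> x <= pi -> 0 <= A x) -> A pi = 1 ->
  forall x, 0 <= x -> x <= pi -> A x = x / pi.
Proof.
move=> Aadd A0 Api.
have pi0 : 0 < pi :> R := pi_gt0 R.
have Amono x y : 0 <= x -> x <= y -> y <= pi -> A x <= A y.
  move=> x0 xy ypi; rewrite -(subrK x y) addrC Aadd//; [|lra..].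
  by rewrite lerDl A0//; lra.
have Amul n x : 0 <= x -> n%:R * x <= pi -> A (n%:R * x) = n%:R * A x.
  move=> x0; elim: n => [|n ih] nx.
    rewrite !mul0r; have := Aadd 0 0 (lexx _) (lexx _); rewrite addr0 => h.
    by have := h (ltW pi0); lra.
  have n0 : 0 <= n%:R * x by rewrite mulr_ge0.
  have e : n.+1%:R * x = n%:R * x + x by rewrite -natr1; ring.
  rewrite e Aadd//; last by rewrite -e.
  by rewrite ih; [rewrite -natr1; ring|rewrite e in nx; lra].
have Afrac n k : (k <= n.+1)%N -> A (k%:R * (pi / n.+1%:R)) = k%:R / n.+1%:R.
  move=> kn; have n0 : 0 < n.+1%:R :> R by rewrite ltr0Sn.
  have d0 : 0 <= pi / n.+1%:R :> R by rewrite divr_ge0// ltW.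
  have e : n.+1%:R * (pi / n.+1%:R) = pi :> R by rewrite mulrCA divff ?mulr1// gt_eqF.
  have A1 : A (pi / n.+1%:R) = n.+1%:R^-1.
    have := Amul n.+1 _ d0; rewrite e lexx Api => /(_ isT) h.
    by rewrite -[LHS](mulKf (lt0r_neq0 n0)) -h mulr1.
  rewrite Amul// ?A1// -[leRHS]e ler_wpM2r// ler_nat//.
move=> x x0 xpi; apply/eqP; rewrite eq_le; apply/andP.
have bound n : `|A x - x / pi| <= n.+1%:R^-1.
  have n0 : 0 < n.+1%:R :> R by rewrite ltr0Sn.
  pose z := n.+1%:R * (x / pi).
  have z0 : 0 <= z by rewrite mulr_ge0// divr_ge0// ltW.
  have /andP[k1 k2] := truncn_itv z0; set k := Num.trunc z in k1 k2.
  have nn0 : n.+1%:R != 0 :> R by rewrite gt_eqF.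
  have pn0 : pi != 0 :> R by rewrite gt_eqF.
  have xz' : x / pi = z / n.+1%:R by rewrite /z mulrAC divff// mul1r.
  have xz : x = z * (pi / n.+1%:R) by rewrite mulrCA -xz' mulrC divfK.
  have d0 : 0 < pi / n.+1%:R :> R by rewrite divr_gt0.
  have kn : (k <= n.+1)%N.
    rewrite -(ler_nat R) (le_trans k1)// /z ler_piMr// ler_pdivrMr// mul1r//.
  have n1 : 0 < n.+1%:R^-1 :> R by rewrite invr_gt0.
  have lo : k%:R / n.+1%:R <= A x.
    rewrite -(Afrac n k kn); apply: Amono => //; first by rewrite mulr_ge0// ltW.
    by rewrite [leRHS]xz ler_wpM2r// ltW.
  have hi : A x <= k.+1%:R / n.+1%:R.
    have [kn'|] := leqP k.+1 n.+1.
      rewrite -(Afrac n k.+1 kn'); apply: Amono => //.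
        by rewrite [leLHS]xz ler_wpM2r// ltW.
      apply: (@le_trans _ _ (n.+1%:R * (pi / n.+1%:R))).
        by rewrite ler_wpM2r ?(ltW d0)// ler_nat.
      by rewrite mulrCA divff ?mulr1.
    rewrite ltnS => nk; apply: (@le_trans _ _ 1); first by rewrite -Api Amono.
    by rewrite ler_pdivlMr// mul1r ler_nat ltnW.
  have kk : k.+1%:R / n.+1%:R = k%:R / n.+1%:R + n.+1%:R^-1 :> R.
    by rewrite -[k.+1%:R]natr1 mulrDl mul1r.
  rewrite xz' ler_norml; apply/andP; split.
    have : z / n.+1%:R <= k.+1%:R / n.+1%:R by rewrite ler_wpM2r// ltW// ltW.
    move: hi lo; rewrite kk; move: (n.+1%:R^-1 : R) => N; move: (A x) (k%:R * N) (z * N) => a b q; lra.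
  have : k%:R / n.+1%:R <= z / n.+1%:R by rewrite ler_wpM2r// ltW.
  move: hi lo; rewrite kk; move: (n.+1%:R^-1 : R) => N; move: (A x) (k%:R * N) (z * N) => a b q; lra.
have : `|A x - x / pi| <= 0.
  rewrite leNgt; apply/negP => e0.
  have [k hk] : exists k : nat, `|A x - x / pi|^-1 < k%:R.
    by exists (Num.trunc `|A x - x / pi|^-1).+1; rewrite truncnS_gt.
  have := bound k; apply/negP; rewrite -ltNge.
  rewrite -[ltRHS]invrK ltf_pV2 ?posrE ?invr_gt0// (lt_trans hk)// ltr_nat//.
by rewrite normr_le0 subr_eq0 => /eqP->.
Qed.

Lemma sum_bool_le1 (D : nat -> bool) n :
  (forall i j, (i < j < n)%N -> D i -> D j -> False) ->
  \sum_(i < n) (D i)%:R <= 1 :> R.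
Proof.
elim: n => [|n ih] h; first by rewrite big_ord0.
rewrite big_ord_recr/=; case Dn: (D n); last first.
  by rewrite addr0 ih// => i j /andP[ij jn]; apply: h; rewrite ij ltnW.
rewrite big1 ?add0r// => i _; case Di: (D i) => //.
by exfalso; apply: (h i n); rewrite ?ltn_ord/=.
Qed.

(* Four consecutive values of a quadratic form along the circle satisfy a linear
   relation with alternating signs, since such forms span a space of dimension 3. *)
Lemma circle_no_alternation (g1 g2 c x1 x2 x3 x4 : R) :
  x1 < x2 -> x2 < x3 -> x3 < x4 -> x4 <= x1 + pi ->
  let U x := cos x * g1 + sin x * g2 in
  c < `|U x1| -> `|U x2| <= c -> c < `|U x3| -> `|U x4| <= c -> False.
Proof.
move=> x12 x23 x34 x41 U u1 u2 u3 u4.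
have c0 : 0 <= c by exact: le_trans (normr_ge0 _) u2.
pose F x := U x ^+ 2 - c ^+ 2 * (cos x ^+ 2 + sin x ^+ 2).
have FE x : F x = `|U x| ^+ 2 - c ^+ 2.
  by rewrite /F cos2Dsin2 mulr1 -normrX ger0_norm ?sqr_ge0.
have F1 : 0 < F x1 by rewrite FE subr_gt0 ltr_pXn2r// nnegrE.
have F3 : 0 < F x3 by rewrite FE subr_gt0 ltr_pXn2r// nnegrE.
have F2 : F x2 <= 0 by rewrite FE subr_le0 ler_pXn2r// nnegrE.
have F4 : F x4 <= 0 by rewrite FE subr_le0 ler_pXn2r// nnegrE.
have sge x y : x <= y -> y <= x + pi -> 0 <= sin (y - x).
  by move=> xy yx; apply: sin_ge0_pi; lra.
have sgt x y : x < y -> y < x + pi -> 0 < sin (y - x).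
  by move=> xy yx; apply: sin_gt0_pi; lra.
have key : sin (x3 - x2) * sin (x4 - x2) * sin (x4 - x3) * F x1
   - sin (x3 - x1) * sin (x4 - x1) * sin (x4 - x3) * F x2
   + sin (x2 - x1) * sin (x4 - x1) * sin (x4 - x2) * F x3
   - sin (x2 - x1) * sin (x3 - x1) * sin (x3 - x2) * F x4 = 0.
  by rewrite /F /U !sinB; ring.
have a1 : 0 < sin (x3 - x2) * sin (x4 - x2) * sin (x4 - x3) * F x1.
  by rewrite !mulr_gt0//; apply: sgt; lra.
have a2 : sin (x3 - x1) * sin (x4 - x1) * sin (x4 - x3) * F x2 <= 0.
  by rewrite mulr_ge0_le0// !mulr_ge0//; apply: sge; lra.
have a3 : 0 <= sin (x2 - x1) * sin (x4 - x1) * sin (x4 - x2) * F x3.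
  by rewrite !mulr_ge0//; [apply: sge; lra..|exact: ltW].
have a4 : sin (x2 - x1) * sin (x3 - x1) * sin (x3 - x2) * F x4 <= 0.
  by rewrite mulr_ge0_le0// !mulr_ge0//; apply: sge; lra.
move: key a1 a2 a3 a4; clear; lra.
Qed.

Lemma sg_between (u0 u1 u2 a b c : R) : 0 <= a -> 0 <= b -> 0 < c ->
  c * u1 = a * u0 + b * u2 -> u0 != 0 -> u1 != 0 -> u2 != 0 ->
  1 - Num.sg u0 * Num.sg u2 =
  (1 - Num.sg u0 * Num.sg u1) + (1 - Num.sg u1 * Num.sg u2) :> R.
Proof.
move=> a0 b0 c0 e n0 n1 n2.
case: (ltgtP u0 0) n0 => // h0 _; case: (ltgtP u2 0) n2 => // h2 _;
  case: (ltgtP u1 0) n1 => // h1 _;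
  rewrite ?(gtr0_sg h0) ?(gtr0_sg h1) ?(gtr0_sg h2) ?(ltr0_sg h0) ?(ltr0_sg h1) ?(ltr0_sg h2);
  try lra; exfalso; move: e; apply/eqP.
- by rewrite gt_eqF// (@le_lt_trans _ _ 0) ?mulr_gt0// -oppr_ge0 opprD -!mulrN addr_ge0// mulr_ge0// oppr_ge0 ltW.
- by rewrite lt_eqF// (@lt_le_trans _ _ 0) ?pmulr_rlt0// addr_ge0// mulr_ge0// ltW.
Qed.

End elementary.

Section exceedance.
Context {R : realType}.

Definition exceeds (c y : R) : R := if c < `|y| then 1 else 0.

Lemma exceeds_ge0 c y : 0 <= exceeds c y.
Proof. by rewrite /exceeds; case: ifP. Qed.

Lemma exceeds_le1 c y : exceeds c y <= 1.
Proof. by rewrite /exceeds; case: ifP. Qed.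

Lemma bm_exceeds c : bm (exceeds c).
Proof.
have mA : measurable [set y : R | c < `|y|].
  rewrite (_ : [set y | _] = (fun y : R => `|y|) @^-1` `]c, +oo[%classic); last first.
    by apply/seteqP; split => y /=; rewrite in_itv/= andbT.
  by rewrite -[_ @^-1` _]setTI; apply: normr_measurable.
have := bm_indic (R := R) mA; congr bm; apply/funext => y.
rewrite indicE /exceeds; case: ifPn => h; first by rewrite mem_set.
by rewrite memNset//= => h'; rewrite h' in h.
Qed.

End exceedance.

Section gaussian_signs.
Context {d : measure_display} {T : measurableType d} {R : realType}.
Variables (P : probability T R) (L : set (T -> R)).
Hypothesis GL : gaussian_space P L.
Implicit Types (Y Z U V X : T -> R) (f g : R -> R).
Local Notation ip := (ip P).

Let L_lin a b Y Z : L Y -> L Z -> L (fun w => a * Y w + b * Z w).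
Proof. by case: GL => + _ _ _ _; apply. Qed.

Let L_meas Y : L Y -> measurable_fun setT Y.
Proof. by case: GL => _ + _ _ _; apply. Qed.

Let null Y : T -> R := \1_(Y @^-1` [set 0]).

Let mnull Y : L Y -> measurable (Y @^-1` [set 0]).
Proof. by move=> LY; rewrite -[_ @^-1` _]setTI; exact: L_meas. Qed.

Let bm_null Y : L Y -> bm (null Y).
Proof. by move=> LY; apply: bm_indic; exact: mnull. Qed.

Let null_ge0 Y w : 0 <= null Y w.
Proof. by rewrite /null indicE ler0n. Qed.

Let null1 Y w : Y w = 0 -> null Y w = 1.
Proof. by move=> Y0; rewrite /null indicE mem_set. Qed.

Let Ex_null Y : L Y -> ip Y Y = 1 -> \int[P]_w null Y w = 0.
Proof.
move=> LY Y1; rewrite /Rintegral integral_indic//; last exact: mnull.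
rewrite setIT; case: GL => _ _ _ _ h.
by transitivity (fine (P (Y @^-1` [set 0]))) => //; rewrite h// Y1.
Qed.

Let Ex_eq_off (f g n : T -> R) : bm f -> bm g -> bm n -> \int[P]_w n w = 0 ->
  (forall w, `|f w - g w| <= n w) -> \int[P]_w f w = \int[P]_w g w.
Proof.
move=> bf bg bn n0 fg; apply/eqP; rewrite -subr_eq0 -ExB//.
by rewrite -normr_le0 -n0; apply: Ex_norm_le => //; exact: bm_sub.
Qed.

Let sgY Y : L Y -> bm (fun w => Num.sg (Y w)).
Proof. by move=> LY; exact: bm_comp bm_sg (L_meas LY). Qed.

Let sg_le1 (x : R) : `|Num.sg x| <= 1.
Proof. by rewrite normr_sg lern1 leq_b1. Qed.

Let sgM_le1 (x y : R) : `|Num.sg x * Num.sg y| <= 1.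
Proof. by rewrite normrM mulr_ile1. Qed.

Section rotation.
Variables G1 G2 : T -> R.
Hypotheses (LG1 : L G1) (LG2 : L G2) (G11 : ip G1 G1 = 1) (G22 : ip G2 G2 = 1)
  (G12 : ip G1 G2 = 0).

Definition rot x w : R := cos x * G1 w + sin x * G2 w.

Lemma L_rot x : L (rot x). Proof. exact: L_lin. Qed.

Lemma ip_rot x y : ip (rot x) (rot y) = cos (y - x).
Proof.
rewrite /rot (ip_linl GL)//; last exact: L_rot.
by rewrite !(ip_linr GL)// (ipC _ G2 G1) G11 G22 G12 cosB; ring.
Qed.

Lemma rot0 : rot 0 = G1.
Proof. by apply/funext => w; rewrite /rot cos0 sin0 mul1r mul0r addr0. Qed.

Let e x := \int[P]_w (Num.sg (G1 w) * Num.sg (rot x w)).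

Let e_shift x y : \int[P]_w (Num.sg (rot x w) * Num.sg (rot (x + y) w)) = e y.
Proof.
rewrite /e -rot0; apply: (gaussian_law GL); rewrite ?ip_rot; try exact: L_rot.
- by rewrite !subrr.
- by rewrite addrAC subrr add0r subr0.
- by rewrite !subrr.
- exact: bm_sg.
- exact: bm_sg.
Qed.

Let e_bm x y : bm (fun w => Num.sg (rot x w) * Num.sg (rot y w)).
Proof. by apply: bm_mul; apply: sgY; exact: L_rot. Qed.

Let e_add x y : 0 <= x -> 0 <= y -> x + y <= pi ->
  1 - e (x + y) = (1 - e x) + (1 - e y).
Proof.
move=> x0 y0 xy.
have e1 z : bm (fun w => 1 - Num.sg (rot 0 w) * Num.sg (rot z w)).
  by apply: bm_sub; [exact: bm_cst|exact: e_bm].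
have e2 : bm (fun w => 1 - Num.sg (rot x w) * Num.sg (rot (x + y) w)).
  by apply: bm_sub; [exact: bm_cst|exact: e_bm].
have eE z : 1 - e z = \int[P]_w (1 - Num.sg (rot 0 w) * Num.sg (rot z w)).
  by rewrite ExB ?Ex_cst ?rot0//; [exact: bm_cst|rewrite -rot0; exact: e_bm].
have eE' : 1 - e y = \int[P]_w (1 - Num.sg (rot x w) * Num.sg (rot (x + y) w)).
  by rewrite ExB ?Ex_cst ?e_shift//; exact: bm_cst.
rewrite eE' !eE -ExD//.
have bn z : bm (null (rot z)) by exact/bm_null/L_rot.
have n0 z : \int[P]_w null (rot z) w = 0.
  by apply: Ex_null; [exact: L_rot|rewrite ip_rot subrr cos0].
apply: (Ex_eq_off (n := fun w => 6 * (null (rot 0) w + null (rot x) w + null (rot (x + y)) w))) => //.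
- exact: bm_add.
- by apply: bm_scale; apply: bm_add => //; exact: bm_add.
- by rewrite ExZ ?ExD ?n0 ?addr0 ?mulr0//; [exact: bm_add|apply: bm_add => //; exact: bm_add].
move=> w; set s0 := Num.sg (rot 0 w); set sx := Num.sg (rot x w); set sz := Num.sg (rot (x + y) w).
have l0 := null_ge0 (rot 0) w; have lx := null_ge0 (rot x) w; have lz := null_ge0 (rot (x + y)) w.
have h6 : `|1 - s0 * sz - (1 - s0 * sx + (1 - sx * sz))| <= 6.
  have := sgM_le1 (rot 0 w) (rot x w); have := sgM_le1 (rot x w) (rot (x + y) w).
  have := sgM_le1 (rot 0 w) (rot (x + y) w); rewrite -/s0 -/sx -/sz !ler_norml.
  by move=> /andP[? ?] /andP[? ?] /andP[? ?]; apply/andP; split; lra.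
have [w0|w0] := eqVneq (rot 0 w) 0; first by rewrite (null1 w0); apply: (le_trans h6); lra.
have [wx|wx] := eqVneq (rot x w) 0; first by rewrite (null1 wx); apply: (le_trans h6); lra.
have [wz|wz] := eqVneq (rot (x + y) w) 0; first by rewrite (null1 wz); apply: (le_trans h6); lra.
rewrite (_ : 1 - s0 * sz = 1 - s0 * sx + (1 - sx * sz)); first by rewrite subrr normr0; lra.
move: xy; rewrite le_eqVlt => /orP[/eqP xy|xy].
  have szE : sz = - s0.
    by rewrite /sz /s0 xy /rot cospi sinpi cos0 sin0 !mul0r !addr0 mul1r mulN1r sgrN.
  have : s0 ^+ 2 = 1 by rewrite sqr_sg w0.
  by rewrite szE; nra.
have [xy0|xy0] := eqVneq (x + y) 0.
  have x00 : x = 0 by lra.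
  have y00 : y = 0 by lra.
  have s1 : s0 ^+ 2 = 1 by rewrite sqr_sg w0.
  by rewrite /sz /sx x00 y00 addr0 -/s0 -expr2 s1; lra.
apply: (@sg_between _ (rot 0 w) (rot x w) (rot (x + y) w) (sin y) (sin x) (sin (x + y))) => //.
- by apply: sin_ge0_pi; lra.
- by apply: sin_ge0_pi; lra.
- by apply: sin_gt0_pi; move: xy0; rewrite xy andbT lt_neqAle eq_sym => ->; rewrite addr_ge0.
- rewrite /rot cos0 sin0 sinD cosD.
  have := cos2Dsin2 x => c1.
  by apply/eqP; rewrite -subr_eq0; apply/eqP;
    transitivity ((cos x ^+ 2 + sin x ^+ 2 - 1) * (sin y * G1 w)); [ring|rewrite c1; ring].
Qed.

Lemma rot_sign x : 0 <= x -> x <= pi -> e x = 1 - 2 * x / pi.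
Proof.
move=> x0 xpi.
have pi0 : 0 < pi :> R := pi_gt0 R.
have e_le z : `|e z| <= 1.
  by apply: Ex_bound => [|w]; [rewrite -rot0; exact: e_bm|exact: sgM_le1].
have epi : e pi = -1.
  rewrite /e -[RHS](Ex_cst P (-1)).
  apply: (Ex_eq_off (n := null G1)).
  - by rewrite -rot0; exact: e_bm.
  - exact: bm_cst.
  - exact: bm_null.
  - exact: Ex_null.
  move=> w; rewrite /rot cospi sinpi mul0r addr0 mulN1r sgrN.
  have [w0|w0] := eqVneq (G1 w) 0; first by rewrite w0 sgr0 (null1 w0) mul0r sub0r opprK normr1.
  by rewrite mulrN -expr2 sqr_sg w0 subrr normr0.
have := @additive_linear _ (fun x => (1 - e x) / 2) _ _ _ x x0 xpi.
move=> h; have : (1 - e x) / 2 = x / pi; last first.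
  by move=> h'; rewrite -mulrA -h'; lra.
apply: h => [y z y0 z0 yz|y y0 ypi|].
- by rewrite e_add//; lra.
- by have := e_le y; rewrite ler_norml => /andP[_]; lra.
- by rewrite epi; lra.
Qed.

(* Along an arc of length at most [pi], [`|rot x|] falls below the level [c] at most
   once, so [n] congruent small rotations have total crossing probability at most 1. *)
Lemma rot_cross (c x : R) : 0 <= x -> x <= pi / 2 ->
  \int[P]_w (exceeds c (G1 w) * (1 - exceeds c (rot x w))) <= 2 * x / pi.
Proof.
move=> x0 x2; have pi0 : 0 < pi :> R := pi_gt0 R.
pose f := exceeds c; pose g (y : R) : R := 1 - exceeds c y.
have bf : bm f by exact: bm_exceeds.
have bg : bm g by apply: bm_sub => //; exact: bm_cst.
have f01 y : 0 <= f y by exact: exceeds_ge0.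
have g01 y : 0 <= g y by rewrite subr_ge0 exceeds_le1.
rewrite (_ : \int[P]_w _ = \int[P]_w (f (G1 w) * g (rot x w)))//.
have [x00|x00] := eqVneq x 0.
  rewrite x00 mulr0 mul0r -[leRHS](Ex_cst P 0) le_eqVlt; apply/orP; left; apply/eqP.
  apply: eq_Rintegral => w _; rewrite rot0 /f /g /exceeds; case: ifP => _; ring.
have x1 : 0 < x by rewrite lt_def x00.
have bL (Y Z : T -> R) : L Y -> L Z -> bm (fun w => f (Y w) * g (Z w)).
  by move=> LY LZ; apply: bm_mul; [exact: bm_comp (L_meas LY)|exact: bm_comp (L_meas LZ)].
pose n := Num.trunc (pi / x).
have pix0 : 0 <= pi / x by rewrite divr_ge0// ltW.
have /andP[n1 n2] := truncn_itv pix0; rewrite -/n in n1 n2.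
have nx : n%:R * x <= pi by rewrite -ler_pdivlMr.
set I := \int[P]_w _.
have I0 : 0 <= I by apply: Rintegral_ge0 => w _; rewrite mulr_ge0.
have nI : n%:R * I <= 1.
  have -> : n%:R * I = \int[P]_w (\sum_(i < n) f (rot (i%:R * x) w) * g (rot (i.+1%:R * x) w)).
    rewrite (Rintegral_sum measurableT); last first.
      by move=> i; apply: intg_bm; apply: bL; exact: L_rot.
    rewrite (eq_bigr (fun=> I)) => [|i _].
      by rewrite sumr_const card_ord mulr_natl.
    rewrite /I -rot0; apply: (gaussian_law GL); rewrite ?ip_rot//; try exact: L_rot.
    - by rewrite !subrr.
    - by rewrite subr0 -natr1 mulrDl mul1r addrAC subrr add0r.
    - by rewrite !subrr.
  rewrite -[leRHS](Ex_cst P 1); apply: Ex_le.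
  - rewrite (_ : (fun=> _) = fun w => \sum_(i <- enum 'I_n) f (rot (i%:R * x) w) * g (rot (i.+1%:R * x) w)); last first.
      by apply/funext => w; rewrite big_enum.
    elim: (enum 'I_n) => [|i s ih].
      by under eq_fun do rewrite big_nil; exact: bm_cst.
    by under eq_fun do rewrite big_cons; apply: bm_add => //; apply: bL; exact: L_rot.
  - exact: bm_cst.
  move=> w.
  pose D i := (c < `|rot (i%:R * x) w|) && ~~ (c < `|rot (i.+1%:R * x) w|).
  rewrite (eq_bigr (fun i : 'I_n => (D i)%:R)); last first.
    by move=> i _; rewrite /f /g /D /exceeds; case: ifP; case: ifP => _ _ /=; ring.
  apply: sum_bool_le1 => i j /andP[ij jn] /andP[di1]; rewrite -leNgt => di2 /andP[dj1].
  rewrite -leNgt => dj2.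
  have le_n a b : (a <= b)%N -> a%:R * x <= b%:R * x by move=> ab; rewrite ler_wpM2r// ler_nat.
  have lt_n a b : (a < b)%N -> a%:R * x < b%:R * x by move=> ab; rewrite ltr_pM2r// ltr_nat.
  have [ij1|ij1] := eqVneq i.+1 j; first by move: dj1; rewrite -ij1 ltNge di2.
  have ij2 : (i.+1 < j)%N by rewrite ltn_neqAle ij1.
  apply: (@circle_no_alternation _ (G1 w) (G2 w) c (i%:R * x) (i.+1%:R * x) (j%:R * x) (j.+1%:R * x)) => //.
  - exact: lt_n.
  - exact: lt_n.
  - exact: lt_n.
  - have := le_n _ _ jn; have : 0 <= i%:R * x by rewrite mulr_ge0.
    by move: nx; lra.
have n3 : pi / (2 * x) <= n%:R.
  have h : 2 <= pi / x by rewrite ler_pdivlMr//; lra.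
  rewrite invfM mulrA mulrAC.
  by move: n2; rewrite -natr1; lra.
have : pi / (2 * x) * I <= 1 by apply: le_trans nI; rewrite ler_wpM2r.
rewrite mulrAC ler_pdivrMr ?mulr_gt0// mul1r mulrC => h.
by rewrite ler_pdivlMr.
Qed.

End rotation.

Lemma ip_norm_le1 U V : L U -> L V -> ip U U = 1 -> ip V V = 1 -> -1 <= ip U V <= 1.
Proof.
move=> LU LV U1 V1.
have := ip_ge0 P (fun w => 1 * U w + 1 * V w).
have := ip_ge0 P (fun w => 1 * U w + -1 * V w).
by rewrite !(ip_lin2 GL)// U1 V1 => ? ?; apply/andP; split; lra.
Qed.

(* Gram-Schmidt. *)
Lemma rot_exists U V : L U -> L V -> ip U U = 1 -> ip V V = 1 -> -1 < ip U V < 1 ->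
  exists G, [/\ L G, ip G G = 1, ip U G = 0 & V = rot U G (acos (ip U V))].
Proof.
move=> LU LV U1 V1 /andP[r1 r2]; set r := ip U V in r1 r2 *.
have s0 : 0 < 1 - r ^+ 2 by nra.
pose s := Num.sqrt (1 - r ^+ 2).
have sgt0 : 0 < s by rewrite sqrtr_gt0.
have sE : s ^+ 2 = 1 - r ^+ 2 by rewrite sqr_sqrtr// ltW.
have sn0 : s != 0 by rewrite gt_eqF.
exists (fun w => s^-1 * V w + - (r / s) * U w); split.
- exact: L_lin.
- rewrite (ip_lin2 GL)// U1 V1 (ipC _ V U) -/r !mulr1.
  transitivity (s^-1 ^+ 2 * (1 - r ^+ 2)); first by field.
  by rewrite -sE -exprMn mulVf// expr1n.
- by rewrite (ip_linr GL)// U1 -/r; field.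
- apply/funext => w; rewrite /rot acosK ?in_itv/= ?(ltW r1) ?(ltW r2)//.
  rewrite sin_acos ?(ltW r1) ?(ltW r2)// -/s; field.
  by rewrite sn0.
Qed.

Lemma sheppard U V : L U -> L V -> ip U U = 1 -> ip V V = 1 ->
  \int[P]_w (Num.sg (U w) * Num.sg (V w)) = 1 - 2 * acos (ip U V) / pi.
Proof.
move=> LU LV U1 V1; have pi0 : pi != 0 :> R by rewrite gt_eqF// pi_gt0.
have /andP[r1 r2] := ip_norm_le1 LU LV U1 V1.
have UU : \int[P]_w (Num.sg (U w) * Num.sg (U w)) = 1.
  rewrite -[RHS](Ex_cst P 1); apply: (Ex_eq_off (n := null U)).
  - by apply: bm_mul; exact: sgY.
  - exact: bm_cst.
  - exact: bm_null.
  - exact: Ex_null.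
  move=> w; have [w0|w0] := eqVneq (U w) 0; first by rewrite w0 sgr0 (null1 w0) mul0r sub0r normrN normr1.
  by rewrite -expr2 sqr_sg w0 subrr normr0.
have [r1e|r1n] := eqVneq (ip U V) 1.
  rewrite r1e acos1 mulr0 mul0r subr0 -UU.
  by apply: (gaussian_law GL) => //; rewrite ?r1e ?U1 ?V1//; exact: bm_sg.
have [r2e|r2n] := eqVneq (ip U V) (-1).
  rewrite r2e acosN1 -mulrA divff// mulr1 (_ : 1 - 2 = - 1); last by lra.
  rewrite -UU; have LN := L_lin (-1) 0 LU LU.
  transitivity (\int[P]_w (Num.sg (U w) * Num.sg (-1 * U w + 0 * U w))).
    apply: (gaussian_law GL) => //; last 2 first.
    - exact: bm_sg.
    - exact: bm_sg.
    - by rewrite (ip_linr GL)// r2e U1; lra.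
    - by rewrite (ip_lin2 GL)// V1 U1; lra.
  rewrite -[RHS]mulN1r -[RHS]ExZ; last by apply: bm_mul; exact: sgY.
  by apply: eq_Rintegral => w _; rewrite mul0r addr0 mulN1r sgrN mulN1r mulrN.
have r12 : -1 < ip U V < 1 by rewrite !lt_def r1 r2 r2n eq_sym r1n.
have [G [LG G1 UG VE]] := rot_exists LU LV U1 V1 r12.
rewrite [X in \int[P]_w (_ * Num.sg (X w))]VE.
by rewrite (rot_sign LU LG)// ?acos_ge0 ?acos_lepi// r1 r2.
Qed.

End gaussian_signs.

Section gaussian_covariances.
Context {d : measure_display} {T : measurableType d} {R : realType}.
Variables (P : probability T R) (L : set (T -> R)).
Hypothesis GL : gaussian_space P L.
Implicit Types (Y Z U V X : T -> R) (f g : R -> R).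
Local Notation ip := (ip P).
Local Notation J := (@jordan_cst R).

Let L_lin a b Y Z : L Y -> L Z -> L (fun w => a * Y w + b * Z w).
Proof. by case: GL => + _ _ _ _; apply. Qed.

Let L_meas Y : L Y -> measurable_fun setT Y.
Proof. by case: GL => _ + _ _ _; apply. Qed.

Let sgY Y : L Y -> bm (fun w => Num.sg (Y w)).
Proof. by move=> LY; exact: bm_comp bm_sg (L_meas LY). Qed.

Let sg_le1 (x : R) : `|Num.sg x| <= 1.
Proof. by rewrite normr_sg lern1 leq_b1. Qed.

Lemma jordan_cst_ge1 : 1 <= J.
Proof.
rewrite /jordan_cst ler_pdivlMr ?cos1_gt0// mul1r.
by have := cos_le1 (1 : R); lra.
Qed.

Let sg_mid (x v n1 n2 : R) : 0 <= n1 -> 0 <= n2 -> (x = 0 -> n1 = 1) -> (v = 0 -> n2 = 1) ->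
  `|Num.sg x - Num.sg ((x + v) / 2)| <= (1 - Num.sg x * Num.sg v) + 2 * (n1 + n2).
Proof.
move=> n10 n20 h1 h2.
have s3 := sg_le1 ((x + v) / 2); move: s3; rewrite ler_norml => /andP[s31 s32].
case: (ltgtP x 0) => [x0|x0|x0].
- case: (ltgtP v 0) => [v0|v0|v0].
  + rewrite (ltr0_sg x0) (ltr0_sg v0) ltr0_sg ?subrr ?normr0; lra.
  + by rewrite (ltr0_sg x0) (gtr0_sg v0) ler_norml; apply/andP; split; lra.
  + by rewrite (h2 v0) (ltr0_sg x0) v0 sgr0 mulr0 -{1}v0 ler_norml; apply/andP; split; lra.
- case: (ltgtP v 0) => [v0|v0|v0].
  + by rewrite (gtr0_sg x0) (ltr0_sg v0) ler_norml; apply/andP; split; lra.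
  + rewrite (gtr0_sg x0) (gtr0_sg v0) gtr0_sg ?subrr ?normr0; lra.
  + by rewrite (h2 v0) (gtr0_sg x0) v0 sgr0 mulr0 -{1}v0 ler_norml; apply/andP; split; lra.
- by rewrite (h1 x0) {1 3}x0 sgr0 mul0r ler_norml; apply/andP; split; lra.
Qed.

(* Here [X - m] is orthogonal to [m], so [X] and [X - 2 m] are unit vectors at an angle
   [y] with [sin (y / 2) = sigma], and [X - m] is their midpoint. *)
Lemma sign_perturbation X m (sigma : R) : L X -> L m -> ip X X = 1 ->
  ip X m = ip m m -> 0 <= sigma -> ip m m <= sigma ^+ 2 ->
  \int[P]_w `|Num.sg (X w) - Num.sg (1 * X w + -1 * m w)| <= 2 * J * sigma.
Proof.
move=> LX Lm X1 Xm sg0 msg.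
pose V w := 1 * X w + -2 * m w.
have LV : L V by exact: L_lin.
have V1 : ip V V = 1 by rewrite (ip_lin2 GL)// X1 Xm; lra.
have XV : ip X V = 1 - 2 * ip m m by rewrite (ip_linr GL)// X1 Xm; lra.
pose nX : T -> R := \1_(X @^-1` [set 0]); pose nV : T -> R := \1_(V @^-1` [set 0]).
have mX0 Y : L Y -> measurable (Y @^-1` [set 0]).
  by move=> LY; rewrite -[_ @^-1` _]setTI; exact: L_meas.
have bX : bm nX by apply: bm_indic; exact: mX0.
have bV : bm nV by apply: bm_indic; exact: mX0.
have E0 Y : L Y -> ip Y Y = 1 -> \int[P]_w (\1_(Y @^-1` [set 0]) w : R) = 0.
  move=> LY Y1; rewrite /Rintegral integral_indic//; last exact: mX0.
  rewrite setIT; case: GL => _ _ _ _ h.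
  by transitivity (fine (P (Y @^-1` [set 0]))) => //; rewrite h// Y1.
have b1 : bm (fun w => Num.sg (X w) - Num.sg (1 * X w + -1 * m w)).
  apply: bm_sub; first exact: sgY.
  by apply: (@sgY (fun w => 1 * X w + -1 * m w)); exact: L_lin.
have b2 : bm (fun w => 1 - Num.sg (X w) * Num.sg (V w)).
  by apply: bm_sub; [exact: bm_cst|apply: bm_mul; exact: sgY].
apply: (@le_trans _ _ (\int[P]_w ((1 - Num.sg (X w) * Num.sg (V w)) + 2 * (nX w + nV w)))).
  apply: Ex_le.
  - exact: bm_norm.
  - by apply: bm_add => //; apply: bm_scale; exact: bm_add.
  move=> w; rewrite (_ : 1 * X w + -1 * m w = (X w + V w) / 2); last by rewrite /V; field.
  apply: sg_mid; rewrite /nX /nV ?indicE ?ler0n// => h; by rewrite mem_set.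
rewrite ExD//; last by apply: bm_scale; exact: bm_add.
rewrite ExZ; last exact: bm_add.
rewrite ExD// !E0// addr0 mulr0 addr0.
rewrite ExB ?Ex_cst; [|exact: bm_cst|by apply: bm_mul; exact: sgY].
rewrite (sheppard GL)// XV; set y := acos _.
have m0 := ip_ge0 P m.
have := ip_norm_le1 GL LX LV X1 V1; rewrite XV => r12.
have y0 : 0 <= y by exact: acos_ge0.
have ypi : y <= pi by exact: acos_lepi.
have pi2 : 2 <= pi :> R := pi_ge2 R.
have yJ : y / 2 <= J * sin (y / 2) by apply: jordan_le; lra.
have sy : sin (y / 2) <= sigma.
  rewrite -(ler_pXn2r (n := 2)) ?nnegrE//; last by apply: sin_ge0_pi; lra.
  have c2 : cos y = 1 - 2 * ip m m by rewrite /y acosK// in_itv.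
  have : cos (y / 2 + y / 2) = 1 - 2 * sin (y / 2) ^+ 2.
    by rewrite cosD -!expr2; have := cos2Dsin2 (y / 2); lra.
  by rewrite (_ : y / 2 + y / 2 = y) ?c2; [lra|field].
have J0 := @jordan_cst_gt0 R.
have yJ' : y <= 2 * J * sigma.
  have : J * sin (y / 2) <= J * sigma by rewrite ler_wpM2l// ltW.
  by lra.
rewrite opprD opprK addrA subrr add0r.
apply: le_trans yJ'.
by rewrite ler_pdivrMr ?pi_gt0//; nra.
Qed.

Lemma regression X1 X2 X (delta : R) : L X1 -> L X2 -> L X -> ip X1 X1 = 1 ->
  ip X2 X2 = 1 -> 0 < delta -> `|ip X1 X2| <= 1 - delta ->
  exists m, [/\ L m, ip X m = ip m m,
    ip X1 (fun w => 1 * X w + -1 * m w) = 0, ip X2 (fun w => 1 * X w + -1 * m w) = 0 &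
    ip m m <= ((`|ip X1 X| + `|ip X2 X|) / delta) ^+ 2].
Proof.
move=> LX1 LX2 LX X11 X22 d0 rd; set r := ip X1 X2 in rd *.
set r1 := ip X1 X; set r2 := ip X2 X.
have rn : `|r| <= 1 by lra.
have r20 : r ^+ 2 = `|r| ^+ 2 by rewrite -normrX ger0_norm ?sqr_ge0.
have rn0 := normr_ge0 r.
have Dd : delta ^+ 2 <= 1 - r ^+ 2 by rewrite r20; nra.
have D0 : 0 < 1 - r ^+ 2 by apply: lt_le_trans Dd; rewrite exprn_gt0.
have Dn0 : 1 - r ^+ 2 != 0 by rewrite gt_eqF.
pose a := (r1 - r * r2) / (1 - r ^+ 2); pose b := (r2 - r * r1) / (1 - r ^+ 2).
pose m w := a * X1 w + b * X2 w.
have Lm : L m by exact: L_lin.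
have m1 : ip X1 m = r1 by rewrite (ip_linr GL)// X11 -/r /a /b; field.
have m2 : ip X2 m = r2 by rewrite (ip_linr GL)// X22 (ipC _ X2 X1) -/r /a /b; field.
have mX : ip X m = a * r1 + b * r2 by rewrite (ip_linr GL)// !(ipC _ X).
have mm : ip m m = a * r1 + b * r2 by rewrite {1}/m (ip_linl GL)// m1 m2.
exists m; split => //.
- by rewrite mX mm.
- by rewrite (ip_linr GL)// m1 -/r1; lra.
- by rewrite (ip_linr GL)// m2 -/r2; lra.
rewrite mm (_ : _ + _ = (r1 ^+ 2 + r2 ^+ 2 - 2 * r * r1 * r2) / (1 - r ^+ 2)); last by rewrite /a /b; field.
rewrite exprMn exprVn.
apply: ler_pM; rewrite ?invr_ge0 ?(ltW D0)//.
- have : 0 <= ip m m by exact: ip_ge0.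
  rewrite mm (_ : _ + _ = (r1 ^+ 2 + r2 ^+ 2 - 2 * r * r1 * r2) / (1 - r ^+ 2)); last by rewrite /a /b; field.
  by rewrite pmulr_lge0// invr_gt0.
- have e1 : r1 ^+ 2 = `|r1| ^+ 2 by rewrite -normrX ger0_norm ?sqr_ge0.
  have e2 : r2 ^+ 2 = `|r2| ^+ 2 by rewrite -normrX ger0_norm ?sqr_ge0.
  have : - (r * r1 * r2) <= `|r1| * `|r2|.
    by rewrite (le_trans (ler_norm _))// normrN !normrM -mulrA ler_piMl.
  by rewrite e1 e2; nra.
- by rewrite lef_pV2// posrE exprn_gt0.
Qed.

Let ExM_bound (f g h : T -> R) : bm f -> bm g -> bm h -> (forall w, `|f w| <= 1) ->
  `|\int[P]_w (f w * g w) - \int[P]_w (f w * h w)| <= \int[P]_w `|g w - h w|.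
Proof.
move=> bf bg bh f1.
rewrite -ExB; [|exact: bm_mul..].
apply: Ex_norm_le.
- by apply: bm_sub; exact: bm_mul.
- by apply: bm_norm; exact: bm_sub.
by move=> w; rewrite -mulrBr normrM ler_piMl.
Qed.

Lemma gaussian_cov_sign X1 X2 X3 X4 (delta : R) : L X1 -> L X2 -> L X3 -> L X4 ->
  ip X1 X1 = 1 -> ip X2 X2 = 1 -> ip X3 X3 = 1 -> ip X4 X4 = 1 ->
  0 < delta -> `|ip X1 X2| <= 1 - delta ->
  `|\int[P]_w (Num.sg (X1 w) * Num.sg (X2 w) * (Num.sg (X3 w) * Num.sg (X4 w))) -
    \int[P]_w (Num.sg (X1 w) * Num.sg (X2 w)) *
    \int[P]_w (Num.sg (X3 w) * Num.sg (X4 w))| <=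
  4 * J / delta * (`|ip X1 X3| + `|ip X2 X3| + `|ip X1 X4| + `|ip X2 X4|).
Proof.
move=> L1 L2 L3 L4 e1 e2 e3 e4 d0 rd.
have [m3 [Lm3 Xm3 m31 m32 m3d]] := regression L1 L2 L3 e1 e2 d0 rd.
have [m4 [Lm4 Xm4 m41 m42 m4d]] := regression L1 L2 L4 e1 e2 d0 rd.
set t3 := _ / delta in m3d; set t4 := _ / delta in m4d.
have t30 : 0 <= t3 by rewrite divr_ge0 ?addr_ge0// ltW.
have t40 : 0 <= t4 by rewrite divr_ge0 ?addr_ge0// ltW.
have p3 := sign_perturbation L3 Lm3 e3 Xm3 t30 m3d.
have p4 := sign_perturbation L4 Lm4 e4 Xm4 t40 m4d.
set r3 := fun w => 1 * X3 w + -1 * m3 w in m31 m32 p3.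
set r4 := fun w => 1 * X4 w + -1 * m4 w in m41 m42 p4.
have Lr3 : L r3 by exact: L_lin.
have Lr4 : L r4 by exact: L_lin.
have b12 : bm (fun w => Num.sg (X1 w) * Num.sg (X2 w)) by apply: bm_mul; exact: sgY.
have b34 : bm (fun w => Num.sg (X3 w) * Num.sg (X4 w)) by apply: bm_mul; exact: sgY.
have br : bm (fun w => Num.sg (r3 w) * Num.sg (r4 w)) by apply: bm_mul; exact: sgY.
have le1 w : `|Num.sg (X1 w) * Num.sg (X2 w)| <= 1 by rewrite normrM mulr_ile1.
have ind := gaussian_indep GL L1 L2 Lr3 Lr4 m31 m41 m32 m42 bm_sg bm_sg bm_sg bm_sg.
have E34 : \int[P]_w `|Num.sg (X3 w) * Num.sg (X4 w) - Num.sg (r3 w) * Num.sg (r4 w)| <=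
    2 * J * (t3 + t4).
  rewrite mulrDr; apply: le_trans (lerD p3 p4).
  have bd3 : bm (fun w => `|Num.sg (X3 w) - Num.sg (r3 w)|) by apply: bm_norm; apply: bm_sub; exact: sgY.
  have bd4 : bm (fun w => `|Num.sg (X4 w) - Num.sg (r4 w)|) by apply: bm_norm; apply: bm_sub; exact: sgY.
  rewrite -ExD//; apply: Ex_le.
  - by apply: bm_norm; exact: bm_sub.
  - exact: bm_add.
  move=> w; rewrite (_ : _ - _ = (Num.sg (X3 w) - Num.sg (r3 w)) * Num.sg (X4 w)
     + Num.sg (r3 w) * (Num.sg (X4 w) - Num.sg (r4 w))); last by ring.
  by rewrite (le_trans (ler_normD _ _))// !normrM lerD// ?ler_piMr// ler_piMl.
have A := ExM_bound b12 b34 br le1.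
have B : `|\int[P]_w (Num.sg (X3 w) * Num.sg (X4 w)) - \int[P]_w (Num.sg (r3 w) * Num.sg (r4 w))|
    <= 2 * J * (t3 + t4).
  rewrite -ExB//; apply: le_trans E34; apply: Ex_norm_le => //; first exact: bm_sub.
  by apply: bm_norm; exact: bm_sub.
have C := Ex_bound P b12 le1.
have A' := le_trans A E34; rewrite ind in A'.
set I := \int[P]_w (_ * _ * (_ * _)) in A' *.
set I12 := \int[P]_w (Num.sg (X1 w) * _) in A' C *.
set I34 := \int[P]_w (Num.sg (X3 w) * _) in B *.
set Ir := \int[P]_w (_ * _) in A' B.
rewrite (_ : I - I12 * I34 = (I - I12 * Ir) + - I12 * (I34 - Ir)); last by ring.
rewrite (le_trans (ler_normD _ _))//.
have h : `|- I12 * (I34 - Ir)| <= 2 * J * (t3 + t4).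
  by rewrite normrM normrN; apply: le_trans B; rewrite ler_piMl.
rewrite (le_trans (lerD A' h))// /t3 /t4.
rewrite [leRHS](_ : _ = 4 * J * ((`|ip X1 X3| + `|ip X2 X3|) / delta + (`|ip X1 X4| + `|ip X2 X4|) / delta)).
  by lra.
by field; rewrite gt_eqF.
Qed.

Lemma gaussian_cov_exceeds U V (c : R) : L U -> L V -> ip U U = 1 -> ip V V = 1 ->
  `|\int[P]_w (exceeds c (U w) * exceeds c (V w)) -
    \int[P]_w exceeds c (U w) * \int[P]_w exceeds c (V w)| <= 2 * J * `|ip U V|.
Proof.
move=> LU LV U1 V1; set r := ip U V.
have J1 := jordan_cst_ge1; pose f := exceeds c.
have bf : bm f by exact: bm_exceeds.
have f0 y : 0 <= f y by exact: exceeds_ge0.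
have f1 y : f y <= 1 by exact: exceeds_le1.
have fn y : `|f y| <= 1 by rewrite ger0_norm.
have bY Y : L Y -> bm (fun w => f (Y w)) by move=> LY; exact: bm_comp (L_meas LY).
have /andP[r1 r2] := ip_norm_le1 GL LU LV U1 V1; rewrite -/r in r1 r2.
have [r3|r3] := boolP (-1 < r < 1); last first.
  have -> : `|r| = 1.
    move: r3; rewrite !lt_def r1 r2 !andbT negb_and !negbK => /orP[/eqP->|/eqP<-].
      by rewrite normrN normr1.
    by rewrite normr1.
  have h1 := @Ex_bound _ _ _ P _ 1 (bm_mul (bY _ LU) (bY _ LV)) _.
  have h2 := Ex_bound P (bY _ LU) (fun w => fn _).
  have h3 := Ex_bound P (bY _ LV) (fun w => fn _).
  rewrite (le_trans (ler_normB _ _))// (@le_trans _ _ 2)//; last by lra.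
  rewrite (_ : 2 = 1 + 1 :> R)// lerD//; last by rewrite normrM mulr_ile1.
  by apply: h1 => w; rewrite normrM mulr_ile1.
have [G [LG G1 UG VE]] := rot_exists GL LU LV U1 V1 r3; rewrite -/r in VE.
set x := acos r in VE.
have x0 : 0 <= x by apply: acos_ge0; rewrite r1 r2.
have xpi : x <= pi by apply: acos_lepi; rewrite r1 r2.
have cx : cos x = r by rewrite acosK// in_itv/= r1 r2.
pose th := `|pi / 2 - x|.
have th0 : 0 <= th by exact: normr_ge0.
have th2 : th <= pi / 2 by rewrite ler_norml; apply/andP; split; lra.
have cth : cos th = sin x.
  have : cos (pi / 2 - x) = sin x by rewrite cosB cos_pihalf sin_pihalf mul0r add0r mul1r.
  by rewrite /th; case: (ler0P (pi / 2 - x)) => // _ <-; rewrite cosN.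
have sth : sin th = `|r|.
  have e : sin (pi / 2 - x) = r by rewrite sinB cos_pihalf sin_pihalf mul0r subr0 mul1r.
  have s0 : 0 <= sin th by apply: sin_ge0_pi; rewrite th0/=; have := pi_gt0 R; lra.
  by rewrite -(ger0_norm s0) /th; case: (ler0P (pi / 2 - x)) => _; rewrite ?sinN ?normrN e.
have thJ : th <= J * `|r| by rewrite -sth; exact: jordan_le.
have pi2 : 2 <= pi :> R := pi_ge2 R.
have LR y : L (rot U G y) by exact: L_lin.
have cross (Y Z : T -> R) : L Y -> L Z -> ip Y Y = 1 -> ip Z Z = 1 -> ip Y Z = sin x ->
    \int[P]_w (f (Y w) * (1 - f (Z w))) <= th.
  move=> LY LZ Y1 Z1 YZ.
  have := rot_cross GL LU LG U1 G1 UG c th0 th2.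
  have -> : \int[P]_w (f (Y w) * (1 - f (Z w))) = \int[P]_w (exceeds c (U w) * (1 - exceeds c (rot U G th w))).
    apply: (gaussian_law GL (g := fun y => 1 - f y)) => //.
    - by rewrite Y1 U1.
    - by rewrite YZ -{1}(rot0 U G) (ip_rot GL LU LG)// subr0 cth.
    - by rewrite Z1 (ip_rot GL LU LG)// subrr cos0.
    - by apply: bm_sub => //; exact: bm_cst.
  move/le_trans; apply; rewrite ler_pdivrMr ?pi_gt0//; nra.
have VG : ip V G = sin x by rewrite VE (ip_linl GL)// UG G1; lra.
have EVG : \int[P]_w f (V w) = \int[P]_w f (G w).
  have b1 : bm (fun _ : R => 1 : R) by exact: (bm_cst (1 : R)).
  have := gaussian_law GL LV LV LG LG _ _ _ bf b1; rewrite V1 G1 => /(_ erefl erefl erefl).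
  under eq_Rintegral do rewrite /= mulr1.
  by under [RHS]eq_Rintegral do rewrite /= mulr1.
have ind : \int[P]_w (f (U w) * f (G w)) = \int[P]_w f (U w) * \int[P]_w f (G w).
  have b1 : bm (fun _ : R => 1 : R) by exact: (bm_cst (1 : R)).
  have := gaussian_indep GL LU LU LG LG UG UG UG UG bf b1 bf b1.
  under eq_Rintegral do rewrite /= !mulr1.
  under [X in _ = X * _]eq_Rintegral do rewrite /= mulr1.
  by under [X in _ = _ * X]eq_Rintegral do rewrite /= mulr1.
rewrite [X in _ - _ * X]EVG -ind.
have A := ExM_bound (bY _ LU) (bY _ LV) (bY _ LG) (fun w => fn _).
apply: (le_trans A).
apply: (@le_trans _ _ (\int[P]_w (f (V w) * (1 - f (G w)) + f (G w) * (1 - f (V w))))).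
  have b1 : bm (fun _ : R => 1 : R) by exact: (bm_cst (1 : R)).
  apply: Ex_le.
  - by apply: bm_norm; apply: bm_sub; exact: bY.
  - have b2 Y Z : L Y -> L Z -> bm (fun w => f (Y w) * (1 - f (Z w))).
      move=> LY LZ; apply: bm_mul; first exact: bY.
      by apply: bm_sub; [exact: (bm_cst (1 : R))|exact: bY].
    by apply: bm_add; exact: b2.
  move=> w; rewrite ler_norml.
  by have := f0 (V w); have := f1 (V w); have := f0 (G w); have := f1 (G w) => *;
    apply/andP; split; nra.
rewrite ExD; last 2 first.
- by apply: bm_mul; [exact: bY|apply: bm_sub; [exact: (bm_cst (1 : R))|exact: bY]].
- by apply: bm_mul; [exact: bY|apply: bm_sub; [exact: (bm_cst (1 : R))|exact: bY]].
have := cross _ _ LV LG V1 G1 VG; have := cross _ _ LG LV G1 V1 _.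
rewrite ipC => /(_ VG) h1 h2; lra.
Qed.

End gaussian_covariances.

(** * Parseval's inequality for cosine coefficients *)

Section cosine_series.
Context {R : realType}.
Local Notation leb := (@lebesgue_measure R).
Local Notation D := (@circle R).
Implicit Types (u v f g : R -> R) (h k n : nat).

Lemma measurable_circle : measurable D.
Proof. exact: measurable_itv. Qed.
Let mD := measurable_circle.

Lemma circle_lty : (leb D < +oo)%E.
Proof. by rewrite /circle lebesgue_measure_itv; case: ifP => _; rewrite ?ltry. Qed.

Lemma circleP x : D x <-> `|x| <= pi.
Proof. by rewrite /circle /= in_itv/= ler_norml. Qed.

Definition cosn h (x : R) : R := cos (h%:R * x).

Lemma continuous_cosn h : continuous (cosn h).
Proof.
move=> x; apply: continuous_comp; last exact: continuous_cos.
by apply: cvgM; [exact: cvg_cst|exact: cvg_id].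
Qed.

Lemma measurable_cosn h (E : set R) : measurable_fun E (cosn h).
Proof. by apply: measurable_funTS; apply: continuous_measurable_fun; exact: continuous_cosn. Qed.

Lemma cosn_le1 h x : `|cosn h x| <= 1.
Proof. by rewrite ler_norml cos_geN1 cos_le1. Qed.

Lemma sin_nat_pi n : sin (n%:R * pi) = 0 :> R.
Proof.
elim: n => [|n ih]; first by rewrite mul0r sin0.
by rewrite -natr1 mulrDl mul1r sinDpi ih oppr0.
Qed.

Definition cosn_weight h : R := if h == 0%N then 2 * pi else pi.

Lemma cosn_weight_gt0 h : 0 < cosn_weight h.
Proof. by rewrite /cosn_weight; case: ifP => _; rewrite ?mulr_gt0// pi_gt0. Qed.

Lemma Rintegral_cosn h : \int[leb]_(x in D) cosn h x = if h == 0%N then 2 * pi else 0.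
Proof.
have pi0 : 0 < pi :> R := pi_gt0 R.
have ab : - pi < pi :> R by lra.
case: (eqVneq h 0%N) => [->|h0].
  rewrite (@FTC_is_derive _ (fun x => 1 * x + 0) (cosn 0) _ _ ab); last exact: continuous_cosn.
    by lra.
  by move=> x; rewrite /cosn mul0r cos0; exact: has_derive_affine.
have hn0 : h%:R != 0 :> R by rewrite pnatr_eq0.
rewrite (@FTC_is_derive _ (fun x => h%:R^-1 * sin (h%:R * x + 0)) (cosn h) _ _ ab); last exact: continuous_cosn.
  by rewrite !addr0 mulrN sinN sin_nat_pi; lra.
move=> x; apply: has_derive_eq.
  by apply: has_derive_scale; apply: has_derive_sin; exact: has_derive_affine.
by rewrite /= addr0 mulrCA mulVf// mulr1.
Qed.

Lemma cosnM h k x :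
  cosn h x * cosn k x = 2^-1 * (cosn (h + k) x + cosn (h - k + (k - h)) x).
Proof.
have -> : cosn (h - k + (k - h)) x = cos (h%:R * x - k%:R * x).
  rewrite /cosn; have [hk|hk] := leqP h k.
    rewrite (eqP (_ : h - k == 0)%N) ?subn_eq0// add0n natrB//.
    by rewrite -cosN; congr cos; ring.
  rewrite (eqP (_ : k - h == 0)%N) ?subn_eq0 ?(ltnW hk)// addn0 natrB ?(ltnW hk)//.
  by congr cos; ring.
rewrite /cosn natrD mulrDl; move: (h%:R * x) (k%:R * x) => a b.
by rewrite cosB cosD; field.
Qed.

Let intg_cosn h : leb.-integrable D (EFin \o cosn h).
Proof.
apply: (@intg_bounded _ _ _ leb D mD _ 1 circle_lty); first exact: measurable_cosn.
by move=> x _; exact: cosn_le1.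
Qed.

Lemma Rintegral_cosnM h k :
  \int[leb]_(x in D) (cosn h x * cosn k x) = if h == k then cosn_weight h else 0.
Proof.
transitivity (\int[leb]_(x in D) (2^-1 * (cosn (h + k) x + cosn (h - k + (k - h)) x))).
  by apply: eq_Rintegral => x _; exact: cosnM.
rewrite RintegralZl//; last by apply: intg_add.
rewrite RintegralD// !Rintegral_cosn /cosn_weight.
have [->|hk] := eqVneq h k.
  by rewrite subnn addn0 eqxx addnn double_eq0; case: ifP => _; lra.
rewrite (_ : (h + k == 0)%N = false); last by apply/negbTE; lia.
by rewrite (_ : (h - k + (k - h) == 0)%N = false) ?addr0 ?mulr0//; apply/negbTE; lia.
Qed.

Let V := lspan [set f : R -> R | exists h, f = cosn h].

Let V_mul f g : V f -> V g -> V (fun x => f x * g x).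
Proof.
apply: lspan_mul => {}f {}g [h ->] [k ->].
have -> : (fun x => cosn h x * cosn k x) =
    fun x => 2^-1 * (cosn (h + k) x + cosn (h - k + (k - h)) x).
  by apply/funext => x; exact: cosnM.
by apply: lspan_scale; apply: lspan_add; apply: lspan_base; eexists.
Qed.

Let V_one : V (fun=> 1).
Proof.
by apply: lspan_base; exists 0%N; apply/funext => x; rewrite /cosn mul0r cos0.
Qed.

Let V_cont f : V f -> continuous f.
Proof.
elim=> {f} [f [h ->]|f g _ cf _ cg|c f _ cf]; first exact: continuous_cosn.
  by move=> x; apply: cvgD; [exact: cf|exact: cg].
by move=> x; apply: cvgM; [exact: cvg_cst|exact: cf].
Qed.

Let V_bounded f : V f -> exists M : R, forall x, D x -> `|f x| <= M.
Proof.
elim=> {f} [f [h ->]|f g _ [M fM] _ [N gN]|c f _ [M fM]].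
- by exists 1 => x _; exact: cosn_le1.
- by exists (M + N) => x Dx; rewrite (le_trans (ler_normD _ _))// lerD ?fM ?gN.
- by exists (`|c| * M) => x Dx; rewrite normrM ler_wpM2l ?fM.
Qed.

Let V_add f g : V f -> V g -> V (fun x => f x + g x).
Proof. exact: lspan_add. Qed.

Let V_scale c f : V f -> V (fun x => c * f x).
Proof. exact: lspan_scale. Qed.

Let V_sum f : V f -> exists n (a : nat -> R), forall x, f x = \sum_(h < n) a h * cosn h x.
Proof.
have ext n m (a : nat -> R) x : (n <= m)%N ->
    \sum_(h < n) a h * cosn h x = \sum_(h < m) (if (h < n)%N then a h else 0) * cosn h x.
  move=> nm; rewrite (big_ord_widen m (fun h => a h * cosn h x) nm) big_mkcond/=.
  by apply: eq_bigr => i _; case: ifP => _ //; rewrite mul0r.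
elim=> {f} [f [h ->]|f g _ [n [a fa]] _ [m [b gb]]|c f _ [n [a fa]]].
- exists h.+1, (fun k => (k == h)%:R) => x; rewrite big_ord_recr/= eqxx mul1r big1 ?add0r// => i _.
  by rewrite ltn_eqF ?mul0r.
- exists (maxn n m), (fun h => (if (h < n)%N then a h else 0) + (if (h < m)%N then b h else 0)) => x.
  rewrite fa gb (ext n (maxn n m)) ?leq_maxl// (ext m (maxn n m)) ?leq_maxr// -big_split/=.
  by apply: eq_bigr => i _; rewrite mulrDl.
- exists n, (fun h => c * a h) => x; rewrite fa mulr_sumr.
  by apply: eq_bigr => i _; rewrite mulrA.
Qed.

Lemma bpc_abs (psi : R -> R) (M : R) : measurable_fun setT psi -> (forall y, `|psi y| <= M) ->
  bpc D V (fun x => psi `|x|).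
Proof.
move=> mpsi psiM.
apply: (@bpc_borel R R D V V_add V_scale V_mul V_one V_bounded (fun x => `|x|) psi M) => // t.
have cst c : bpc D V (fun=> c) by apply: bpc_cst => //.
have sgb : exists M : R, forall x, D x -> `|Num.sg (`|x| - t)| <= M.
  by exists 1 => x _; rewrite normr_sg lern1 leq_b1.
have bddc (c : R) : exists M : R, forall x : R, D x -> `|c| <= M by exists `|c|.
have [t0|t0] := ltP t 0.
  apply: (bpc_eq (f := fun=> 1)) => // x Dx.
  by rewrite gtr0_sg// subr_gt0 (lt_le_trans t0).
have [tpi|tpi] := ltP pi t.
  apply: (bpc_eq (f := fun=> -1)) => // x /circleP xpi.
  by rewrite ltr0_sg// subr_lt0 (le_lt_trans xpi).
apply: (bpc_eq (f := fun x => Num.sg (cos t + -1 * cosn 1 x))).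
- apply: bpc_sg => //; apply: bpc_add => //; apply: bpc_scale => //.
  by apply: bpc_base; apply: lspan_base; exists 1%N.
- move=> x /circleP xpi; rewrite mulN1r /cosn mul1r.
  have -> : cos x = cos `|x| by case: (ler0P x) => _; rewrite ?cosN.
  have inI y : 0 <= y -> y <= pi -> y \in `[0, pi] by move=> *; rewrite in_itv/=; apply/andP.
  case: (ltgtP `|x| t) => [h|h|->].
  + by rewrite [RHS]ltr0_sg ?subr_lt0// ltr0_sg// subr_lt0 ltr_cos ?inI.
  + by rewrite [RHS]gtr0_sg ?subr_gt0// gtr0_sg// subr_gt0 ltr_cos ?inI.
  + by rewrite !subrr.
- by exists 1 => x _; rewrite normr_sg lern1 leq_b1.
Qed.

Variables (u : R -> R) (B : R).
Hypothesis iu : leb.-integrable D (EFin \o u).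
Hypothesis u_even : forall x, D x -> u (- x) = u x.
Let c h := \int[leb]_(x in D) (u x * cosn h x).
Hypothesis uB : forall n, \sum_(h < n) c h ^+ 2 / cosn_weight h <= B.

Let mu_ : measurable_fun D u.
Proof. exact: intg_measurable iu. Qed.

Let iuM f (M : R) : measurable_fun D f -> (forall x, D x -> `|f x| <= M) ->
  leb.-integrable D (EFin \o (fun x => u x * f x)).
Proof.
move=> mf fM; have := @intg_mul_bounded _ _ _ leb D mD u f M iu mf fM.
by under eq_fun do rewrite mulrC.
Qed.

Let iM f (M : R) : measurable_fun D f -> (forall x, D x -> `|f x| <= M) ->
  leb.-integrable D (EFin \o (fun x => f x * f x)).
Proof.
move=> mf fM; apply: (@intg_bounded _ _ _ leb D mD _ (M * M) circle_lty).
  exact: measurable_funM.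
by move=> x Dx; rewrite normrM ler_pM ?fM.
Qed.

Let Qb f := 2 * \int[leb]_(x in D) (u x * f x) - \int[leb]_(x in D) (f x * f x) <= B.

Let Q_trig f : V f -> Qb f.
Proof.
move=> /V_sum[n [a fa]]; apply: le_trans (uB n); rewrite /Qb.
have -> : \int[leb]_(x in D) (u x * f x) = \sum_(h < n) a h * c h.
  transitivity (\int[leb]_(x in D) (\sum_(h < n) a h * (u x * cosn h x))).
    apply: eq_Rintegral => x _; rewrite fa mulr_sumr; apply: eq_bigr => i _; exact: mulrCA.
  have iuc (h : 'I_n) : leb.-integrable D (EFin \o (fun x => u x * cosn h x)).
    by apply: (iuM (M := 1)); [exact: measurable_cosn|move=> x _; exact: cosn_le1].
  rewrite Rintegral_sum// => [|i]; last exact: intg_scale.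
  by apply: eq_bigr => i _; rewrite RintegralZl.
have -> : \int[leb]_(x in D) (f x * f x) = \sum_(h < n) a h ^+ 2 * cosn_weight h.
  have icc (h k : 'I_n) : leb.-integrable D (EFin \o (fun x => cosn h x * cosn k x)).
    apply: (@intg_bounded _ _ _ leb D mD _ 1 circle_lty).
      by apply: measurable_funM; exact: measurable_cosn.
    by move=> x _; rewrite normrM mulr_ile1// cosn_le1.
  transitivity (\int[leb]_(x in D) (\sum_(h < n) \sum_(k < n) (a h * a k) * (cosn h x * cosn k x))).
    apply: eq_Rintegral => x _; rewrite !fa mulr_suml; apply: eq_bigr => i _.
    by rewrite mulr_sumr; apply: eq_bigr => j _; ring.
  rewrite Rintegral_sum// => [|i]; last first.
    by apply: intg_sum => // j; exact: intg_scale.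
  apply: eq_bigr => i _; rewrite Rintegral_sum// => [|j]; last exact: intg_scale.
  rewrite (bigD1 i)//= big1 ?addr0 => [|j ij].
    by rewrite RintegralZl// Rintegral_cosnM eqxx expr2.
  rewrite RintegralZl// Rintegral_cosnM ifF ?mulr0//.
  by apply/negbTE; rewrite eq_sym.
rewrite mulr_sumr -sumrB; apply: ler_sum => i _.
have w0 := cosn_weight_gt0 i; set w := cosn_weight i in w0 *.
rewrite -subr_ge0 (_ : _ - _ = (c i - a i * w) ^+ 2 / w); last by field; rewrite gt_eqF.
by rewrite divr_ge0 ?sqr_ge0// ltW.
Qed.

Let Q_bpc f : bpc D V f -> measurable_fun D f /\ Qb f.
Proof.
elim=> {f} [f Vf|v f M bv hv vM vf].
  split; last exact: Q_trig.
  by apply: measurable_funTS; apply: continuous_measurable_fun; exact: V_cont.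
have mv n : measurable_fun D (v n) by case: (hv n).
split; first exact: measurable_fun_cvg mv vf.
have [_ h1] : leb.-integrable D (EFin \o (fun x => u x * f x)) /\
   \int[leb]_(x in D) (u x * v n x) @[n --> \oo] --> \int[leb]_(x in D) (u x * f x).
  apply: (@Rdominated _ _ _ leb D mD (fun n x => u x * v n x) _ (fun x => M * `|u x|)).
  - by move=> n; exact: (measurable_funM mu_ (mv n)).
  - by move=> x Dx; apply: cvgM; [exact: cvg_cst|exact: vf].
  - by move=> n x Dx; rewrite normrM mulrC ler_wpM2r ?vM.
  - by apply: intg_scale => //; exact: intg_norm.
have [_ h2] : leb.-integrable D (EFin \o (fun x => f x * f x)) /\
   \int[leb]_(x in D) (v n x * v n x) @[n --> \oo] --> \int[leb]_(x in D) (f x * f x).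
  apply: (@Rdominated _ _ _ leb D mD (fun n x => v n x * v n x) _ (fun x => M * M)).
  - by move=> n; exact: (measurable_funM (mv n) (mv n)).
  - by move=> x Dx; apply: cvgM; exact: vf.
  - by move=> n x Dx; rewrite normrM ler_pM ?vM.
  - apply: (@intg_bounded _ _ _ leb D mD _ `|M * M| circle_lty) => //.
have h3 : 2 * \int[leb]_(x in D) (u x * v n x) - \int[leb]_(x in D) (v n x * v n x) @[n --> \oo] -->
    2 * \int[leb]_(x in D) (u x * f x) - \int[leb]_(x in D) (f x * f x).
  by apply: cvgB h2; apply: cvgM h1; exact: cvg_cst.
rewrite /Qb -(cvg_lim (@Rhausdorff R) h3); apply: limr_le.
  by apply/cvg_ex; eexists; exact: h3.
by apply: nearW => n; case: (hv n).
Qed.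

Let clip (M y : R) := Num.max (Num.min y M) (- M).

Let clip_props (M y : R) : 0 <= M -> [/\ `|clip M y| <= M, clip M y ^+ 2 <= y * clip M y &
  `|y| <= M -> clip M y = y].
Proof.
move=> M0; rewrite /clip; case: (leP y M) => yM; [case: (leP y (- M)) => h|case: (leP M (- M)) => h].
- split; [by rewrite normrN ger0_norm|by nra|by rewrite ler_norml => /andP[? _]; lra].
- by split=> //; rewrite ler_norml yM andbT ltW.
- have -> : M = 0 by lra.
  by split; rewrite ?oppr0 ?normr0 ?expr0n ?mulr0//= normr_le0 => /eqP.
- split; [by rewrite ger0_norm|by nra|by rewrite ler_norml => /andP[_ ?]; lra].
Qed.

Let mclip (M : R) : measurable_fun D (fun x => clip M (u x)).
Proof.
apply: measurable_maxr; last exact: measurable_cst.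
by apply: measurable_minr => //; exact: measurable_cst.
Qed.

Let Rintegral_clip_sqr (M : R) : 0 <= M ->
  \int[leb]_(x in D) (clip M (u x) ^+ 2) <= B.
Proof.
move=> M0.
have mpsi : measurable_fun setT (fun y => clip M ((u \_ D) y)).
  apply: measurable_maxr; last exact: measurable_cst.
  apply: measurable_minr; last exact: measurable_cst.
  exact: (proj1 (measurable_restrictT u mD)).
have psiM y : `|clip M ((u \_ D) y)| <= M by case: (clip_props ((u \_ D) y) M0).
have [_] := Q_bpc (bpc_abs mpsi psiM).
rewrite /Qb.
have uabs x : D x -> (u \_ D) `|x| = u x.
  move=> Dx; rewrite patchE mem_set; last first.
    by apply/circleP; rewrite normr_id; exact/circleP.
  by case: (ler0P x) => _ //; exact: u_even.
have -> : \int[leb]_(x in D) (u x * clip M ((u \_ D) `|x|)) = \int[leb]_(x in D) (u x * clip M (u x)).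
  by apply: eq_Rintegral => x /set_mem Dx; rewrite uabs.
have -> : \int[leb]_(x in D) (clip M ((u \_ D) `|x|) * clip M ((u \_ D) `|x|)) =
    \int[leb]_(x in D) (clip M (u x) ^+ 2).
  by apply: eq_Rintegral => x /set_mem Dx; rewrite uabs// expr2.
have clipM x : D x -> `|clip M (u x)| <= M by move=> _; case: (clip_props (u x) M0).
have i1 := iuM (mclip M) clipM.
have i2 : leb.-integrable D (EFin \o (fun x => clip M (u x) ^+ 2)).
  by have := iM (mclip M) clipM; under eq_fun do rewrite -expr2.
have : \int[leb]_(x in D) (clip M (u x) ^+ 2) <= \int[leb]_(x in D) (u x * clip M (u x)).
  by apply: le_Rintegral => // x _; case: (clip_props (u x) M0).
lra.
Qed.

Let sqre_poweR (x : \bar R) : (0 <= x -> x ^+ 2 = x `^ 2)%E.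
Proof.
case: x => [r| |]// r0; last by rewrite expe2 mulyy poweRyr.
by rewrite poweR_EFin powR_mulrn// -EFin_expe.
Qed.

(* Parseval's inequality for integrable functions that are not known a priori to be
   square integrable. *)
Theorem L2norm_sqr_le : (L2norm u ^+ 2 <= B%:E)%E.
Proof.
have -> : (L2norm u ^+ 2 = \int[leb]_(x in D) (u x ^+ 2)%:E)%E.
  rewrite /L2norm sqre_poweR; last exact: Lnorm_ge0.
  rewrite powR_Lnorm//.
  rewrite [RHS]integral_mkcond; apply: eq_integral => x _.
  rewrite /= !patchE; case: ifPn => _ /=.
    by rewrite ?poweR_EFin powR_mulrn// -normrX ger0_norm ?sqr_ge0.
  by rewrite normr0 powR0.
pose g n x := ((clip n%:R (u x)) ^+ 2)%:E.
have gmono x : D x -> nondecreasing_seq (g ^~ x).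
  move=> Dx n m nm; rewrite lee_fin /clip.
  have nmR : n%:R <= m%:R :> R by rewrite ler_nat.
  have n0 : 0 <= n%:R :> R by [].
  have cE (M : R) : 0 <= M -> clip M (u x) = if u x <= - M then - M else if u x <= M then u x else M.
    move=> M0; rewrite /clip.
    case: (leP (u x) M) => h1; case: (leP (u x) (- M)) => h2 //.
      by exfalso; lra.
    by rewrite max_l//; lra.
  have m0 : 0 <= m%:R :> R by [].
  rewrite -/(clip n%:R (u x)) -/(clip m%:R (u x)) !cE//.
  by case: (leP (u x) (- n%:R)) => h1; case: (leP (u x) n%:R) => h2;
    case: (leP (u x) (- m%:R)) => h3; case: (leP (u x) m%:R) => h4; nra.
have glim x : D x -> g n x @[n --> \oo] --> (u x ^+ 2)%:E.
  move=> Dx; apply: cvg_near_cst.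
  have [k /ltW hk] : exists k : nat, `|u x| < k%:R.
    by exists (Num.trunc `|u x|).+1; rewrite truncnS_gt.
  exists k => // n /= kn; rewrite /g.
  have n0 : 0 <= n%:R :> R by [].
  by have [_ _ ->//] := clip_props (u x) n0; rewrite (le_trans hk)// ler_nat.
have mg n : measurable_fun D (g n).
  by apply/measurable_EFinP; apply: measurable_funX; exact: mclip.
have g0 n x : D x -> (0 <= g n x)%E by move=> _; rewrite lee_fin sqr_ge0.
have h : (\int[leb]_(x in D) g n x)%E @[n --> \oo] -->
    (\int[leb]_(x in D) (fun x => limn (g ^~ x)) x)%E.
  exact: cvg_monotone_convergence.
have -> : (\int[leb]_(x in D) (u x ^+ 2)%:E = \int[leb]_(x in D) (fun x => limn (g ^~ x)) x)%E.
  by apply: eq_integral => x /set_mem Dx; apply/esym/cvg_lim => //; exact: glim.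
rewrite -(cvg_lim (@ereal_hausdorff R) h).
apply: lime_le.
  apply: ereal_nondecreasing_is_cvgn => n m nm; apply: ge0_le_integral => //.
  - by move=> x _; rewrite lee_fin sqr_ge0.
  - exact: mg.
  - exact: mg.
  - by move=> x Dx; exact: (@gmono x Dx n m nm).
apply: nearW => n.
have n0 : 0 <= n%:R :> R by [].
have := Rintegral_clip_sqr n0; rewrite -lee_fin; apply: le_trans.
rewrite /Rintegral fineK//.
have clipM x : D x -> `|clip n%:R (u x)| <= n%:R by move=> _; case: (clip_props (u x) n0).
have i2 : leb.-integrable D (EFin \o (fun x => clip n%:R (u x) ^+ 2)).
  by have := iM (mclip n%:R) clipM; under eq_fun do rewrite -expr2.
exact: integrable_fin_num.
Qed.

End cosine_series.

(** * Laplace noise *)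

Section indicator_induction.
Context {R : realType}.
Implicit Types f g : R -> R.

Let B : set (R -> R) := [set f | exists2 A : set R, measurable A & f = \1_A].
Let V := lspan B.

Let V_bm f : V f -> bm f.
Proof.
elim=> {f} [f [A mA ->]|f g _ bf _ bg|c f _ bf]; first exact: bm_indic.
  exact: bm_add.
exact: bm_scale.
Qed.

Let V_mul f g : V f -> V g -> V (fun x => f x * g x).
Proof.
apply: lspan_mul => {}f {}g [A mA ->] [A' mA' ->].
apply: lspan_base; exists (A `&` A'); first exact: measurableI.
by apply/funext => x; rewrite indicI.
Qed.

Let V_one : V (fun=> 1).
Proof.
by apply: lspan_base; exists setT => //; apply/funext => x; rewrite indicT.
Qed.

Lemma bm_generating_indic : bm_generating [set f | exists2 A : set R, measurable A & f = \1_A].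
Proof.
move=> Q Qind Qadd Qscale Qlim.
have VQ f : V f -> Q f.
  elim=> {f} [f Bf|f g Vf Qf Vg Qg|c f Vf Qf]; first exact: Qind.
    by apply: Qadd => //; exact: V_bm.
  by apply: Qscale => //; exact: V_bm.
have bQ f : bpc setT V f -> bm f /\ Q f.
  elim=> {f} [f Vf|u f M bu h uM uf]; first by split; [exact: V_bm|exact: VQ].
  have uM' n x : `|u n x| <= M by exact: uM.
  have uf' x : u n x @[n --> \oo] --> f x by exact: uf.
  split; first by apply: (bm_lim _ uM' uf') => n; case: (h n).
  by apply: (Qlim u f M) => // n; case: (h n).
have V_bounded f : V f -> exists M : R, forall x, [set: R] x -> `|f x| <= M.
  by move=> /V_bm[_ [M fM]]; exists M => x _.
have V_add f g : V f -> V g -> V (fun x => f x + g x) by exact: lspan_add.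
have V_scale c f : V f -> V (fun x => c * f x) by exact: lspan_scale.
move=> f [mf [M fM]].
suff /bQ[] : bpc setT V f by [].
have := @bpc_borel R R setT V V_add V_scale V_mul V_one V_bounded id f M.
apply => // t; apply: bpc_base.
have -> : (fun x : R => Num.sg (id x - t)) = fun x => \1_`]t, +oo[ x + -1 * \1_`]-oo, t[ x.
  apply/funext => x; rewrite !indicE !mem_setE !in_itv/= andbT.
  case: (ltgtP x t) => [xt|xt|->].
  - by rewrite ltr0_sg ?subr_lt0//=; lra.
  - by rewrite gtr0_sg ?subr_gt0//=; lra.
  - by rewrite subrr sgr0/=; lra.
apply: lspan_add; last apply: lspan_scale; apply: lspan_base.
- by exists `]t, +oo[%classic.
- by exists `]-oo, t[%classic.
Qed.

End indicator_induction.

Section independent_products.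
Context {R : realType} {d : measure_display} {T : measurableType d}.
Variable P : probability T R.

Lemma Ex_indic_ext (Y A A' : T -> R) (c : R) : measurable_fun setT Y -> bm A -> bm A' ->
  (forall E, measurable E ->
    \int[P]_w (\1_E (Y w) * A w) = c * \int[P]_w (\1_E (Y w) * A' w)) ->
  forall f, bm f -> \int[P]_w (f (Y w) * A w) = c * \int[P]_w (f (Y w) * A' w).
Proof.
move=> mY bA bA' h; apply: (Ex_bm_ext bm_generating_indic) => // _ [E mE ->].
exact: h.
Qed.

Lemma Ex_indic (A : set T) : measurable A -> \int[P]_w \1_A w = fine (P A).
Proof. by move=> mA; rewrite /Rintegral integral_indic// setIT. Qed.

Lemma bm_prod (I : Type) (s : seq I) (F : I -> T -> R) : (forall i, bm (F i)) ->
  bm (fun w => \prod_(i <- s) F i w).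
Proof.
move=> bF; elim: s => [|i s ih].
  by under eq_fun do rewrite big_nil; exact: bm_cst.
by under eq_fun do rewrite big_cons; exact: bm_mul.
Qed.

(* [Y] is independent of the family [V]; stated with indicators only. *)
Lemma Ex_prod_bm (I : eqType) (V : I -> T -> R) (s : seq I) (Y : T -> R) :
  (forall k, measurable_fun setT (V k)) -> bm Y -> uniq s ->
  (forall E : I -> set R, (forall k, measurable (E k)) ->
    \int[P]_w (Y w * \prod_(k <- s) \1_(E k) (V k w)) =
    \int[P]_w Y w * \prod_(k <- s) \int[P]_w \1_(E k) (V k w)) ->
  forall phi : I -> R -> R, (forall k, bm (phi k)) ->
    \int[P]_w (Y w * \prod_(k <- s) phi k (V k w)) =
    \int[P]_w Y w * \prod_(k <- s) \int[P]_w phi k (V k w).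
Proof.
move=> mV bY us hY phi bphi; elim: s Y bY us hY => [|k s ih] Y bY us hY.
  by rewrite big_nil mulr1; apply: eq_Rintegral => w _; rewrite big_nil mulr1.
move: us => /= /andP[ks us].
have bI E : measurable E -> bm (fun w => \1_E (V k w) : R).
  by move=> mE; exact: bm_comp (bm_indic mE) (mV k).
have b1T w i : \1_(setT : set R) (V i w) = 1 :> R by rewrite indicT.
have stepT (i : I) : \int[P]_w (\1_(setT : set R) (V i w) : R) = 1.
  by under eq_Rintegral do rewrite b1T; exact: Ex_cst.
have hk E (F : I -> set R) : measurable E -> (forall i, measurable (F i)) ->
    \int[P]_w (Y w * \1_E (V k w) * \prod_(i <- s) \1_(F i) (V i w)) =
    \int[P]_w Y w * \int[P]_w \1_E (V k w) * \prod_(i <- s) \int[P]_w \1_(F i) (V i w).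
  move=> mE mF; pose G i := if i == k then E else F i.
  have mG i : measurable (G i) by rewrite /G; case: ifP.
  have Gs i : i \in s -> G i = F i.
    by move=> si; rewrite /G; case: eqP => // ik; rewrite ik (negbTE ks) in si.
  have := hY G mG; rewrite big_cons {2}/G eqxx mulrA.
  rewrite (eq_big_seq (fun i => \int[P]_w \1_(F i) (V i w))); last by move=> i /Gs ->.
  move=> <-; apply: eq_Rintegral => w _; rewrite big_cons {1}/G eqxx mulrA.
  by congr (_ * _); apply: eq_big_seq => i /Gs ->.
have hkE E : measurable E -> \int[P]_w (Y w * \1_E (V k w)) =
    \int[P]_w Y w * \int[P]_w \1_E (V k w).
  move=> mE; have := hk E (fun=> setT) mE (fun=> measurableT).
  rewrite [X in _ = _ * X]big1 ?mulr1 => [<-|i _]; last exact: stepT.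
  by apply: eq_Rintegral => w _; rewrite big1 ?mulr1.
have ih' E : measurable E ->
    \int[P]_w (Y w * \1_E (V k w) * \prod_(i <- s) phi i (V i w)) =
    \int[P]_w (Y w * \1_E (V k w)) * \prod_(i <- s) \int[P]_w phi i (V i w).
  move=> mE; apply: ih => //; first by apply: bm_mul => //; exact: bI.
  by move=> F mF; rewrite hk// hkE.
rewrite big_cons.
have b1 : bm (fun _ : T => 1 : R) by exact: (bm_cst (1 : R)).
have h : \int[P]_w (phi k (V k w) * (Y w * \prod_(i <- s) phi i (V i w))) =
    (\int[P]_w Y w * \prod_(i <- s) \int[P]_w phi i (V i w)) * \int[P]_w (phi k (V k w) * 1).
  apply: (Ex_indic_ext (A' := fun=> 1)) => //.
  - apply: bm_mul => //; apply: bm_prod => i; exact: bm_comp (mV i).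
  - move=> E mE.
    transitivity (\int[P]_w (Y w * \1_E (V k w) * \prod_(i <- s) phi i (V i w))).
      by apply: eq_Rintegral => w _; ring.
    rewrite ih'// hkE//.
    under [X in _ = _ * X]eq_Rintegral do rewrite mulr1.
    by ring.
transitivity (\int[P]_w (phi k (V k w) * (Y w * \prod_(i <- s) phi i (V i w)))).
  by apply: eq_Rintegral => w _; rewrite big_cons; ring.
rewrite h; under [X in _ * X = _]eq_Rintegral do rewrite mulr1.
by ring.
Qed.

(* Truncation removes the boundedness assumption. *)
Lemma Ex_prod (I : eqType) (V : I -> T -> R) (s : seq I) (Y G : T -> R) :
  (forall k, measurable_fun setT (V k)) -> bm Y -> uniq s ->
  (forall E : I -> set R, (forall k, measurable (E k)) ->
    \int[P]_w (Y w * \prod_(k <- s) \1_(E k) (V k w)) =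
    \int[P]_w Y w * \prod_(k <- s) \int[P]_w \1_(E k) (V k w)) ->
  forall phi : I -> R -> R, (forall k, measurable_fun setT (phi k)) ->
    (forall k, k \in s -> P.-integrable setT (EFin \o (fun w => phi k (V k w)))) ->
    P.-integrable setT (EFin \o G) ->
    (forall w, `|Y w * \prod_(k <- s) phi k (V k w)| <= G w) ->
    \int[P]_w (Y w * \prod_(k <- s) phi k (V k w)) =
    \int[P]_w Y w * \prod_(k <- s) \int[P]_w phi k (V k w).
Proof.
move=> mV bY us hY phi mphi iphi iG GY.
pose tr n k (x : R) := if `|phi k x| <= n%:R then phi k x else 0.
have mtr n k : measurable_fun setT (tr n k).
  apply: measurable_fun_ifT => //.
  by apply: measurable_fun_ler; [exact: measurableT_comp|exact: measurable_cst].
have btr n k : bm (tr n k).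
  split=> //; exists n%:R => x; rewrite /tr; case: ifP => //.
  by rewrite normr0.
have tr_le n k x : `|tr n k x| <= `|phi k x|.
  by rewrite /tr; case: ifP => //; rewrite normr0.
have tr_cvg k x : tr n k x @[n --> \oo] --> phi k x.
  apply: cvg_near_cst.
  have [m /ltW hm] : exists m : nat, `|phi k x| < m%:R.
    by exists (Num.trunc `|phi k x|).+1; rewrite truncnS_gt.
  by exists m => // n /= mn; rewrite /tr ifT// (le_trans hm)// ler_nat.
have prod_cvg (F : nat -> I -> R) (l : I -> R) r : (forall k, k \in r -> F n k @[n --> \oo] --> l k) ->
    \prod_(k <- r) F n k @[n --> \oo] --> \prod_(k <- r) l k.
  elim: r => [|k r ih] Fl.
    by under eq_fun do rewrite big_nil; rewrite big_nil; exact: cvg_cst.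
  under eq_fun do rewrite big_cons; rewrite big_cons; apply: cvgM.
    by apply: Fl; rewrite mem_head.
  by apply: ih => j jr; apply: Fl; rewrite in_cons jr orbT.
have mYp (p : I -> R -> R) : (forall k, measurable_fun setT (p k)) ->
    measurable_fun setT (fun w => Y w * \prod_(k <- s) p k (V k w)).
  move=> mp; apply: measurable_funM; first by case: bY.
  by apply: measurable_prod => k _; exact: measurableT_comp.
have [_ e1] : P.-integrable setT (EFin \o (fun w => Y w * \prod_(k <- s) phi k (V k w))) /\
   \int[P]_w (Y w * \prod_(k <- s) tr n k (V k w)) @[n --> \oo] -->
   \int[P]_w (Y w * \prod_(k <- s) phi k (V k w)).
  apply: (@Rdominated _ _ _ P setT measurableT
    (fun n w => Y w * \prod_(k <- s) tr n k (V k w)) _ G) => //.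
  - by move=> n; exact: mYp.
  - move=> w _; apply: cvgM; first exact: cvg_cst.
    by apply: prod_cvg => k _; exact: tr_cvg.
  - move=> n w _; apply: le_trans (GY w).
    rewrite !normrM ler_wpM2l// !normr_prod; apply: ler_prod => k _.
    by rewrite normr_ge0/=; exact: tr_le.
have e2 : \int[P]_w (Y w * \prod_(k <- s) tr n k (V k w)) @[n --> \oo] -->
    \int[P]_w Y w * \prod_(k <- s) \int[P]_w phi k (V k w).
  have := fun n => Ex_prod_bm mV bY us hY (btr n) => h.
  under eq_fun do rewrite h.
  apply: cvgM; first exact: cvg_cst.
  apply: prod_cvg => k ks.
  have [] // := @Rdominated _ _ _ P setT measurableT (fun n w => tr n k (V k w))
    (fun w => phi k (V k w)) (fun w => `|phi k (V k w)|).
  - by move=> n; exact: measurableT_comp.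
  - by apply: intg_norm => //; exact: iphi.
by rewrite -(cvg_lim (@Rhausdorff R) e1) (cvg_lim (@Rhausdorff R) e2).
Qed.

End independent_products.

Section noise.
Context {R : realType} {d : measure_display} {T : measurableType d}.
Variables (P : probability T R) (N : nat) (X : int -> {RV P >-> R}).
Variable W : nat * nat -> {RV P >-> R}.
Hypothesis XW : laplace_noise N X W.
Local Notation D := (noise_index N).
Implicit Types (f : R -> R) (i j : int) (a b c k : nat * nat).

Let mX i : measurable_fun setT (X i : T -> R). Proof. exact: measurable_funPT. Qed.
Let mW k : measurable_fun setT (W k : T -> R). Proof. exact: measurable_funPT. Qed.

Let lapW k : D k -> standard_laplace (W k).
Proof. by case: XW => + _ _; apply. Qed.

Let preim_measurable (Y : T -> R) (E : set R) : measurable_fun setT Y -> measurable E ->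
  measurable (Y @^-1` E).
Proof. by move=> mY mE; rewrite -[_ @^-1` _]setTI; exact: mY. Qed.

Let prod_indic (s : seq (nat * nat)) (E : nat * nat -> set R) w :
  \prod_(k <- s) \1_(E k) (W k w) =
  \1_(\bigcap_(k in [set` [fset k in s]%fset]) ((W k : T -> R) @^-1` E k)) w :> R.
Proof.
rewrite [RHS]indicE; case: (boolP (w \in _)) => [/set_mem h|h].
  rewrite big_seq big1// => k ks; rewrite indicE mem_set//.
  by apply: h => /=; rewrite inE.
have [k ks Ek] : exists2 k, k \in s & ~ E k (W k w).
  apply: contrapT => h'; move/negP: h; apply; apply: mem_set => k /=.
  rewrite inE => ks; apply: contrapT => h2; apply: h'; by exists k.
by apply/eqP; rewrite prodf_seq_eq0; apply/hasP; exists k => //=; rewrite indicE memNset.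
Qed.

Let sigmaW (s : seq (nat * nat)) (E : nat * nat -> set R) : {subset s <= [pred k | `[< D k >]]} ->
  (forall k, measurable (E k)) ->
  generated_sigma_algebra D W (\bigcap_(k in [set` [fset k in s]%fset]) ((W k : T -> R) @^-1` E k)).
Proof.
move=> sD mE; rewrite /generated_sigma_algebra.
set G := [set _ | _].
apply: (@fin_bigcap_measurable _ (g_sigma_algebraType G)) => // k /=.
rewrite inE => /sD/asboolP Dk; apply: sub_sigma_algebra; exists k => //.
by exists (E k).
Qed.

Let indepW (s : seq (nat * nat)) (E : nat * nat -> set R) : uniq s ->
  {subset s <= [pred k | `[< D k >]]} -> (forall k, measurable (E k)) ->
  P (\bigcap_(k in [set` [fset k in s]%fset]) ((W k : T -> R) @^-1` E k)) =
  (\prod_(k <- s) \int[P]_w \1_(E k) (W k w))%:E.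
Proof.
move=> us sD mE; case: XW => _ h _.
rewrite h//; last by move=> k /=; rewrite inE => /sD/asboolP.
have -> : (\prod_(k <- [fset k in s]%fset) P ((W k : T -> R) @^-1` E k) =
   \prod_(k <- s) P ((W k : T -> R) @^-1` E k))%E.
  by apply: perm_big; apply: uniq_perm => // k; rewrite inE.
elim: s {us sD} => [|k s ih]; first by rewrite !big_nil.
rewrite !big_cons ih EFinM; congr (_ * _)%E.
have mWE : measurable ((W k : T -> R) @^-1` E k) by exact: preim_measurable.
rewrite -[LHS]fineK ?fin_num_measure//; congr (_%:E).
rewrite -(Ex_indic P mWE).
by apply: eq_Rintegral => w _; rewrite !indicE.
Qed.

Lemma noise_indep (s : seq (nat * nat)) (E : nat * nat -> set R) f1 f2 i j : uniq s ->
  {subset s <= [pred k | `[< D k >]]} -> bm f1 -> bm f2 -> (forall k, measurable (E k)) ->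
  \int[P]_w (f1 (X i w) * f2 (X j w) * \prod_(k <- s) \1_(E k) (W k w)) =
  \int[P]_w (f1 (X i w) * f2 (X j w)) * \prod_(k <- s) \int[P]_w \1_(E k) (W k w).
Proof.
move=> us sD bf1 bf2 mE.
set F := \bigcap_(k in [set` [fset k in s]%fset]) ((W k : T -> R) @^-1` E k).
have mF : measurable F by apply: fin_bigcap_measurable => // k _; exact: preim_measurable.
set c := \prod_(k <- s) _.
have PF : P F = c%:E by exact: indepW.
have bF : bm (fun w => \1_F w : R) by exact: bm_indic.
have base A1 A2 : measurable A1 -> measurable A2 ->
    \int[P]_w (\1_A1 (X i w) * (\1_A2 (X j w) * \1_F w)) =
    c * \int[P]_w (\1_A1 (X i w) * \1_A2 (X j w)).
  move=> mA1 mA2; pose E1 := ((X i : T -> R) @^-1` A1) `&` ((X j : T -> R) @^-1` A2).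
  have m1 : measurable ((X i : T -> R) @^-1` A1) by exact: preim_measurable.
  have m2 : measurable ((X j : T -> R) @^-1` A2) by exact: preim_measurable.
  have mE1 : measurable E1 by exact: measurableI.
  have sE1 : generated_sigma_algebra [set: int] X E1.
    rewrite /generated_sigma_algebra; set G := [set _ | _].
    apply: (@measurableI _ (g_sigma_algebraType G)); apply: sub_sigma_algebra.
    - by exists i => //; exists A1.
    - by exists j => //; exists A2.
  transitivity (\int[P]_w \1_(E1 `&` F) w).
    by apply: eq_Rintegral => w _; rewrite !indicI !indicE/=; ring.
  transitivity (c * \int[P]_w \1_E1 w); last first.
    by congr (_ * _); apply: eq_Rintegral => w _; rewrite indicI !indicE.
  rewrite !Ex_indic//; last exact: measurableI.
  case: XW => _ _ /(_ E1 F sE1 (sigmaW sD mE)) ->.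
  rewrite PF -[P E1]fineK ?fin_num_measure// -EFinM/=; exact: mulrC.
have bind1 A1 (l : int) : measurable A1 -> bm (fun w => \1_A1 (X l w) : R).
  by move=> mA1; exact: bm_comp (bm_indic mA1) (mX l).
have bf1X : bm (fun w => f1 (X i w)) by exact: bm_comp bf1 (mX i).
have step1 A2 : measurable A2 ->
    \int[P]_w (f1 (X i w) * (\1_A2 (X j w) * \1_F w)) =
    c * \int[P]_w (f1 (X i w) * \1_A2 (X j w)).
  move=> mA2; apply: (Ex_indic_ext (A' := fun w => \1_A2 (X j w))) => //.
  - by apply: bm_mul => //; exact: bind1.
  - exact: bind1.
  - by move=> A1 mA1; exact: base.
transitivity (\int[P]_w (f2 (X j w) * (f1 (X i w) * \1_F w))).
  by apply: eq_Rintegral => w _; rewrite prod_indic -/F; ring.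
rewrite mulrC.
transitivity (c * \int[P]_w (f2 (X j w) * f1 (X i w))); last first.
  by congr (_ * _); apply: eq_Rintegral => w _; exact: mulrC.
apply: Ex_indic_ext => //; first exact: bm_mul.
move=> A2 mA2.
transitivity (\int[P]_w (f1 (X i w) * (\1_A2 (X j w) * \1_F w))).
  by apply: eq_Rintegral => w _; ring.
rewrite step1//; congr (_ * _).
by apply: eq_Rintegral => w _; exact: mulrC.
Qed.

Let intg_poly f (C : R) k : D k -> measurable_fun setT f ->
  (forall x, `|f x| <= C * (1 + x ^+ 4)) ->
  P.-integrable setT (EFin \o (fun w => f (W k w))).
Proof. by move=> Dk; exact: intg_laplace (lapW Dk) _ _. Qed.

Let pow4 (x : R) : [/\ 0 <= x ^+ 4, `|x| <= 1 + x ^+ 4 & x ^+ 2 <= 1 + x ^+ 4].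
Proof.
have x20 : 0 <= x ^+ 2 by exact: sqr_ge0.
have e : x ^+ 4 = (x ^+ 2) ^+ 2 by rewrite -exprM.
have a0 := normr_ge0 x.
have ea : x ^+ 2 = `|x| ^+ 2 by rewrite -normrX ger0_norm.
split; first by rewrite e sqr_ge0.
- by rewrite e ea; move: a0; set y := `|x| => y0; have := sqr_ge0 (y ^+ 2 - 1/2); have := sqr_ge0 (y - 1/2); nra.
- by rewrite e; have := sqr_ge0 (x ^+ 2 - 1); nra.
Qed.

Let intgW4 k : D k -> P.-integrable setT (EFin \o (fun w => W k w ^+ 4)).
Proof.
move=> Dk; apply: (@intg_poly (fun x => x ^+ 4) 1) => // x.
by rewrite mul1r ger0_norm; case: (pow4 x) => // *; rewrite lerDr.
Qed.

Let intgW1 k : D k -> P.-integrable setT (EFin \o (fun w => W k w)).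
Proof.
move=> Dk; apply: (@intg_poly (fun x => x) 1) => // x.
by rewrite mul1r; case: (pow4 x).
Qed.

Let intgW2 k : D k -> P.-integrable setT (EFin \o (fun w => W k w ^+ 2)).
Proof.
move=> Dk; apply: (@intg_poly (fun x => x ^+ 2) 1) => // x.
by rewrite mul1r ger0_norm ?sqr_ge0//; case: (pow4 x).
Qed.

Let dom4 k1 k2 k3 k4 : D k1 -> D k2 -> D k3 -> D k4 -> P.-integrable setT (EFin \o
  (fun w => W k1 w ^+ 4 + W k2 w ^+ 4 + W k3 w ^+ 4 + W k4 w ^+ 4)).
Proof.
move=> *; apply: intg_add => //; last exact: intgW4.
apply: intg_add => //; last exact: intgW4.
by apply: intg_add => //; exact: intgW4.
Qed.

Let amgm4 (x y z t : R) : `|x * y * z * t| <= x ^+ 4 + y ^+ 4 + z ^+ 4 + t ^+ 4.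
Proof.
have e u : u ^+ 4 = (`|u| ^+ 2) ^+ 2 :> R.
  by rewrite -exprM -normrX ger0_norm//; case: (pow4 u).
rewrite !normrM !e; have := normr_ge0 x; have := normr_ge0 y; have := normr_ge0 z; have := normr_ge0 t.
set a := `|x|; set b := `|y|; set c := `|z|; set f := `|t| => f0 c0 b0 a0.
have h1 : a * b <= a ^+ 2 + b ^+ 2 by have := sqr_ge0 (a - b); nra.
have h2 : c * f <= c ^+ 2 + f ^+ 2 by have := sqr_ge0 (c - f); nra.
have h3 : 2 * (a * b) <= a ^+ 2 + b ^+ 2 by have := sqr_ge0 (a - b); nra.
have h4 : 2 * (c * f) <= c ^+ 2 + f ^+ 2 by have := sqr_ge0 (c - f); nra.
have h5 : (a * b) ^+ 2 * 2 <= (a ^+ 2) ^+ 2 + (b ^+ 2) ^+ 2.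
  by have := sqr_ge0 (a ^+ 2 - b ^+ 2); rewrite exprMn; nra.
have h6 : (c * f) ^+ 2 * 2 <= (c ^+ 2) ^+ 2 + (f ^+ 2) ^+ 2.
  by have := sqr_ge0 (c ^+ 2 - f ^+ 2); rewrite exprMn; nra.
rewrite -mulrA; move: (a * b) (c * f) h5 h6 => p q h5 h6.
have := sqr_ge0 (p - q); have := sqr_ge0 p; have := sqr_ge0 q.
by move: ((a ^+ 2) ^+ 2) ((b ^+ 2) ^+ 2) ((c ^+ 2) ^+ 2) ((f ^+ 2) ^+ 2) h5 h6 => A B C F h5 h6; nra.
Qed.

Lemma noise_mean0 k : D k -> \int[P]_w W k w = 0.
Proof. by move=> /lapW; exact: Rintegral_laplace1. Qed.

Lemma noise_moment4 k : D k -> \int[P]_w (W k w ^+ 4) = laplace_moment4.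
Proof. by move=> /lapW; exact: Rintegral_laplace4. Qed.

Lemma noise_moment2 k : D k -> \int[P]_w (W k w ^+ 2) <= 1 + laplace_moment4.
Proof.
move=> Dk; rewrite -(noise_moment4 Dk) -[X in X + _](Ex_cst P 1) -RintegralD//; last 2 first.
- exact/intg_bm/bm_cst.
- exact: intgW4.
apply: le_Rintegral => //; first exact: intgW2.
- by apply: intg_add => //; [exact/intg_bm/bm_cst|exact: intgW4].
- by move=> w _; case: (pow4 (W k w)).
Qed.

Lemma noise_orth4 a b c e : D a -> D b -> D c -> D e -> a != b -> a != c -> a != e ->
  b != e -> c != e -> \int[P]_w (W a w * W b w * W c w * W e w) = 0.
Proof.
move=> Da Db Dc De ab ac ae be ce.
have b1 : bm (fun _ : R => 1 : R) by exact: (bm_cst (1 : R)).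
have b1T : bm (fun _ : T => 1 * 1 : R) by exact: (bm_cst (1 * 1 : R)).
have dom := dom4 Da Db Dc De.
have key (s : seq (nat * nat)) (phi : nat * nat -> R -> R) : uniq s ->
    {subset s <= [pred k | `[< D k >]]} -> (forall k, measurable_fun setT (phi k)) ->
    (forall k, k \in s -> P.-integrable setT (EFin \o (fun w => phi k (W k w)))) ->
    a \in s -> phi a = id ->
    (forall w, \prod_(k <- s) phi k (W k w) = W a w * W b w * W c w * W e w) ->
    \int[P]_w (W a w * W b w * W c w * W e w) = 0.
  move=> us sD mphi iphi as_ pa pE.
  transitivity (\int[P]_w (1 * 1 * \prod_(k <- s) phi k (W k w))).
    by apply: eq_Rintegral => w _; rewrite pE !mul1r.
  rewrite (@Ex_prod _ _ _ P _ (fun k => W k : T -> R) s _ _ mW b1T us _ phi mphi iphi dom); last first.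
  - by move=> w; rewrite pE !mul1r; exact: amgm4.
  - by move=> E mE; exact: (@noise_indep s E (fun=> 1) (fun=> 1) 0 0).
  apply/eqP; rewrite mulf_eq0; apply/orP; right.
  by rewrite prodf_seq_eq0; apply/hasP; exists a => //=; rewrite pa; apply/eqP; exact: noise_mean0.
have inD k : D k -> k \in [pred k | `[< D k >]] by move=> ?; apply/asboolP.
have [bc|bc] := eqVneq b c.
- apply: (key [:: a; b; e] (fun k x => if k == b then x ^+ 2 else x)).
  + by rewrite /= !inE negb_or ab ae be.
  + by move=> k ks; apply/asboolP; move: ks; rewrite !inE => /or3P[] /eqP->.
  + by move=> k; case: (k == b); [exact: exprn_measurable|exact: measurable_id].
  + move=> k; rewrite !inE => /or3P[] /eqP->; rewrite ?eqxx ?(negbTE ab) 1?eq_sym ?(negbTE be).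
    * exact: intgW1.
    * exact: intgW2.
    * exact: intgW1.
  + by rewrite mem_head.
  + by apply/funext => x; rewrite (negbTE ab).
  + move=> w; rewrite !big_cons big_nil (negbTE ab) eqxx (eq_sym e) (negbTE be) -bc; ring.
- apply: (key [:: a; b; c; e] (fun k x => x)) => //.
  + by rewrite /= !inE !negb_or ab ac ae bc be ce.
  + by move=> k ks; apply/asboolP; move: ks; rewrite !inE => /or4P[] /eqP->.
  + by move=> k; rewrite !inE => /or4P[] /eqP->; exact: intgW1.
  + by rewrite mem_head.
  + by move=> w; rewrite !big_cons big_nil; ring.
Qed.

Lemma noise_orth2 f1 f2 i j a b : bm f1 -> bm f2 -> D a -> D b -> a != b ->
  \int[P]_w (f1 (X i w) * f2 (X j w) * (W a w * W b w)) = 0.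
Proof.
move=> bf1 bf2 Da Db ab.
have bY : bm (fun w => f1 (X i w) * f2 (X j w)).
  by apply: bm_mul; [exact: bm_comp (mX i)|exact: bm_comp (mX j)].
have [_ [M YM]] := bY.
transitivity (\int[P]_w (f1 (X i w) * f2 (X j w) * \prod_(k <- [:: a; b]) W k w)).
  by apply: eq_Rintegral => w _; rewrite !big_cons big_nil mulr1.
have us : uniq [:: a; b] by rewrite /= inE ab.
have sD : {subset [:: a; b] <= [pred k | `[< D k >]]}.
  by move=> k ks; apply/asboolP; move: ks; rewrite !inE => /orP[] /eqP->.
have dom : P.-integrable setT (EFin \o (fun w => M * (W a w ^+ 2 + W b w ^+ 2))).
  by apply: intg_scale => //; apply: intg_add => //; exact: intgW2.
rewrite (@Ex_prod _ _ _ P _ (fun k => W k : T -> R) [:: a; b] _ _ mW bY us _ (fun _ x => x) _ _ dom).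
- by rewrite !big_cons noise_mean0// mul0r mulr0.
- by move=> E mE; exact: noise_indep.
- by move=> k; exact: measurable_id.
- by move=> k; rewrite !inE => /orP[] /eqP->; exact: intgW1.
- move=> w; rewrite !big_cons big_nil mulr1 normrM ler_pM//.
  rewrite normrM; have := sqr_ge0 (`|W a w| - `|W b w|).
  rewrite -(ger0_norm (sqr_ge0 (W a w))) -(ger0_norm (sqr_ge0 (W b w))) !normrX.
  by have := normr_ge0 (W a w); have := normr_ge0 (W b w); nra.
Qed.

Lemma noise_intg4 a b c e : D a -> D b -> D c -> D e ->
  P.-integrable setT (EFin \o (fun w => W a w * W b w * W c w * W e w)).
Proof.
move=> Da Db Dc De.
apply: (@intg_le _ _ _ P setT measurableT _ _ _ _ (dom4 Da Db Dc De)).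
- by apply: measurable_funM => //; apply: measurable_funM => //; exact: measurable_funM.
- by move=> w _; exact: amgm4.
Qed.

Lemma noise_intg2 (Y : T -> R) a b : bm Y -> D a -> D b ->
  P.-integrable setT (EFin \o (fun w => Y w * (W a w * W b w))).
Proof.
move=> [mY [M YM]] Da Db; apply: (@intg_mul_bounded _ _ _ P setT measurableT _ _ M) => //.
apply: (@intg_le _ _ _ P setT measurableT _ (fun w => W a w ^+ 2 + W b w ^+ 2)).
- exact: measurable_funM.
- move=> w _; have := sqr_ge0 (W a w - W b w); have := sqr_ge0 (W a w + W b w).
  by rewrite ler_norml; nra.
- by apply: intg_add => //; exact: intgW2.
Qed.

End noise.

(** * Gaussian processes and spectral classes *)

Section gaussian_variables.
Context {d : measure_display} {T : measurableType d} {R : realType}.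
Variable P : probability T R.
Local Notation leb := (@lebesgue_measure R).

Lemma gaussian_variable_moments (Z : T -> R) : measurable_fun setT Z ->
  gaussian_variable P Z -> exists m s : R,
  [/\ P.-integrable setT (EFin \o (fun w => Z w - m)) /\ \int[P]_w (Z w - m) = 0,
      P.-integrable setT (EFin \o (fun w => (Z w - m) ^+ 2)) /\
        \int[P]_w (Z w - m) ^+ 2 = s ^+ 2,
      forall b, \int[P]_w cos (Z w - m + b) = expR (- (s ^+ 2 / 2)) * cos b &
      0 <= s /\ (0 < s -> forall A, measurable A -> P (Z @^-1` A) = normal_prob m s A)].
Proof.
move=> mZ [m [s [s0 ZP]]]; exists m, s.
have mcos b : measurable_fun setT (fun x : R => cos (x - m + b)).
  have := bm_cos 1 (b - m) => -[+ _]; congr (measurable_fun _ _).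
  by apply/funext => x; congr cos; ring.
have m1 : measurable_fun setT (fun x : R => x - m).
  by apply: measurable_funB => //; exact: measurable_cst.
have m2 : measurable_fun setT (fun x : R => (x - m) ^+ 2) by exact: measurable_funX.
have [s00|s00] := eqVneq s 0.
- pose mu := (\d_m : {measure set R -> \bar R}).
  have Zg A : measurable A -> P (Z @^-1` A) = (\int[mu]_(x in A) ((fun=> 1 : R) x)%:E)%E.
    by move=> mA; rewrite ZP// s00 eqxx integral_cst// mul1e.
  have if_ (f : R -> R) : measurable_fun setT f -> mu.-integrable setT (EFin \o (fun x => f x * 1)).
    move=> mf; apply/integrableP; split.
      by apply/measurable_EFinP; apply: measurable_funM => //; exact: measurable_cst.
    rewrite integral_dirac ?diracT ?mul1e ?ltry//.
    by apply/measurable_EFinP => /=; apply: measurableT_comp => //; apply: measurable_funM => //; exact: measurable_cst.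
  have v (f : R -> R) : measurable_fun setT f -> P.-integrable setT (EFin \o (fun w => f (Z w))) /\
      \int[P]_w f (Z w) = f m.
    move=> mf; split.
      exact: (@intg_density _ _ T R R P mu Z (fun=> 1) mZ (measurable_cst _) (fun=> ler01) Zg f mf (if_ f mf)).
    rewrite (@Rintegral_density _ _ T R R P mu Z (fun=> 1) mZ (measurable_cst _) (fun=> ler01) Zg f mf (if_ f mf)).
    rewrite /Rintegral integral_dirac ?diracT ?mul1e ?mulr1//.
    by apply/measurable_EFinP => /=; apply: measurable_funM => //; exact: measurable_cst.
  rewrite s00; split.
  + by have [? ->] := v _ m1; rewrite subrr.
  + by have [? ->] := v _ m2; rewrite subrr.
  + by move=> b; have [_ ->] := v _ (mcos b); rewrite subrr add0r !expr2 !mul0r oppr0 expR0 mul1r.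
  + by rewrite ltxx.
- have sp : 0 < s by rewrite lt_neqAle eq_sym s00.
  have Zg A : measurable A -> P (Z @^-1` A) = (\int[leb]_(x in A) (normal_pdf m s x)%:E)%E.
    by move=> mA; rewrite ZP// (negbTE s00).
  have mp : measurable_fun setT (normal_pdf m s : measurableTypeR R -> R).
    by apply: continuous_measurable_fun; exact: continuous_normal_pdf_pos.
  have p0 x : 0 <= normal_pdf m s x by exact: normal_pdf_ge0.
  have v (f : R -> R) : measurable_fun setT f -> leb.-integrable setT (EFin \o (fun x => f x * normal_pdf m s x)) ->
      P.-integrable setT (EFin \o (fun w => f (Z w))) /\
      \int[P]_w f (Z w) = \int[leb]_x (f x * normal_pdf m s x).
    move=> mf iff; split.
      exact: (@intg_density _ _ T (measurableTypeR R) R P leb Z (normal_pdf m s) mZ mp p0 Zg f mf iff).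
    exact: (@Rintegral_density _ _ T (measurableTypeR R) R P leb Z (normal_pdf m s) mZ mp p0 Zg f mf iff).
  split.
  + by have [? ->] := v _ m1 (intg_normal1 m sp); rewrite Rintegral_normal1.
  + by have [? ->] := v _ m2 (intg_normal2 m sp); rewrite Rintegral_normal2.
  + move=> b; have e x : cos (1 * (x - m) + b) = cos (x - m + b) by rewrite mul1r.
    have ii : leb.-integrable setT (EFin \o (fun x => cos (x - m + b) * normal_pdf m s x)).
      by have := intg_normal_cos m sp 1 b; under eq_fun do rewrite e.
    have [_ ->] := v _ (mcos b) ii.
    have := Rintegral_normal_cos m sp 1 b; under eq_Rintegral do rewrite e.
    by move=> ->; rewrite expr1n mulr1.
  + by split=> // _ A mA; rewrite ZP// (negbTE s00).
Qed.

End gaussian_variables.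

Section linear_span.
Context {d : measure_display} {T : measurableType d} {R : realType}.
Variable P : probability T R.
Variable X : int -> {RV P >-> R}.
Hypothesis gX : gaussian_process X.
Hypothesis X0 : forall t : int, ('E_P[X t] = 0)%E.

Definition span_fun (s : seq (R * int)) w : R := \sum_(p <- s) p.1 * X p.2 w.

Definition process_span : set (T -> R) := [set Y | exists s, Y = span_fun s].

Let mX t : measurable_fun setT (X t : T -> R). Proof. exact: measurable_funPT. Qed.

Lemma process_spanX t : process_span (X t).
Proof.
by exists [:: (1, t)]; apply/funext => w; rewrite /span_fun big_seq1 mul1r.
Qed.

Lemma process_span_lin a b Y Z : process_span Y -> process_span Z ->
  process_span (fun w => a * Y w + b * Z w).
Proof.
move=> [s ->] [r ->]; exists ([seq (a * p.1, p.2) | p <- s] ++ [seq (b * p.1, p.2) | p <- r]).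
apply/funext => w; rewrite /span_fun big_cat !big_map /=.
by rewrite !mulr_sumr; congr (_ + _); apply: eq_bigr => p _; rewrite mulrA.
Qed.

Lemma measurable_span Y : process_span Y -> measurable_fun setT Y.
Proof.
move=> [s ->]; apply: measurable_sum => p.
by apply: measurable_funM => //; exact: measurable_cst.
Qed.

Lemma gaussian_span Y : process_span Y -> gaussian_variable P Y.
Proof.
move=> [s ->].
have := gX [fset p.2 | p in s]%fset (fun t => \sum_(p <- s | p.2 == t) p.1).
congr (gaussian_variable _ _); apply/funext => w; rewrite /span_fun.
under eq_bigr do rewrite mulr_suml.
rewrite (exchange_big_dep predT)//=.
rewrite big_seq [RHS]big_seq; apply: eq_bigr => p ps.
rewrite big_mkcond (bigD1_seq p.2) ?fset_uniq//=; last by apply/imfsetP; exists p.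
by rewrite eqxx big1 ?addr0// => t; rewrite eq_sym => /negbTE ->.
Qed.

Let Xint t : P.-integrable setT (EFin \o (X t : T -> R)) /\ \int[P]_w X t w = 0.
Proof.
have [m [s [[i1 _] _ _ _]]] := gaussian_variable_moments (mX t) (gaussian_span (process_spanX t)).
split; last by rewrite /Rintegral -expectation_def X0.
have := intg_add measurableT i1 (intg_bm P (bm_cst (m : R))).
by congr (integrable _ _ _); apply/funext => w /=; rewrite subrK.
Qed.

Let span_mean Y : process_span Y -> P.-integrable setT (EFin \o Y) /\ \int[P]_w Y w = 0.
Proof.
move=> [s ->]; split.
  by apply: intg_sum => // p; apply: intg_scale => //; exact: (Xint _).1.
rewrite /span_fun Rintegral_sum//; last first.
  by move=> p; apply: intg_scale => //; exact: (Xint _).1.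
by rewrite big1// => p _; rewrite RintegralZl ?(Xint _).2 ?mulr0//; exact: (Xint _).1.
Qed.

Lemma process_span_law Y : process_span Y -> exists s : R, [/\ 0 <= s,
  P.-integrable setT (EFin \o (fun w => Y w * Y w)), ip P Y Y = s ^+ 2,
  forall b, \int[P]_w cos (Y w + b) = expR (- (s ^+ 2 / 2)) * cos b &
  0 < s -> forall A, measurable A -> P (Y @^-1` A) = normal_prob 0 s A].
Proof.
move=> LY.
have [m [s [[i1 e1] [i2 e2] ec [s0 law]]]] := gaussian_variable_moments (measurable_span LY) (gaussian_span LY).
have [iY Y0] := span_mean LY.
have m0 : m = 0.
  have bm1 := intg_bm P (bm_cst (m : R)).
  move: e1; rewrite RintegralB// Y0 sub0r Ex_cst => /eqP.
  by rewrite oppr_eq0 => /eqP.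
exists s; move: i2 e2 ec law; rewrite m0.
under eq_fun do rewrite subr0 expr2.
move=> i2 e2 ec law; split => //.
- by move=> b; rewrite -ec; apply: eq_Rintegral => w _; rewrite subr0.
Qed.

Lemma gaussian_process_span : gaussian_space P process_span.
Proof.
split.
- exact: process_span_lin.
- exact: measurable_span.
- by move=> Y /process_span_law[s []].
- by move=> Y b /process_span_law[s [_ _ -> + _]]; apply.
- move=> Y /process_span_law[s [s0 _ -> _ law]] s2.
  have sp : 0 < s by rewrite lt_neqAle s0 andbT; apply: contraTneq s2 => <-; rewrite expr2 mulr0 ltxx.
  by rewrite law// /normal_prob integral_set1.
Qed.

Lemma unit_span_law Y : process_span Y -> ip P Y Y = 1 -> forall A, measurable A ->
  P (Y @^-1` A) = normal_prob 0 1 A.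
Proof.
move=> /process_span_law[s [s0 _ -> _ law]] /eqP.
rewrite sqrf_eq1 => /orP[/eqP s1|/eqP s1]; first by subst s; exact: law.
by move: s0; rewrite s1 ler0N1.
Qed.

Lemma covariance_ip t u : covariance P (X t) (X u) = (ip P (X t) (X u))%:E.
Proof.
rewrite covariance.unlock !X0 /=.
rewrite unlock /ip /Rintegral fineK; last first.
  apply: integrable_fin_num => //.
  exact: (gaussian_intg_mul gaussian_process_span (process_spanX t) (process_spanX u)).
by apply: eq_integral => w _; congr (_%:E); rewrite -[LHS]/((X t w - 0) * (X u w - 0)) !subr0.
Qed.

End linear_span.

Section summation.
Context {R : realType}.
Implicit Types (F : nat -> R).

Definition dist (a b : nat) : nat := (a - b) + (b - a).

Lemma sum_dist_le F (M : R) a b n : (forall h, 0 <= F h) ->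
  (forall m, \sum_(h < m) F h <= M) -> \sum_(k < n) F (dist a (b + k)) <= 2 * M.
Proof.
move=> F0 FM; pose m := (a + (b + n))%N.
have sub1 k l (G : nat -> R) : (forall h, 0 <= G h) -> (k <= l)%N ->
    \sum_(h < k) G h <= \sum_(h < l) G h.
  by move=> G0 kl; rewrite (big_ord_widen _ G kl) big_mkcond/=; apply: ler_sum => h _; case: ifP.
have h1 : \sum_(k < n) F (dist a (b + k)) <= \sum_(j < b + n) F (dist a j).
  rewrite big_split_ord /= lerDr; exact: sumr_ge0.
have h2 : \sum_(j < b + n) F (dist a j) <= \sum_(j < m) F (dist a j).
  by apply: (sub1 _ _ (fun j => F (dist a j))) => //; rewrite leq_addl.
have h3 : \sum_(j < m) F (dist a j) = \sum_(j < a) F j.+1 + \sum_(j < b + n) F j.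
  rewrite big_split_ord/=; congr (_ + _).
    rewrite (reindex_inj rev_ord_inj) /=; apply: eq_bigr => j _; congr F; rewrite /dist.
    by have := ltn_ord j; lia.
  by apply: eq_bigr => j _; congr F; rewrite /dist; lia.
have h4 : \sum_(j < a) F j.+1 <= M.
  by rewrite (le_trans _ (FM a.+1))// big_ord_recl lerDr.
by have := FM (b + n)%N; lra.
Qed.

(* Dyadic condensation. *)
Lemma sum_powR_le (t : R) n : 1 < t ->
  \sum_(h < n) h.+1%:R `^ (- t) <= (1 - 2 `^ (1 - t))^-1.
Proof.
move=> t1; set q := 2 `^ (1 - t).
have q0 : 0 < q by rewrite powR_gt0.
have q1 : q < 1.
  by rewrite /q /powR pnatr_eq0/= expR_lt1 pmulr_llt0 ?ln_gt0 ?ltr1n//; lra.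
have h m : \sum_(h < (2 ^ m).-1) h.+1%:R `^ (- t) <= (1 - q ^+ m) / (1 - q).
  elim: m => [|m ih]; first by rewrite big_ord0 expr0 subrr mul0r.
  have -> : (2 ^ m.+1).-1 = ((2 ^ m).-1 + 2 ^ m)%N.
    by rewrite expnS; have := expn_gt0 2 m; lia.
  rewrite big_split_ord/=.
  have hb : \sum_(i < 2 ^ m) ((2 ^ m).-1 + i).+1%:R `^ (- t) <= q ^+ m.
    rewrite (le_trans (y := \sum_(i < 2 ^ m) (2 ^ m)%:R `^ (- t)))//.
      apply: ler_sum => i _; rewrite !powRN lef_pV2 ?posrE ?powR_gt0 ?ltr0n ?expn_gt0//.
      apply: ge0_ler_powR; rewrite ?nnegrE ?ler0n//; first by lra.
      by rewrite ler_nat; have := expn_gt0 2 m; lia.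
    rewrite sumr_const card_ord /q -[leRHS]powR_mulrn ?powR_ge0// -powRrM -[leLHS]mulr_natl.
    rewrite (_ : (2 ^ m)%:R = 2 `^ m%:R); last by rewrite natrX powR_mulrn.
    rewrite -powRrM -powRD; last by rewrite pnatr_eq0 implybT.
    by rewrite (_ : m%:R + m%:R * - t = (1 - t) * m%:R)//; ring.
  apply: (le_trans (lerD ih hb)).
  by rewrite ler_pdivlMr ?subr_gt0// mulrDl divfK ?gt_eqF ?subr_gt0// exprS; lra.
have nlt : (n <= (2 ^ n).-1)%N by have := ltn_expl n (isT : (1 < 2)%N); lia.
rewrite (le_trans (y := \sum_(h < (2 ^ n).-1) h.+1%:R `^ (- t)))//.
  rewrite (big_ord_widen _ (fun h => h.+1%:R `^ (- t)) nlt) big_mkcond/=.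
  by apply: ler_sum => i _; case: ifP => // _; rewrite powR_ge0.
apply: (le_trans (h n)).
rewrite ler_piMl ?invr_ge0 ?subr_ge0 ?ltW//.
by rewrite ltrBlDr ltrDl exprn_gt0.
Qed.

Lemma sin_natM_le k (x : R) : `|sin (k%:R * x)| <= k%:R * `|sin x|.
Proof.
elim: k => [|k ih]; first by rewrite !mul0r sin0 normr0.
rewrite -natr1 !mulrDl !mul1r sinD (le_trans (ler_normD _ _))// lerD//.
  by rewrite normrM (le_trans _ ih)// ler_piMr// ler_norml cos_geN1 cos_le1.
by rewrite normrM ler_piMl// ler_norml cos_geN1 cos_le1.
Qed.

Lemma cos_natM_le k (x : R) : 1 - cos (k%:R * x) <= k%:R ^+ 2 * (1 - cos x).
Proof.
have e (y : R) : 1 - cos y = 2 * `|sin (y / 2)| ^+ 2.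
  rewrite {1}(_ : y = y / 2 *+ 2); last by rewrite -mulr_natr divfK.
  by rewrite cos_mulr2n real_normK ?num_real// sin2cos2; ring.
rewrite !e [leRHS]mulrCA ler_wpM2l// -exprMn ler_sqr ?nnegrE ?mulr_ge0//.
by rewrite -mulrA; exact: sin_natM_le.
Qed.

Lemma cos_doubled_le (x : R) : 1 - cos (2 * x) <= 4 * (1 + cos x).
Proof.
rewrite (_ : 2 * x = x *+ 2) ?mulr_natl// cos_mulr2n.
by have := cos_le1 x; have := cos_geN1 x; nra.
Qed.

End summation.

Section spectral_classes.
Context {R : realType}.
Variables (C0 C1 s : R) (f : R -> R).
Hypotheses (C01 : 1 <= C0) (C10 : 0 < C1) (s2 : 1 / 2 < s).
Hypothesis fF : spectral_class C0 C1 s f.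
Local Notation leb := (@lebesgue_measure R).
Local Notation D := (@circle R).

Let s2_gt1 : 1 < 2 * s.
Proof. by rewrite mulrC -ltr_pdivrMr. Qed.

Definition acov (f : R -> R) n := \int[leb]_(x in D) (f x * cosn n x).
Definition acorr (f : R -> R) n := acov f n / acov f 0.
Local Notation gam := (acov f).
Local Notation rho := (acorr f).

Lemma intg_spectral : leb.-integrable D (EFin \o f).
Proof. by case: fF => -[]. Qed.

Lemma Re_autocov h : complex.Re (autocov f h) = gam `|h|%N.
Proof.
apply: eq_Rintegral => x _; rewrite /= mul0r subr0; congr (_ * _); rewrite /cosn.
by case: h => n//=; rewrite NegzE mulrNz mulNr cosN.
Qed.

Let intg_cosn n : leb.-integrable D (EFin \o (fun x => f x * cosn n x)).
Proof.
have := @intg_mul_bounded _ _ _ leb D measurable_circle f (cosn n) 1 intg_spectral (@measurable_cosn R n D).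
move=> /(_ (fun x _ => cosn_le1 n x)).
by congr (integrable _ _ _); apply/funext => x /=; rewrite mulrC.
Qed.

Let intg_scale_cosn a n : leb.-integrable D (EFin \o (fun x => a * (f x * cosn n x))).
Proof. exact: (@intg_scale _ _ _ leb D measurable_circle a (fun x => f x * cosn n x)). Qed.

Lemma autocov0 : autocov f 0 = (gam 0)%:C.
Proof.
apply/eqP; rewrite eq_complex; apply/andP; split; apply/eqP; first exact: Re_autocov.
transitivity (\int[leb]_(x in D) (0 : R)).
  by apply: eq_Rintegral => x _; rewrite /= mul0r sin0; ring.
by rewrite /Rintegral integral0.
Qed.

Lemma acov0_bounds : C0^-1 <= gam 0 <= C0.
Proof. by case: fF => _ + _; rewrite autocov0 !lecR. Qed.

Lemma acov0_gt0 : 0 < gam 0.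
Proof.
have /andP[+ _] := acov0_bounds; apply: lt_le_trans.
by rewrite invr_gt0 (lt_le_trans ltr01).
Qed.

Lemma acorr0 : rho 0 = 1.
Proof. by rewrite /acorr divff// gt_eqF// acov0_gt0. Qed.

Lemma acorr_sobolev (l : seq nat) : uniq l -> 0%N \notin l ->
  \sum_(h <- l) h%:R `^ (2 * s) * rho h ^+ 2 <= C1 ^+ 2.
Proof.
move=> ul l0; case: fF => _ _ h.
rewrite -lee_fin; apply: (le_trans _ h); apply: esum_ge.
exists [set` [seq Posz n | n <- l]].
  split; first exact: finite_seq.
  by move=> k /= /mapP[n nl ->]; apply: contraNneq l0 => -[<-].
rewrite -fsbig_seq; last by rewrite map_inj_uniq// => a b [].
rewrite big_map -sumEFin; apply: lee_sum => n _; rewrite lee_fin.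
have -> : autocorr f n = (autocov f n) * ((gam 0)^-1)%:C.
  by rewrite /autocorr autocov0; congr (_ * _); rewrite [RHS]fmorphV.
rewrite ler_wpM2l ?powR_ge0// Normc.normcM exprMn.
rewrite /acorr exprMn.
have -> : Normc.normc (gam 0)^-1%:C = (gam 0)^-1.
  by rewrite /Normc.normc /= expr2 expr2 mul0r addr0 -expr2 sqrtr_sqr ger0_norm// invr_ge0 ltW// acov0_gt0.
rewrite ler_wpM2r ?sqr_ge0// -[gam n](Re_autocov n).
by case: (autocov f n) => a b /=; rewrite sqr_sqrtr ?addr_ge0 ?sqr_ge0// lerDl sqr_ge0.
Qed.

Lemma acorr_sobolev_ord m n :
  \sum_(j < n) (m.+1 + j)%:R `^ (2 * s) * rho (m.+1 + j) ^+ 2 <= C1 ^+ 2.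
Proof.
have := acorr_sobolev (iota_uniq m.+1 n).
have -> : iota m.+1 n = [seq (m.+1 + j)%N | j <- index_iota 0 n].
  by rewrite /index_iota subn0 -iotaDl addn0.
by rewrite big_map big_mkord; apply; apply/mapP => -[j _]; rewrite addSn.
Qed.

(* AM-GM: [2 * `|rho h| <= h ^ (2 * s) * rho h ^ 2 + h ^ (- 2 * s)]. *)
Lemma acorr_abs_sum n : \sum_(h < n) `|rho h| <=
  1 + 2^-1 * (C1 ^+ 2 + (1 - 2 `^ (1 - 2 * s))^-1).
Proof.
have s21 := s2_gt1.
have C1g := sqr_ge0 C1.
have Zg : 0 <= (1 - 2 `^ (1 - 2 * s))^-1 :> R.
  by have := sum_powR_le 0 s21; rewrite big_ord0.
case: n => [|n]; first by rewrite big_ord0; lra.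
rewrite big_ord_recl acorr0 normr1 lerD2l.
have hR : \sum_(h < n) h.+1%:R `^ (2 * s) * rho h.+1 ^+ 2 <= C1 ^+ 2.
  exact: acorr_sobolev_ord 0 n.
apply: (@le_trans _ _ (2^-1 * (\sum_(h < n) h.+1%:R `^ (2 * s) * rho h.+1 ^+ 2 +
   \sum_(h < n) h.+1%:R `^ (- (2 * s))))); last first.
  by rewrite ler_wpM2l ?invr_ge0// lerD// sum_powR_le.
rewrite -big_split/= mulr_sumr; apply: ler_sum => h _.
rewrite powRN /bump/= add1n.
have : 0 < (h.+1%:R : R) `^ (2 * s) by rewrite powR_gt0.
move: (_ `^ _) => a a0; rewrite -(real_normK (num_real (rho h.+1))).
move: (`|rho _|) => r.
have h2 := sqr_ge0 (a * r - 1).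
by rewrite -(ler_pM2r a0) -mulrA mulrDl mulVf ?gt_eqF//; nra.
Qed.

Lemma acorr_sum_dist a b n : \sum_(k < n) `|rho (dist a (b + k))| <=
  2 + (C1 ^+ 2 + (1 - 2 `^ (1 - 2 * s))^-1).
Proof.
have := sum_dist_le a b n (fun h => normr_ge0 (rho h)) acorr_abs_sum.
by move=> h; apply: (le_trans h); rewrite mulrDr mulrA mulfV// mul1r mulr1.
Qed.

Let acorr_lin a b h : a + b * rho h = (\int[leb]_(x in D) (f x * (a + b * cosn h x))) / gam 0.
Proof.
have g0 : gam 0 != 0 by rewrite gt_eqF// acov0_gt0.
apply: (mulIf g0); rewrite divfK// mulrDl -mulrA divfK// /acov.
rewrite -!RintegralZl//; try exact: measurable_circle.
rewrite -RintegralD//; try exact: measurable_circle.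
by apply: eq_Rintegral => x _; rewrite {1}/cosn mul0r cos0; ring.
Qed.

Let acorr_lin_le a b h a' b' k :
  (forall x, a + b * cosn h x <= a' + b' * cosn k x) -> a + b * rho h <= a' + b' * rho k.
Proof.
move=> h1; rewrite !acorr_lin ler_pM2r ?invr_gt0 ?acov0_gt0//.
have ii c e j : leb.-integrable D (EFin \o (fun x => f x * (c + e * cosn j x))).
  apply: (@intg_eq _ _ _ leb D measurable_circle (fun x => c * (f x * cosn 0 x) + e * (f x * cosn j x))).
    by move=> x _; rewrite {1}/cosn mul0r cos0; ring.
  exact: (@intg_add _ _ _ leb D measurable_circle (fun x => c * (f x * cosn 0 x)) (fun x => e * (f x * cosn j x))).
apply: le_Rintegral => //; try exact: measurable_circle.
by move=> x Dx; rewrite ler_wpM2l//; case: fF => -[f0 _ _] _ _; apply: f0; rewrite inE.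
Qed.

Lemma acorr_natM_le k h : 1 - rho (k * h) <= k%:R ^+ 2 * (1 - rho h).
Proof.
have := @acorr_lin_le 1 (-1) (k * h) (k%:R ^+ 2) (- k%:R ^+ 2) h.
rewrite !mulN1r mulNr mulrBr mulr1; apply => x.
rewrite mulN1r mulNr /cosn natrM -mulrA.
by have := cos_natM_le k (h%:R * x); rewrite mulrBr mulr1.
Qed.

Lemma acorr_doubled_le h : 1 - rho (2 * h) <= 4 * (1 + rho h).
Proof.
have := @acorr_lin_le 1 (-1) (2 * h) 4 4 h.
rewrite mulN1r mulrDr mulr1; apply => x.
rewrite mulN1r /cosn natrM -mulrA.
by have := cos_doubled_le (h%:R * x); rewrite mulrDr mulr1.
Qed.

Definition acorr_gap (C1 : R) : R :=
  (8 * (Num.truncn (4 * C1 ^+ 2)).+1%:R ^+ 2)^-1.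

Lemma acorr_gap_gt0 : 0 < acorr_gap C1.
Proof. by rewrite invr_gt0 mulr_gt0// exprn_gt0. Qed.

(* If [rho h] were too close to 1, so would be [rho (k * h)] for more values of [k] than the
   Sobolev bound allows; the case of [-1] reduces to this one through [rho (2 * h)]. *)
Lemma acorr_le h : (0 < h)%N -> `|rho h| <= 1 - acorr_gap C1.
Proof.
move=> h0; set K := (Num.truncn (4 * C1 ^+ 2)).+1.
have K0 : 0 < K%:R :> R by rewrite ltr0n.
have C1K : 4 * C1 ^+ 2 < K%:R by exact: truncnS_gt.
have gE : acorr_gap C1 = (2 * K%:R ^+ 2)^-1 / 4.
  by rewrite /acorr_gap -/K -invfM; congr (_^-1); ring.
have main j : (0 < j)%N -> (2 * K%:R ^+ 2)^-1 <= 1 - rho j.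
  move=> j0; rewrite leNgt; apply/negP => lt1.
  have rk k : (k < K)%N -> 1 / 2 <= rho (k.+1 * j).
    move=> kK; have := acorr_natM_le k.+1 j.
    have : k.+1%:R ^+ 2 * (1 - rho j) <= 1 / 2.
      rewrite (le_trans (y := K%:R ^+ 2 * (2 * K%:R ^+ 2)^-1))//.
        apply: (le_trans (ler_wpM2l (sqr_ge0 _) (ltW lt1))).
        by rewrite ler_wpM2r ?invr_ge0 ?mulr_ge0 ?sqr_ge0// ler_sqr ?nnegrE ?ler0n// ler_nat.
      by rewrite invfM mulrCA divff ?gt_eqF ?exprn_gt0//; lra.
    lra.
  have := @acorr_sobolev [seq (k.+1 * j)%N | k <- index_iota 0 K].
  rewrite map_inj_in_uniq ?iota_uniq; last first.
    by move=> a b _ _ /eqP; rewrite eqn_pmul2r// => /eqP[].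
  rewrite big_map big_mkord => /(_ isT) h1.
  have {}h1 : \sum_(i < K) (i.+1 * j)%:R `^ (2 * s) * rho (i.+1 * j) ^+ 2 <= C1 ^+ 2.
    by apply: h1; apply/mapP => -[k _]; lia.
  have : \sum_(i < K) (1 / 4 : R) <= C1 ^+ 2.
    apply: le_trans h1; apply: ler_sum => i _.
    have := rk i (ltn_ord i) => ri.
    have a1 : 1 <= (i.+1 * j)%:R `^ (2 * s) :> R.
      apply: (le_trans (y := 1 `^ (2 * s))); first by rewrite powR1.
      apply: ge0_ler_powR; rewrite ?nnegrE//; first exact: ltW (lt_trans ltr01 s2_gt1).
      by rewrite (ler_nat _ 1); lia.
    by move: (_ `^ _) a1 => a a1; nra.
  by rewrite sumr_const card_ord -mulr_natl; lra.
have m1 := main h h0; have m2 := main (2 * h)%N ltac:(lia).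
have := acorr_doubled_le h; rewrite gE ler_norml => h3.
have : 0 <= (2 * K%:R ^+ 2)^-1 :> R by rewrite invr_ge0 mulr_ge0// sqr_ge0.
by move: (_^-1) m1 m2 => g m1 m2 g0; apply/andP; split; lra.
Qed.

End spectral_classes.

(** * Variances of the privatized sums *)

Section square_of_sum.
Context {R : realType} {d : measure_display} {T : measurableType d}.
Variable P : probability T R.
Local Notation intg f := (P.-integrable setT (EFin \o f)).

Lemma Ex_sqr_sum_le (Y : nat -> T -> R) n (M : R) :
  (forall i k, (i < n)%N -> (k < n)%N -> intg (fun w => Y i w * Y k w)) ->
  (forall i, (i < n)%N -> \sum_(k < n) `|\int[P]_w (Y i w * Y k w)| <= M) ->
  intg (fun w => (\sum_(i < n) Y i w) ^+ 2) /\
  \int[P]_w (\sum_(i < n) Y i w) ^+ 2 <= n%:R * M.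
Proof.
move=> iY YM.
have e w : (\sum_(i < n) Y i w) ^+ 2 = \sum_(i < n) \sum_(k < n) (Y i w * Y k w).
  by rewrite expr2 mulr_suml; apply: eq_bigr => i _; rewrite mulr_sumr.
have ii (i : 'I_n) : intg (fun w => \sum_(k < n) (Y i w * Y k w)).
  by apply: (@intg_sum _ _ _ P setT measurableT _ _ (fun (k : 'I_n) w => Y i w * Y k w)) => k; exact: iY.
split.
  under eq_fun do rewrite e.
  exact: (@intg_sum _ _ _ P setT measurableT _ _ (fun (i : 'I_n) w => \sum_(k < n) (Y i w * Y k w))).
under eq_Rintegral do rewrite e.
rewrite (Rintegral_sum measurableT _ ii).
apply: (@le_trans _ _ (\sum_(i < n) M)); last first.
  by rewrite sumr_const card_ord mulr_natl.
apply: ler_sum => i _.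
rewrite (Rintegral_sum measurableT _ (F := fun (k : 'I_n) w => Y i w * Y k w)); last first.
  by move=> k; exact: iY.
apply: le_trans (YM i (ltn_ord i)); apply: (le_trans (ler_norm _)).
exact: ler_norm_sum.
Qed.

Lemma Ex_sqr_sum_orthogonal_le (Y : nat -> T -> R) n (M : R) :
  (forall i k, (i < n)%N -> (k < n)%N -> intg (fun w => Y i w * Y k w)) ->
  (forall i k, (i < n)%N -> (k < n)%N -> i != k -> \int[P]_w (Y i w * Y k w) = 0) ->
  (forall i, (i < n)%N -> \int[P]_w (Y i w * Y i w) <= M) ->
  intg (fun w => (\sum_(i < n) Y i w) ^+ 2) /\
  \int[P]_w (\sum_(i < n) Y i w) ^+ 2 <= n%:R * M.
Proof.
move=> iY Y0 YM; apply: Ex_sqr_sum_le => // i i_n.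
rewrite (bigD1 (Ordinal i_n))//= big1 ?addr0; last first.
  by move=> k /eqP ki; rewrite Y0 ?normr0//; apply/eqP => ik; apply: ki; exact/val_inj/esym.
rewrite ger0_norm ?YM//; apply: Rintegral_ge0 => w _.
by rewrite -expr2 sqr_ge0.
Qed.

End square_of_sum.

Section noise_sums.
Context {R : realType} {d : measure_display} {T : measurableType d}.
Variables (P : probability T R) (N : nat) (X : int -> {RV P >-> R}).
Variable W : nat * nat -> {RV P >-> R}.
Hypothesis XW : laplace_noise N X W.
Local Notation D := (noise_index N).
Local Notation intg f := (P.-integrable setT (EFin \o f)).

Let mX i : measurable_fun setT (X i : T -> R). Proof. exact: measurable_funPT. Qed.

Lemma noise_sum_le (phi : R -> R) (t : nat -> int) (a : nat -> nat * nat) n :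
  bm phi -> (forall x, `|phi x| <= 1) -> injective a -> (forall j, (j < n)%N -> D (a j)) ->
  intg (fun w => (\sum_(j < n) (phi (X (t j) w) * W (a j) w)) ^+ 2) /\
  \int[P]_w (\sum_(j < n) (phi (X (t j) w) * W (a j) w)) ^+ 2 <=
  n%:R * (1 + laplace_moment4).
Proof.
move=> bphi phi1 ainj Da.
have bX i : bm (fun w => phi (X i w)) by exact: bm_comp bphi (mX i).
have e i k w : phi (X (t i) w) * W (a i) w * (phi (X (t k) w) * W (a k) w) =
    phi (X (t i) w) * phi (X (t k) w) * (W (a i) w * W (a k) w) by ring.
apply: (Ex_sqr_sum_orthogonal_le (Y := fun j w => phi (X (t j) w) * W (a j) w)).
- move=> i k i_n k_n; under eq_fun do rewrite e.
  by apply: (noise_intg2 XW); [exact: bm_mul|exact: Da..].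
- move=> i k i_n k_n ik; under eq_Rintegral do rewrite e.
  apply: (noise_orth2 XW) => //; [exact: Da..|].
  by apply: contra_neq ik; exact: ainj.
- move=> i i_n; apply: le_trans (noise_moment2 XW (Da i i_n)).
  apply: le_Rintegral => //.
  + under eq_fun do rewrite e.
    by apply: (noise_intg2 XW); [exact: bm_mul|exact: Da..].
  + have := noise_intg2 XW (bm_cst (1 : R)) (Da i i_n) (Da i i_n).
    by under eq_fun do rewrite mul1r -expr2.
  + move=> w _; rewrite e -!expr2 ler_piMl ?sqr_ge0//.
    by rewrite -(real_normK (num_real (phi _))) expr_le1.
Qed.

Let sqr_mul_le (x y : R) : x * y * (x * y) <= 2^-1 * (x ^+ 4 + y ^+ 4).
Proof. by have := sqr_ge0 (x ^+ 2 - y ^+ 2); lra. Qed.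

Lemma noise_product_sum_le h n : (0 < h)%N -> (n + h <= N)%N ->
  intg (fun w => (\sum_(j < n) (W (j.+1, 2%N) w * W ((j.+1 + h)%N, 2%N) w)) ^+ 2) /\
  \int[P]_w (\sum_(j < n) (W (j.+1, 2%N) w * W ((j.+1 + h)%N, 2%N) w)) ^+ 2 <=
  n%:R * laplace_moment4.
Proof.
move=> h0 nh.
have D1 j : (j < n)%N -> D (j.+1, 2%N) by move=> jn; split => //=; lia.
have D2 j : (j < n)%N -> D ((j.+1 + h)%N, 2%N) by move=> jn; split => //=; lia.
have i4 i k : (i < n)%N -> (k < n)%N -> intg (fun w => W (i.+1, 2%N) w * W ((i.+1 + h)%N, 2%N) w *
    (W (k.+1, 2%N) w * W ((k.+1 + h)%N, 2%N) w)).
  move=> i_n k_n; have := noise_intg4 XW (D1 i i_n) (D2 i i_n) (D1 k k_n) (D2 k k_n).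
  by under eq_fun do rewrite -mulrA.
apply: (Ex_sqr_sum_orthogonal_le (Y := fun j w => W (j.+1, 2%N) w * W ((j.+1 + h)%N, 2%N) w)) => //.
- have lt0 i k : (i < n)%N -> (k < n)%N -> (i < k)%N -> \int[P]_w (W (i.+1, 2%N) w * W ((i.+1 + h)%N, 2%N) w *
      (W (k.+1, 2%N) w * W ((k.+1 + h)%N, 2%N) w)) = 0.
    move=> i_n k_n ik.
    have := noise_orth4 XW (D1 i i_n) (D2 i i_n) (D1 k k_n) (D2 k k_n).
    rewrite !xpair_eqE/= !andbT => <-; try lia.
    by apply: eq_Rintegral => w _; ring.
  move=> i k i_n k_n; rewrite neq_ltn => /orP[ik|ik]; first exact: lt0.
  by rewrite -[RHS](lt0 k i)//; apply: eq_Rintegral => w _; ring.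
- move=> i i_n.
  have iW j : D j -> intg (fun w => W j w ^+ 4).
    move=> Dj; have := noise_intg4 XW Dj Dj Dj Dj.
    suff -> : (fun w => W j w * W j w * W j w * W j w) = (fun w => W j w ^+ 4) by [].
    by apply/funext => w; move: (W j w) => x; rewrite !exprS expr0 mulr1 !mulrA.
  have iD := intg_scale measurableT 2^-1 (intg_add measurableT (iW _ (D1 i i_n)) (iW _ (D2 i i_n))).
  apply: (@le_trans _ _ (\int[P]_w (2^-1 * (W (i.+1, 2%N) w ^+ 4 + W ((i.+1 + h)%N, 2%N) w ^+ 4)))).
    by apply: le_Rintegral => //; exact: i4.
  rewrite RintegralZl//; last first.
    exact: (intg_add measurableT (iW _ (D1 i i_n)) (iW _ (D2 i i_n))).
  rewrite (RintegralD measurableT (iW _ (D1 i i_n)) (iW _ (D2 i i_n))).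
  rewrite (noise_moment4 XW (D1 i i_n)) (noise_moment4 XW (D2 i i_n)).
  by lra.
Qed.

End noise_sums.

Section square_helpers.
Context {R : realType} {d : measure_display} {T : measurableType d}.
Variable P : probability T R.
Local Notation intg f := (P.-integrable setT (EFin \o f)).

Lemma Ex_centered_mul (a b : T -> R) : bm a -> bm b ->
  \int[P]_w ((a w - \int[P]_v a v) * (b w - \int[P]_v b v)) =
  \int[P]_w (a w * b w) - \int[P]_w a w * \int[P]_w b w.
Proof.
move=> ba bb; set p := \int[P]_w a w; set q := \int[P]_w b w.
transitivity (\int[P]_w (a w * b w - (q * a w + p * b w - p * q))).
  by apply: eq_Rintegral => w _; ring.
have bc : bm (fun _ : T => p * q : R) by exact: (bm_cst (p * q : R)).
rewrite ExB; [|exact: bm_mul|by apply: bm_sub => //; apply: bm_add; exact: bm_scale].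
rewrite ExB//; last by apply: bm_add; exact: bm_scale.
rewrite ExD; [|exact: bm_scale..].
by rewrite (Ex_cst P (p * q)) !ExZ// -/p -/q; ring.
Qed.

Lemma Ex_sqr_le (Y G : T -> R) : measurable_fun setT Y -> (forall w, Y w ^+ 2 <= G w) ->
  intg G -> intg (fun w => Y w ^+ 2) /\ \int[P]_w Y w ^+ 2 <= \int[P]_w G w.
Proof.
move=> mY YG iG.
have iY : intg (fun w => Y w ^+ 2).
  apply: (@intg_le _ _ _ P setT measurableT _ G) => //; first exact: measurable_funX.
  by move=> w _; rewrite ger0_norm ?sqr_ge0.
by split => //; apply: le_Rintegral.
Qed.

End square_helpers.

Section time_series.
Context {R : realType} {d : measure_display} {T : measurableType d}.
Variables (C0 C1 s : R) (f : R -> R) (P : probability T R) (X : int -> {RV P >-> R}).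
Hypotheses (C01 : 1 <= C0) (C10 : 0 < C1) (s2 : 1 / 2 < s).
Hypothesis fF : spectral_class C0 C1 s f.
Hypothesis fX : centered_stationary_gaussian f X.
Local Notation intg f := (P.-integrable setT (EFin \o f)).
Local Notation L := (process_span X).
Local Notation ip := (ip P).
Local Notation rho := (acorr f).
Local Notation J := (@jordan_cst R).

Let mX i : measurable_fun setT (X i : T -> R). Proof. exact: measurable_funPT. Qed.

Lemma centered t : ('E_P[X t] = 0)%E.
Proof. by case: fX => _ + _ _; apply. Qed.

Lemma gaussian_span_X : gaussian_space P L.
Proof. by apply: gaussian_process_span; [case: fX|exact: centered]. Qed.

Let GL := gaussian_span_X.

Let L_scale a Y : L Y -> L (fun w => a * Y w).
Proof.
move=> LY; have := process_span_lin a 0 LY LY.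
by under eq_fun do rewrite mul0r addr0.
Qed.

Let ip_scale a b Y Z : L Y -> L Z -> ip (fun w => a * Y w) (fun w => b * Z w) = a * b * ip Y Z.
Proof.
move=> LY LZ; have := ip_linl GL a 0 LY LY (L_scale b LZ).
under eq_fun do rewrite mul0r addr0.
move=> ->; rewrite mul0r addr0; have := ip_linr GL b 0 LZ LZ LY.
under eq_fun do rewrite mul0r addr0.
by move=> ->; ring.
Qed.

Lemma ip_X i j : ip (X i%:Z) (X j%:Z) = acov f (dist i j).
Proof.
case: fX => gX EX cX fc.
have e : covariance P (X i%:Z) (X j%:Z) = covariance P (X 0) (X (j%:Z - i%:Z)).
  by rewrite -(cX i%:Z) addrC subrK.
have := covariance_ip gX EX i%:Z j%:Z; rewrite e => /(congr1 fine) /= <-.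
have -> : fine (covariance P (X 0) (X (j%:Z - i%:Z))) = complex.Re (autocov f (j%:Z - i%:Z)).
  by rewrite -fc.
by rewrite Re_autocov; congr (acov f _); rewrite /dist; lia.
Qed.

Definition std j : T -> R := fun w => (Num.sqrt (acov f 0))^-1 * X j%:Z w.

Let s0 : 0 < Num.sqrt (acov f 0).
Proof. by rewrite sqrtr_gt0 (acov0_gt0 C01 fF). Qed.

Lemma L_std j : L (std j).
Proof. exact/L_scale/process_spanX. Qed.

Lemma ip_std i j : ip (std i) (std j) = rho (dist i j).
Proof.
rewrite /std ip_scale; [|exact: process_spanX..].
rewrite ip_X -invfM -expr2 sqr_sqrtr; last exact: ltW (acov0_gt0 C01 fF).
by rewrite /acorr mulrC.
Qed.

Lemma dist_self j : dist j j = 0%N. Proof. by rewrite /dist subnn. Qed.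

Lemma ip_std1 j : ip (std j) (std j) = 1.
Proof. by rewrite ip_std dist_self (acorr0 C01 fF). Qed.

Lemma sg_std j w : Num.sg (X j%:Z w) = Num.sg (std j w).
Proof. by rewrite /std sgrM (@gtr0_sg _ (_^-1)) ?invr_gt0// mul1r. Qed.

Lemma exceeds_std c j w : exceeds c (X j%:Z w) = exceeds (c / Num.sqrt (acov f 0)) (std j w).
Proof.
by rewrite /exceeds /std normrM gtr0_norm ?invr_gt0// mulrC ltr_pM2l ?invr_gt0.
Qed.

Let Ex_std (phi : R -> R) i j : bm phi -> \int[P]_w phi (std i w) = \int[P]_w phi (std j w).
Proof.
move=> bphi; have b1 : bm (fun _ : R => 1 : R) by exact: (bm_cst (1 : R)).
have := gaussian_law GL (L_std i) (L_std i) (L_std j) (L_std j) _ _ _ bphi b1.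
rewrite !ip_std1 => /(_ erefl erefl erefl).
by under eq_Rintegral do rewrite mulr1; under [RHS]eq_Rintegral do rewrite mulr1.
Qed.

Definition corr_total (C1 s : R) : R := 2 + (C1 ^+ 2 + (1 - 2 `^ (1 - 2 * s))^-1).
Local Notation Lam := (corr_total C1 s).

Lemma sum_ip_le a b n : \sum_(k < n) `|rho (dist a (b + k))| <= Lam.
Proof. exact: (acorr_sum_dist C01 s2 fF). Qed.

Lemma corr_total_ge0 : 0 <= Lam.
Proof. by have := sum_ip_le 0 0 0; rewrite big_ord0. Qed.

Definition exceed_prob : R := \int[P]_w exceeds C0 (X 0 w).

Lemma Ex_exceeds j : \int[P]_w exceeds C0 (X j%:Z w) = exceed_prob.
Proof.
rewrite /exceed_prob -[X 0]/(X 0%:Z).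
under eq_Rintegral do rewrite exceeds_std.
under [RHS]eq_Rintegral do rewrite exceeds_std.
by apply: Ex_std; exact: bm_exceeds.
Qed.

Lemma exceeds_sum_le n :
  intg (fun w => (\sum_(i < n) (exceeds C0 (X i.+1%:Z w) - exceed_prob)) ^+ 2) /\
  \int[P]_w (\sum_(i < n) (exceeds C0 (X i.+1%:Z w) - exceed_prob)) ^+ 2 <=
  n%:R * (2 * J * Lam).
Proof.
have be i : bm (fun w => exceeds C0 (X i%:Z w)) by exact: bm_comp (bm_exceeds C0) (mX i).
have bp : bm (fun _ : T => exceed_prob) by exact: bm_cst.
apply: (Ex_sqr_sum_le (Y := fun i w => exceeds C0 (X i.+1%:Z w) - exceed_prob)).
  by move=> i k _ _; apply: intg_bm; apply: bm_mul; apply: bm_sub.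
move=> i _; apply: (@le_trans _ _ (\sum_(k < n) (2 * J * `|rho (dist i.+1 (1 + k))|))).
  apply: ler_sum => k _; rewrite add1n.
  have := Ex_centered_mul P (be i.+1) (be k.+1); rewrite !Ex_exceeds => ->.
  rewrite -{1}(Ex_exceeds i.+1) -(Ex_exceeds k.+1).
  rewrite -ip_std.
  under eq_Rintegral do rewrite !exceeds_std.
  under [X in _ - X * _]eq_Rintegral do rewrite exceeds_std.
  under [X in _ - _ * X]eq_Rintegral do rewrite exceeds_std.
  exact: (gaussian_cov_exceeds GL _ (L_std _) (L_std _) (ip_std1 _) (ip_std1 _)).
rewrite -mulr_sumr ler_wpM2l ?sum_ip_le// mulr_ge0// ltW//; exact: jordan_cst_gt0.
Qed.

Definition sign_mean (f : R -> R) h : R := 1 - 2 * acos (acorr f h) / pi.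

Let sgM i j : bm (fun w => Num.sg (X i%:Z w) * Num.sg (X j%:Z w)).
Proof. by apply: bm_mul; exact: bm_comp bm_sg (mX _). Qed.

Lemma Ex_signs j h : \int[P]_w (Num.sg (X j%:Z w) * Num.sg (X (j + h)%N%:Z w)) = sign_mean f h.
Proof.
under eq_Rintegral do rewrite !sg_std.
rewrite (sheppard GL (L_std _) (L_std _) (ip_std1 _) (ip_std1 _)) ip_std /sign_mean.
by rewrite /dist addKn (_ : j - (j + h) = 0)%N//; lia.
Qed.

Lemma sign_sum_le h n : (0 < h)%N ->
  intg (fun w => (\sum_(j < n) (Num.sg (X j.+1%:Z w) * Num.sg (X (j.+1 + h)%N%:Z w) - sign_mean f h)) ^+ 2) /\
  \int[P]_w (\sum_(j < n) (Num.sg (X j.+1%:Z w) * Num.sg (X (j.+1 + h)%N%:Z w) - sign_mean f h)) ^+ 2 <=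
  n%:R * (4 * J / acorr_gap C1 * (4 * Lam)).
Proof.
move=> h0; set mu := sign_mean f h.
have bmu : bm (fun _ : T => mu) by exact: bm_cst.
have dp : 0 < acorr_gap C1 by exact: acorr_gap_gt0.
apply: (Ex_sqr_sum_le (Y := fun j w => Num.sg (X j.+1%:Z w) * Num.sg (X (j.+1 + h)%N%:Z w) - mu)).
  by move=> i k _ _; apply: intg_bm; apply: bm_mul; apply: bm_sub.
move=> i _; apply: (@le_trans _ _ (\sum_(k < n) (4 * J / acorr_gap C1 *
   (`|rho (dist i.+1 (1 + k))| + `|rho (dist (i.+1 + h) (1 + k))| +
    `|rho (dist i.+1 (1 + h + k))| + `|rho (dist (i.+1 + h) (1 + h + k))|)))).
  apply: ler_sum => k _; rewrite addnAC add1n.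
  have := Ex_centered_mul P (sgM i.+1 (i.+1 + h)) (sgM k.+1 (k.+1 + h)); rewrite !Ex_signs => ->.
  rewrite -{1}(Ex_signs i.+1 h) -(Ex_signs k.+1 h).
  rewrite -!ip_std.
  under eq_Rintegral do rewrite !sg_std.
  under [X in _ - X * _]eq_Rintegral do rewrite !sg_std.
  under [X in _ - _ * X]eq_Rintegral do rewrite !sg_std.
  apply: (gaussian_cov_sign GL (L_std _) (L_std _) (L_std _) (L_std _) (ip_std1 _) (ip_std1 _) (ip_std1 _) (ip_std1 _) dp).
  rewrite ip_std; apply: (acorr_le C01 C10 s2 fF); rewrite /dist; lia.
rewrite -mulr_sumr !big_split/= ler_wpM2l//.
  by rewrite mulr_ge0 ?invr_ge0 ?(ltW dp)// mulr_ge0// ltW//; exact: jordan_cst_gt0.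
have := sum_ip_le i.+1 1 n; have := sum_ip_le (i.+1 + h) 1 n.
have := sum_ip_le i.+1 (1 + h) n; have := sum_ip_le (i.+1 + h) (1 + h) n.
by lra.
Qed.

End time_series.

Section privatized_sums.
Context {R : realType} {d : measure_display} {T : measurableType d}.
Variables (C0 C1 s alpha : R) (f : R -> R) (P : probability T R) (N : nat).
Variables (X : int -> {RV P >-> R}) (W : nat * nat -> {RV P >-> R}).
Hypotheses (C01 : 1 <= C0) (C10 : 0 < C1) (s2 : 1 / 2 < s).
Hypothesis fF : spectral_class C0 C1 s f.
Hypothesis fX : centered_stationary_gaussian f X.
Hypothesis XW : laplace_noise N X W.
Local Notation intg f := (P.-integrable setT (EFin \o f)).
Local Notation Lam := (corr_total C1 s).
Local Notation J := (@jordan_cst R).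
Local Notation m4 := (@laplace_moment4 R).
Local Notation b := (3 / alpha).

Let mX i : measurable_fun setT (X i : T -> R). Proof. exact: measurable_funPT. Qed.
Let mW k : measurable_fun setT (W k : T -> R). Proof. exact: measurable_funPT. Qed.

Let sqrD_le (x y : R) : (x + y) ^+ 2 <= 2 * x ^+ 2 + 2 * y ^+ 2.
Proof. by have := sqr_ge0 (x - y); lra. Qed.

Let sqrD4_le (x y z t : R) :
  (x + y + z + t) ^+ 2 <= 4 * x ^+ 2 + 4 * y ^+ 2 + 4 * z ^+ 2 + 4 * t ^+ 2.
Proof.
have := sqr_ge0 (x - y); have := sqr_ge0 (x - z); have := sqr_ge0 (x - t).
by have := sqr_ge0 (y - z); have := sqr_ge0 (y - t); have := sqr_ge0 (z - t); lra.
Qed.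

Definition noisy (w : T) : nat * nat -> R :=
  privatize C0 alpha (fun i => X i%:Z w) (fun k => W k w).

Lemma measurable_noisy k : measurable_fun setT (fun w => noisy w k).
Proof.
have mbW : measurable_fun setT (fun w => b * W k w).
  by apply: measurable_funM => //; exact: measurable_cst.
rewrite /noisy /privatize; case: (k.2 == 1%N); apply: measurable_funD => //.
- exact: (bm_comp (bm_exceeds C0) (mX k.1)).1.
- exact: (bm_comp bm_sg (mX k.1)).1.
Qed.

Definition exceed_cst (C1 s : R) : R := 4 * J * corr_total C1 s.

Lemma exceed_frequency_le : (0 < N)%N ->
  intg (fun w => (N%:R^-1 * \sum_(1 <= i < N.+1) noisy w (i, 1%N) - exceed_prob C0 X) ^+ 2) /\
  \int[P]_w (N%:R^-1 * \sum_(1 <= i < N.+1) noisy w (i, 1%N) - exceed_prob C0 X) ^+ 2 <=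
  (exceed_cst C1 s + 2 * b ^+ 2 * (1 + m4)) / N%:R.
Proof.
move=> N0; set p := exceed_prob C0 X.
have Np : 0 < N%:R :> R by rewrite ltr0n.
have [i1 e1] := exceeds_sum_le C01 C10 s2 fF fX N.
have b1 : bm (fun _ : R => 1 : R) by exact: (bm_cst (1 : R)).
have n1 (x : R) : `|1 : R| <= 1 by rewrite normr1.
have inj1 : injective (fun j => (j.+1, 1%N)) by move=> x y [].
have D1 j : (j < N)%N -> noise_index N (j.+1, 1%N) by move=> jN; split => /=; lia.
have [i2 e2] := noise_sum_le XW (fun=> 0) b1 n1 inj1 D1.
set S1 := fun w => \sum_(i < N) (exceeds C0 (X i.+1%:Z w) - p).
set S2 := fun w => \sum_(j < N) (1 * W (j.+1, 1%N) w).
have YE w : N%:R^-1 * \sum_(1 <= i < N.+1) noisy w (i, 1%N) - p = N%:R^-1 * (S1 w + b * S2 w).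
  rewrite big_add1 /= big_mkord (_ : \sum_(i < N) noisy w (i.+1, 1%N) =
    \sum_(i < N) (exceeds C0 (X i.+1%:Z w) + b * W (i.+1, 1%N) w)); last by [].
  rewrite big_split/= -mulr_sumr /S1 /S2 sumrB.
  rewrite (_ : \sum_(i < N) p = N%:R * p); last by rewrite sumr_const card_ord mulr_natl.
  under [X in _ = _ * (_ + b * X)]eq_bigr do rewrite mul1r.
  by rewrite addrAC mulrBr mulKf ?gt_eqF.
have mY : measurable_fun setT (fun w => N%:R^-1 * \sum_(1 <= i < N.+1) noisy w (i, 1%N) - p).
  apply: measurable_funB => //; apply: measurable_funM => //.
  by apply: measurable_sum => i; exact: measurable_noisy.
have iG := intg_scale measurableT (N%:R^-1 ^+ 2) (intg_add measurableT
  (intg_scale measurableT 2 i1) (intg_scale measurableT (2 * b ^+ 2) i2)).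
have [|iY eY] := Ex_sqr_le mY _ iG.
  move=> w; rewrite YE exprMn ler_wpM2l ?sqr_ge0// -/(S1 w) -/(S2 w).
  rewrite (_ : 2 * b ^+ 2 * S2 w ^+ 2 = 2 * (b * S2 w) ^+ 2); last by rewrite -[LHS]mulrA -exprMn.
  exact: sqrD_le.
split => //; apply: (le_trans eY).
rewrite RintegralZl//; last first.
  exact: (intg_add measurableT (intg_scale measurableT 2 i1) (intg_scale measurableT (2 * b ^+ 2) i2)).
rewrite (RintegralD measurableT (intg_scale measurableT 2 i1) (intg_scale measurableT (2 * b ^+ 2) i2)).
rewrite (RintegralZl _ measurableT i1) (RintegralZl _ measurableT i2).
have b20 : 0 <= b ^+ 2 by exact: sqr_ge0.
rewrite (_ : _ / N%:R = N%:R^-1 ^+ 2 * (2 * (N%:R * (2 * J * Lam)) + 2 * b ^+ 2 * (N%:R * (1 + m4)))).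
  by rewrite ler_wpM2l ?sqr_ge0// lerD// ler_wpM2l// mulr_ge0.
rewrite /exceed_cst; have := gt_eqF Np; move/negbT.
by move: (N%:R) (b ^+ 2) => n bb n0; field.
Qed.

Definition sign_cst (C1 s : R) : R := 64 * J / acorr_gap C1 * corr_total C1 s.

Lemma sign_products_le h : (0 < h < N)%N ->
  intg (fun w => (\sum_(1 <= j < (N - h).+1) noisy w (j, 2%N) * noisy w ((j + h)%N, 2%N) -
    (N - h)%:R * sign_mean f h) ^+ 2) /\
  \int[P]_w (\sum_(1 <= j < (N - h).+1) noisy w (j, 2%N) * noisy w ((j + h)%N, 2%N) -
    (N - h)%:R * sign_mean f h) ^+ 2 <=
  N%:R * (sign_cst C1 s + 8 * b ^+ 2 * (1 + m4) + 4 * b ^+ 4 * m4).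
Proof.
move=> /andP[h0 hN]; set n := (N - h)%N; set mu := sign_mean f h.
have nh : (n + h <= N)%N by rewrite /n; lia.
have [i1 e1] := sign_sum_le C01 C10 s2 fF fX n h0.
have sg1 (x : R) : `|Num.sg x| <= 1 by rewrite normr_sg; case: (x != 0).
have inj2 : injective (fun j => ((j.+1 + h)%N, 2%N)) by move=> x y []; lia.
have D2 j : (j < n)%N -> noise_index N ((j.+1 + h)%N, 2%N) by move=> jN; split => /=; lia.
have [i2 e2] := noise_sum_le XW (fun j => j.+1%:Z) bm_sg sg1 inj2 D2.
have inj3 : injective (fun j => (j.+1, 2%N)) by move=> x y [].
have D3 j : (j < n)%N -> noise_index N (j.+1, 2%N) by move=> jN; split => /=; lia.
have [i3 e3] := noise_sum_le XW (fun j => (j.+1 + h)%N%:Z) bm_sg sg1 inj3 D3.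
have [i4 e4] := noise_product_sum_le XW h0 nh.
move: i1 e1 i2 e2 i3 e3 i4 e4.
set S1 := fun w => \sum_(j < n) (Num.sg (X j.+1%:Z w) * Num.sg (X (j.+1 + h)%N%:Z w) - mu).
set S2 := fun w => \sum_(j < n) (Num.sg (X j.+1%:Z w) * W ((j.+1 + h)%N, 2%N) w).
set S3 := fun w => \sum_(j < n) (Num.sg (X (j.+1 + h)%N%:Z w) * W (j.+1, 2%N) w).
set S4 := fun w => \sum_(j < n) (W (j.+1, 2%N) w * W ((j.+1 + h)%N, 2%N) w).
move=> i1 e1 i2 e2 i3 e3 i4 e4.
have YE w : \sum_(1 <= j < n.+1) noisy w (j, 2%N) * noisy w ((j + h)%N, 2%N) - n%:R * mu =
    S1 w + b * S2 w + b * S3 w + b ^+ 2 * S4 w.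
  rewrite big_add1 /= big_mkord (_ : n%:R * mu = \sum_(j < n) mu); last first.
    by rewrite sumr_const card_ord mulr_natl.
  rewrite -sumrB /S1 /S2 /S3 /S4 !mulr_sumr -!big_split/=; apply: eq_bigr => j _.
  rewrite /noisy /privatize /=; ring.
have mY : measurable_fun setT (fun w =>
    \sum_(1 <= j < n.+1) noisy w (j, 2%N) * noisy w ((j + h)%N, 2%N) - n%:R * mu).
  apply: measurable_funB => //; apply: measurable_sum => j.
  by apply: measurable_funM; exact: measurable_noisy.
have j1 := intg_scale measurableT 4 i1.
have j2 := intg_scale measurableT (4 * b ^+ 2) i2.
have j3 := intg_scale measurableT (4 * b ^+ 2) i3.
have j4 := intg_scale measurableT (4 * b ^+ 4) i4.
have k2 := intg_add measurableT j1 j2.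
have k3 := intg_add measurableT k2 j3.
have k4 := intg_add measurableT k3 j4.
have [|iY eY] := Ex_sqr_le mY _ k4.
  move=> w; rewrite YE -/(S1 w) -/(S2 w) -/(S3 w) -/(S4 w).
  move: (S1 w) (S2 w) (S3 w) (S4 w) => x y z t.
  rewrite (_ : 4 * b ^+ 2 * y ^+ 2 = 4 * (b * y) ^+ 2); last by ring.
  rewrite (_ : 4 * b ^+ 2 * z ^+ 2 = 4 * (b * z) ^+ 2); last by ring.
  rewrite (_ : 4 * b ^+ 4 * t ^+ 2 = 4 * (b ^+ 2 * t) ^+ 2); last by ring.
  exact: sqrD4_le.
split => //; apply: (le_trans eY).
rewrite (RintegralD measurableT k3 j4) (RintegralD measurableT k2 j3) (RintegralD measurableT j1 j2).
rewrite (RintegralZl _ measurableT i1) (RintegralZl _ measurableT i2).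
rewrite (RintegralZl _ measurableT i3) (RintegralZl _ measurableT i4).
have b20 : 0 <= b ^+ 2 by exact: sqr_ge0.
have b40 : 0 <= b ^+ 4 by rewrite (_ : 4%N = (2 * 2)%N)// exprM sqr_ge0.
have nN : n%:R <= N%:R :> R by rewrite ler_nat leq_subr.
apply: (@le_trans _ _ (n%:R * (sign_cst C1 s + 8 * b ^+ 2 * (1 + m4) + 4 * b ^+ 4 * m4))); last first.
  rewrite ler_wpM2r//.
  have m40 : 0 <= m4 by exact: laplace_moment4_ge0.
  have Lam0 : 0 <= Lam by exact: corr_total_ge0 C01 s2 fF.
  have gap0 : 0 <= (acorr_gap C1)^-1 by rewrite invr_ge0 ltW// acorr_gap_gt0.
  have J0 : 0 <= J by rewrite ltW// jordan_cst_gt0.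
  have s0 : 0 <= sign_cst C1 s by rewrite /sign_cst; apply: mulr_ge0 => //; apply: mulr_ge0 => //; apply: mulr_ge0.
  apply: addr_ge0; last by apply: mulr_ge0 => //; apply: mulr_ge0.
  apply: addr_ge0 => //; apply: mulr_ge0; last exact: addr_ge0.
  exact: mulr_ge0.
have h1 := ler_wpM2l (ltW (ltr0Sn R 3)) e1.
have h2 : 4 * b ^+ 2 * \int[P]_w S2 w ^+ 2 <= 4 * b ^+ 2 * (n%:R * (1 + m4)) by rewrite ler_wpM2l// mulr_ge0.
have h3 : 4 * b ^+ 2 * \int[P]_w S3 w ^+ 2 <= 4 * b ^+ 2 * (n%:R * (1 + m4)) by rewrite ler_wpM2l// mulr_ge0.
have h4 : 4 * b ^+ 4 * \int[P]_w S4 w ^+ 2 <= 4 * b ^+ 4 * (n%:R * m4) by rewrite ler_wpM2l// mulr_ge0.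
apply: (le_trans (lerD (lerD (lerD h1 h2) h3) h4)).
rewrite /sign_cst le_eqVlt; apply/orP; left; apply/eqP.
by move: (b ^+ 2) (b ^+ 4) (acorr_gap C1)^-1 => *; ring.
Qed.

End privatized_sums.

(** * The estimators as Lipschitz functions of the privatized sums *)

Section gaussian_distribution_function.
Context {R : realType}.
Local Notation leb := (@lebesgue_measure R).
Local Notation phi := (normal_pdf (0 : R) 1).
Implicit Types (x y t B : R).

Lemma Phi_sub x y : x <= y -> Phi y - Phi x = \int[leb]_(t in `]x, y]) phi t.
Proof.
move=> xy; rewrite /Phi.
have -> : normal_prob 0 1 `]-oo, y]%classic =
    (normal_prob 0 1 `]-oo, x]%classic + normal_prob (0 : R) 1 `]x, y]%classic)%E.
  rewrite -measureU//.
    congr (normal_prob _ _ _); apply/seteqP; split=> t /=; rewrite !in_itv/=.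
      by case: (leP t x) => tx; [left|right].
    by move=> [/le_trans|/andP[]//]; exact.
  apply/seteqP; split=> t //= -[]; rewrite !in_itv/= => tx /andP[xt _].
  by move: (lt_le_trans xt tx); rewrite ltxx.
by rewrite fineD ?fin_num_measure// addrAC subrr add0r.
Qed.

Let intg_phi (E : set R) : measurable E -> leb.-integrable E (EFin \o phi).
Proof.
move=> mE; apply: (integrableS measurableT) => //.
exact: integrable_normal_pdf.
Qed.

Let Rintegral_itv_cst (c x y : R) : x <= y -> \int[leb]_(t in `]x, y]) c = c * (y - x).
Proof.
move=> xy; rewrite Rintegral_cst//; congr (_ * _).
have e : (leb `]x, y]%classic = (y - x)%:E)%E.
  rewrite lebesgue_measure_itv/= lte_fin; case: ltP => [//|yx].
  by rewrite (_ : y = x) ?subrr//; apply/le_anti; rewrite yx xy.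
exact: (congr1 fine e).
Qed.

Let intg_cst (c x y : R) : leb.-integrable `]x, y] (EFin \o (fun=> c)).
Proof.
apply: (@intg_bounded _ _ _ leb `]x, y]%classic _ _ `|c|) => //.
by rewrite /= lebesgue_measure_itv/=; case: ifP => _; rewrite ltry.
Qed.

Lemma Phi_upper x y : x <= y -> Phi y - Phi x <= normal_peak 1 * (y - x).
Proof.
move=> xy; rewrite Phi_sub// -Rintegral_itv_cst//; apply: le_Rintegral => //.
- exact: intg_phi.
- by move=> t _; exact: normal_pdf_ub.
Qed.

Lemma Phi_lower B x y : - B <= x -> x <= y -> y <= B ->
  phi B * (y - x) <= Phi y - Phi x.
Proof.
move=> Bx xy yB; rewrite Phi_sub// -Rintegral_itv_cst//; apply: le_Rintegral => //.
- exact: intg_phi.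
- move=> t; rewrite /= in_itv/= => /andP[xt ty].
  rewrite !normal_pdfE// ler_wpM2l ?normal_peak_ge0//.
  rewrite /normal_fun ler_expR !subr0 expr1n.
  by rewrite ler_pM2r ?invr_gt0// lerN2; nra.
Qed.

Lemma phi_gt0 B : 0 < phi B.
Proof. by rewrite normal_pdfE// mulr_gt0 ?normal_peak_gt0// expR_gt0. Qed.

Lemma Phi_le x y : x <= y -> Phi x <= Phi y.
Proof. by move=> xy; rewrite -subr_ge0 Phi_sub//; apply: Rintegral_ge0 => t _; exact: normal_pdf_ge0. Qed.

Lemma Phi_inj x y : Phi x = Phi y -> x = y.
Proof.
wlog xy : x y / x <= y => [hw|].
  by case: (leP x y) => [|/ltW] xy h; [exact: hw|apply/esym/hw].
move=> e; have := @Phi_lower (`|x| + `|y|) x y; rewrite e subrr => h.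
have {}h : phi (`|x| + `|y|) * (y - x) <= 0.
  have := ler_norm (- x); have := ler_norm y; rewrite normrN => h1 h2.
  by apply: h => //; have := normr_ge0 x; have := normr_ge0 y; lra.
apply/le_anti; rewrite xy/= -subr_le0.
by move: h; rewrite pmulr_rle0 ?phi_gt0.
Qed.

Lemma continuous_Phi : continuous (@Phi R).
Proof.
have K0 : 0 < normal_peak (1 : R) by exact: normal_peak_gt0.
move=> x; apply/cvgrPdist_le => e e0; near=> y.
have h : `|Phi x - Phi y| <= normal_peak 1 * `|x - y|.
  case: (leP x y) => [xy|/ltW xy].
    by rewrite distrC (distrC x) !ger0_norm ?subr_ge0 ?Phi_le// Phi_upper.
  by rewrite !ger0_norm ?subr_ge0 ?Phi_le// Phi_upper.
apply: (le_trans h); rewrite -ler_pdivlMl//.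
near: y; apply: (@cvgr_dist_le _ _ _ (nbhs x) _ id x); first exact: cvg_id.
by apply: mulr_gt0; [rewrite invr_gt0; exact: K0|exact: e0].
Unshelve. all: by end_near. Qed.

Lemma Phi_invP (l u q : R) : l <= u -> Phi l <= q <= Phi u ->
  l <= Phi_inv q <= u /\ Phi (Phi_inv q) = q :> R.
Proof.
move=> lu /andP[lq qu].
have [x xlu xq] : exists2 x, x \in `[l, u] & Phi x = q.
  apply: IVT => //; first by apply: continuous_subspaceT; exact: continuous_Phi.
  by rewrite (min_idPl (Phi_le lu)) (max_idPr (Phi_le lu)) lq.
have -> : Phi_inv q = x.
  by apply: Phi_inj; rewrite xq; rewrite /Phi_inv; case: xgetP => [y _ <-//|/(_ x)].
by split => //; move: xlu; rewrite in_itv.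
Qed.

End gaussian_distribution_function.

Section variance_estimator.
Context {R : realType}.
Variable C0 : R.
Hypothesis C01 : 1 <= C0.
Local Notation l := (C0 `^ (1 / 2)).
Local Notation u := (C0 `^ (3 / 2)).

Let C00 : 0 < C0.
Proof. exact: lt_le_trans ltr01 C01. Qed.

Let l1 : 1 <= l.
Proof.
apply: (le_trans (y := 1 `^ (1 / 2))); first by rewrite powR1.
by apply: ge0_ler_powR; rewrite ?nnegrE// ?(ltW C00)//; lra.
Qed.

Let lE : l = Num.sqrt C0.
Proof. by rewrite mul1r powR12_sqrt// ltW. Qed.

Let uE : u = C0 * l.
Proof.
rewrite (_ : 3 / 2 = 1 + 1 / 2); last by field.
by rewrite powRD ?powRr1// ?ltW//; apply/implyP => _; rewrite gt_eqF.
Qed.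

Let lsq : l ^+ 2 = C0. Proof. by rewrite lE sqr_sqrtr// ltW. Qed.

Lemma projection_dist (a b p x : R) : a <= p <= b -> `|projection a b x - p| <= `|x - p|.
Proof.
move=> /andP[ap pb]; rewrite /projection.
rewrite ler_norml /Order.max /Order.min; case: ifP; case: ifP => h1 h2; move: (h1) (h2);
  case: (ger0P (x - p)) => h3; move/idP => h4; move/idP=> h5; apply/andP; split; lra.
Qed.

Lemma projection_bounds (a b x : R) : a <= b -> a <= projection a b x <= b.
Proof. by move=> ab; rewrite /projection le_max lexx orbT ge_max ge_min lexx orbT. Qed.

Let half_bounds (q x y : R) :
  2 * (1 - y) <= q <= 2 * (1 - x) -> x <= 1 - q / 2 <= y.
Proof. by move=> /andP[h1 h2]; apply/andP; split; lra. Qed.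

Definition gamma_cst : R := C0 ^+ 2 * u / normal_pdf 0 1 u.

Lemma gamma_hat_dist N z (g : R) : C0^-1 <= g <= C0 ->
  let p := 2 * (1 - Phi (C0 / Num.sqrt g)) in
  [/\ C0^-1 <= gamma_hat C0 N z, gamma_hat C0 N z <= C0 &
  `|gamma_hat C0 N z - g| <=
    gamma_cst * `|N%:R^-1 * \sum_(1 <= i < N.+1) z (i, 1%N) - p| ].
Proof.
move=> /andP[g1 g2] p.
have c01 := C01; have c00 := C00.
have g0 : 0 < g by apply: lt_le_trans g1; rewrite invr_gt0.
set a := C0 / Num.sqrt g in p *.
have pE : p = 2 * (1 - Phi a) by [].
clearbody p.
have sg0 : 0 < Num.sqrt g by rewrite sqrtr_gt0.
have ga : g = (C0 / a) ^+ 2.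
  by rewrite /a invfM invrK mulrA divff ?gt_eqF// mul1r sqr_sqrtr// ltW.
have la : l <= a.
  rewrite /a ler_pdivlMr// -[leRHS]lsq expr2 ler_wpM2l// ?powR_ge0//.
  by rewrite lE ler_wsqrtr.
have au : a <= u.
  rewrite /a ler_pdivrMr// uE -mulrA ler_peMr//; first exact: ltW.
  rewrite -(ler_sqr) ?nnegrE ?mulr_ge0 ?powR_ge0 ?sqrtr_ge0// exprMn lsq sqr_sqrtr; last exact: ltW.
  by rewrite expr1n mulrC -ler_pdivrMr// div1r.
have lu : l <= u := le_trans la au.
have [pl pu] : 2 * (1 - Phi u) <= p /\ p <= 2 * (1 - Phi l).
  by rewrite pE !ler_pM2l// !lerD2l !lerN2; split; exact: Phi_le.
set raw := N%:R^-1 * _.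
have hp : `|p_hat C0 N z - p| <= `|raw - p| by apply: projection_dist; rewrite pl pu.
have hI : Phi l <= 1 - p_hat C0 N z / 2 <= Phi u.
  exact: half_bounds (projection_bounds raw (le_trans pl pu)).
have [/andP[lt tu] Pt] := Phi_invP lu hI.
rewrite /gamma_hat; move: (Phi_inv _) lt tu Pt => t lt tu Pt.
have l0 : 0 < l := lt_le_trans ltr01 l1.
have t0 : 0 < t by apply: lt_le_trans lt.
have a0 : 0 < a by apply: lt_le_trans la.
have u0 : 0 < u by apply: lt_le_trans lu.
have e1 : C0 / t <= l.
  by rewrite ler_pdivrMr// -{1}lsq expr2 ler_wpM2l// ltW.
have e2 : l^-1 <= C0 / t.
  rewrite ler_pdivlMr// mulrC ler_pdivrMr//; by move: tu; rewrite uE.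
split.
- rewrite -[in leLHS]lsq -exprVn ler_sqr ?nnegrE ?invr_ge0 ?powR_ge0//.
  exact/ltW/divr_gt0.
- by rewrite -[leRHS]lsq ler_sqr ?nnegrE ?powR_ge0//; exact/ltW/divr_gt0.
have c0 := phi_gt0 u.
have h1 : normal_pdf 0 1 u * `|t - a| <= `|Phi t - Phi a|.
  have hh x y : l <= x -> x <= y -> y <= u -> normal_pdf 0 1 u * `|x - y| <= `|Phi x - Phi y|.
    move=> lx xy yu; rewrite distrC (distrC (Phi x)) !ger0_norm ?subr_ge0 ?Phi_le//.
    apply: Phi_lower => //; apply: (@le_trans _ _ 0); first by rewrite oppr_le0 ltW.
    exact: le_trans (ltW l0) lx.
  case: (leP t a) => [ta|/ltW ta]; first exact: hh.
  by rewrite distrC (distrC (Phi t)); exact: hh.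
have h2 : `|Phi t - Phi a| = 2^-1 * `|p_hat C0 N z - p|.
  rewrite Pt pE (_ : _ - _ = 2^-1 * (2 * (1 - Phi a) - p_hat C0 N z)); last by field.
  by rewrite normrM distrC (@ger0_norm _ 2^-1) ?invr_ge0.
have h3 : `|(C0 / t) ^+ 2 - g| <= C0 ^+ 2 * (2 * u) * `|t - a|.
  rewrite ga (_ : _ - _ = C0 ^+ 2 * ((t + a) / (t * a) ^+ 2) * (a - t)); last first.
    by field; rewrite !gt_eqF.
  rewrite (normrM (_ * _)) (normrM (C0 ^+ 2)) (distrC a) (ger0_norm (sqr_ge0 C0)).
  apply: ler_wpM2r => //; apply: ler_wpM2l; first exact: sqr_ge0.
  have q1 : 1 <= (t * a) ^+ 2.
    by rewrite exprn_ege1// mulr_ege1// (le_trans l1).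
  have q0 := lt_le_trans ltr01 q1.
  rewrite ger0_norm; last by rewrite divr_ge0 ?addr_ge0 ?(ltW q0)// ltW.
  rewrite ler_pdivrMr//; apply: (@le_trans _ _ (2 * u)); last first.
    by apply: ler_peMr => //; apply: mulr_ge0 => //; exact: ltW.
  by rewrite mulr2n mulrDl !mul1r lerD.
apply: (le_trans h3); rewrite /gamma_cst.
have : `|t - a| <= (normal_pdf 0 1 u)^-1 * (2^-1 * `|raw - p|).
  rewrite mulrC ler_pdivlMr// mulrC (le_trans h1)// h2.
  by rewrite ler_wpM2l// invr_ge0.
have k0 : 0 <= C0 ^+ 2 * (2 * u) by rewrite mulr_ge0 ?sqr_ge0// mulr_ge0// ltW.
move=> /(ler_wpM2l k0) h4; apply: (le_trans h4).
rewrite le_eqVlt; apply/orP; left; apply/eqP.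
by field; rewrite gt_eqF.
Qed.

End variance_estimator.

Section exceedance_probability.
Context {R : realType} {d : measure_display} {T : measurableType d}.
Variables (C0 C1 s : R) (f : R -> R) (P : probability T R) (X : int -> {RV P >-> R}).
Hypotheses (C01 : 1 <= C0) (C10 : 0 < C1) (s2 : 1 / 2 < s).
Hypothesis fF : spectral_class C0 C1 s f.
Hypothesis fX : centered_stationary_gaussian f X.

Lemma exceed_probE : exceed_prob C0 X = 2 * (1 - Phi (C0 / Num.sqrt (acov f 0))).
Proof.
set a := C0 / _.
have a0 : 0 <= a by rewrite divr_ge0 ?sqrtr_ge0// (le_trans ler01).
rewrite /exceed_prob -[X 0]/(X 0%:Z).
under eq_Rintegral do rewrite (exceeds_std X C01 fF).
have LG := L_std f X 0; have G1 := ip_std1 C01 C10 s2 fF fX 0.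
set G := std f X 0; rewrite -/G in LG G1 *.
have [gX EX _ _] := fX.
have LN : process_span X (fun w => (-1) * G w + 0 * G w) by exact: process_span_lin.
have GS := gaussian_span_X fX.
have N1 : ip P (fun w => (-1) * G w + 0 * G w) (fun w => (-1) * G w + 0 * G w) = 1.
  by rewrite (ip_lin2 GS) ?G1//; ring.
have tail Y : process_span X Y -> ip P Y Y = 1 ->
    bm (fun w => \1_(`]a, +oo[%classic) (Y w) : R) /\
    \int[P]_w \1_(`]a, +oo[%classic) (Y w) = 1 - Phi a.
  move=> LY Y1; have mY := measurable_span LY.
  have mA : measurable (Y @^-1` `]a, +oo[%classic) by rewrite -[_ @^-1` _]setTI; exact: mY.
  split; first exact: bm_comp (bm_indic _) mY.
  transitivity (\int[P]_w \1_(Y @^-1` `]a, +oo[%classic) w : R); first by [].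
  rewrite Ex_indic// (unit_span_law gX EX LY Y1)// /Phi.
  rewrite (_ : `]a, +oo[%classic = ~` `]-oo, a]%classic); last by rewrite setCitvl.
  by rewrite probability_setC// fineB ?fin_num_measure.
have [b1 e1] := tail _ LG G1; have [b2 e2] := tail _ LN N1.
transitivity (\int[P]_w (\1_(`]a, +oo[%classic) (G w) +
    \1_(`]a, +oo[%classic) ((-1) * G w + 0 * G w) : R)).
  apply: eq_Rintegral => w _; rewrite mulN1r mul0r addr0 /exceeds !indicE.
  rewrite !mem_setE !in_itv/= !andbT lter_normr; case: (ltP a (G w)) => h1; case: (ltP a (- G w)) => h2 //=; rewrite ?addr0 ?add0r//.
  by move: (ltrD h1 h2); rewrite subrr => /(le_lt_trans (addr_ge0 a0 a0)); rewrite ltxx.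
by rewrite ExD// e1 e2; ring.
Qed.

End exceedance_probability.

Section autocorrelation_estimator.
Context {R : realType}.

Lemma sin_lipschitz (x y : R) : `|sin x - sin y| <= `|x - y|.
Proof.
wlog xy : x y / y <= x.
  by move=> h; case: (leP y x) => [|/ltW] xy; [exact: h|rewrite distrC (distrC x); exact: h].
have [c _ ->] := @MVT_segment R sin cos y x xy (fun z _ => is_derive_sin z)
  (continuous_subspaceT (@continuous_sin R)).
by rewrite normrM ler_piMl// ler_norml cos_geN1 cos_le1.
Qed.

Let pi_bounds : 2 <= (pi : R) <= 4.
Proof.
rewrite pi_ge2/=; have := @pihalf_02 R => /andP[_]; lra.
Qed.

Lemma sign_meanE f h : pi / 2 * sign_mean f h = pi / 2 - acos (acorr f h) :> R.
Proof.
rewrite /sign_mean; have : pi != 0 :> R by rewrite gt_eqF// pi_gt0.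
by move: pi (acos _) => p a p0; field.
Qed.

Lemma sin_sign_mean (f : R -> R) h : -1 <= acorr f h <= 1 ->
  sin (pi / 2 * sign_mean f h) = acorr f h.
Proof.
move=> r1; rewrite sign_meanE sinB sin_pihalf cos_pihalf mul1r mul0r subr0 acosK//.
Qed.

Lemma sign_mean_le (f : R -> R) h : -1 <= acorr f h <= 1 ->
  `|sign_mean f h| <= jordan_cst * `|acorr f h|.
Proof.
move=> r1; have sE := sin_sign_mean r1; have /andP[p2 p4] := pi_bounds.
have ab := acos_ge0 r1; have aub := acos_lepi r1.
have t1 : `|pi / 2 * sign_mean f h| <= pi / 2 by rewrite sign_meanE ler_norml; lra.
have h1 : `|pi / 2 * sign_mean f h| <= jordan_cst * `|acorr f h|.
  move: t1 sE; move: (pi / 2 * sign_mean f h) => t t1 sE.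
  have := jordan_le (normr_ge0 t) t1; suff -> : sin `|t| = `|acorr f h| by [].
  rewrite -sE; case: (ger0P t) t1 => t0 t1.
    by rewrite ger0_norm// sin_ge0_pi//; lra.
  rewrite sinN ler0_norm// -oppr_ge0 -sinN sin_ge0_pi//; lra.
apply: le_trans h1; rewrite normrM ger0_norm; last by lra.
by rewrite ler_peMl//; lra.
Qed.

Lemma rho_hat_dist (f : R -> R) N z h : (h < N)%N -> -1 <= acorr f h <= 1 ->
  (rho_hat N z h - acorr f h) ^+ 2 <= 8 / N%:R ^+ 2 *
    ((\sum_(1 <= j < (N - h).+1) z (j, 2%N) * z ((j + h)%N, 2%N) -
      (N - h)%:R * sign_mean f h) ^+ 2 + h%:R ^+ 2 * (jordan_cst ^+ 2 * acorr f h ^+ 2)).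
Proof.
move=> hN r1; rewrite /rho_hat -{1}(sin_sign_mean r1).
set A := \sum_(_ <= _ < _) _; have mle := sign_mean_le r1.
set mu := sign_mean f h in mle *.
have Np : 0 < N%:R :> R by rewrite ltr0n; lia.
have e : pi / (2 * N%:R) * A - pi / 2 * mu =
    pi / 2 / N%:R * ((A - (N - h)%:R * mu) - h%:R * mu).
  by rewrite natrB 1?ltnW//; field; rewrite gt_eqF.
have h1 := sin_lipschitz (pi / (2 * N%:R) * A) (pi / 2 * mu).
have {}h1 : (sin (pi / (2 * N%:R) * A) - sin (pi / 2 * mu)) ^+ 2 <=
   (pi / (2 * N%:R) * A - pi / 2 * mu) ^+ 2.
  by rewrite -(real_normK (num_real (sin _ - _))) -[leRHS](real_normK (num_real _)) ler_sqr ?nnegrE.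
apply: (le_trans h1); rewrite e.
move: (A - _) => {h1 e}Y.
have mu2 : mu ^+ 2 <= jordan_cst ^+ 2 * acorr f h ^+ 2.
  rewrite -exprMn -(real_normK (num_real mu)) -[leRHS](real_normK (num_real _)) ler_sqr ?nnegrE//.
  by rewrite normrM (ger0_norm (ltW jordan_cst_gt0)).
have hm : (h%:R * mu) ^+ 2 <= h%:R ^+ 2 * (jordan_cst ^+ 2 * acorr f h ^+ 2).
  by rewrite exprMn ler_wpM2l ?sqr_ge0.
have c4 : (pi / 2 / N%:R) ^+ 2 <= 4 / N%:R ^+ 2 :> R.
  rewrite expr_div_n ler_pM2r ?invr_gt0 ?exprn_gt0//.
  have /andP[p2 p4] := pi_bounds; rewrite (_ : 4 = 2 ^+ 2); last by rewrite -natrX.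
  by rewrite ler_sqr ?nnegrE//; lra.
rewrite exprMn; apply: (@le_trans _ _ (4 / N%:R ^+ 2 * (Y - h%:R * mu) ^+ 2)).
  by rewrite ler_wpM2r ?sqr_ge0.
rewrite (_ : 8 / _ = 4 / N%:R ^+ 2 * 2); last by rewrite mulrAC -natrM.
rewrite -[leRHS]mulrA; apply: ler_wpM2l; first by rewrite divr_ge0// sqr_ge0.
by have := sqr_ge0 (Y + h%:R * mu); move: hm; move: (h%:R * mu) => q; lra.
Qed.

End autocorrelation_estimator.

Section integral_monotonicity.
Context {d : measure_display} {T : measurableType d} {R : realType}.

(* Unlike in the library, [F] need not be measurable, as is the case of the loss: the
   integral is a supremum over the simple functions below [F]. *)
Lemma ge0_integral_le (mu : {measure set T -> \bar R}) (F G : T -> \bar R) :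
  (forall x, (0 <= F x)%E) -> (forall x, (F x <= G x)%E) ->
  (\int[mu]_x F x <= \int[mu]_x G x)%E.
Proof.
move=> F0 FG; have G0 x : (0 <= G x)%E := le_trans (F0 x) (FG x).
rewrite !ge0_integralTE//; apply: le_ereal_sup => _ [h hF <-].
by exists h => // x; exact: le_trans (hF x) (FG x).
Qed.

End integral_monotonicity.

Section quadratic_loss.
Context {R : realType}.
Variables (C0 C1 s : R) (f : R -> R).
Hypotheses (C01 : 1 <= C0) (s2 : 1 / 2 < s).
Hypothesis fF : spectral_class C0 C1 s f.
Local Notation leb := (@lebesgue_measure R).
Local Notation D := (@circle R).
Local Notation rho := (acorr f).

Lemma acorr_tail m n :
  \sum_(j < n) rho (m.+1 + j) ^+ 2 <= C1 ^+ 2 * m.+1%:R `^ (- (2 * s)).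
Proof.
have s0 : 0 <= 2 * s by rewrite mulr_ge0// (le_trans _ (ltW s2)).
have p0 : 0 < m.+1%:R `^ (2 * s) :> R by rewrite powR_gt0.
rewrite powRN ler_pdivlMr// mulrC mulr_sumr.
apply: le_trans (acorr_sobolev_ord C01 fF m n).
apply: ler_sum => j _; rewrite ler_wpM2r ?sqr_ge0//.
by apply: ge0_ler_powR; rewrite ?nnegrE ?ler0n// ler_nat leq_addr.
Qed.

Lemma acorr_sqr_sum n : \sum_(j < n) rho j.+1 ^+ 2 <= C1 ^+ 2.
Proof.
have := acorr_tail 0 n; rewrite powR1 mulr1; apply: le_trans.
by apply: ler_sum => j _; rewrite add1n.
Qed.

Section loss.
Variables (N H : nat) (z : nat * nat -> R).
Local Notation g := (gamma_hat C0 N z).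
Local Notation r := (rho_hat N z).
Local Notation fhat := (f_hat C0 N H z).

Let a h : R := g * (if h == 0%N then 1 else r h) / cosn_weight h.

Let fhatE x : fhat x = \sum_(h < H.+1) a h * cosn h x.
Proof.
have p0 : pi != 0 :> R by rewrite gt_eqF// pi_gt0.
rewrite /f_hat /f_red_hat big_ord_recl/= big_add1/= big_mkord /cosn mul0r cos0.
rewrite {1}/a /cosn_weight/=.
rewrite (_ : \sum_(i < H) a (bump 0 i) * cos ((bump 0 i)%:R * x) =
  g / pi * \sum_(i < H) r i.+1 * cos (i.+1%:R * x)).
  by move: (\sum_(i < H) _) => S; move: (pi : R) p0 => p p0; field.
rewrite mulr_sumr; apply: eq_bigr => i _; rewrite /bump/= add1n /a /cosn_weight/=.
by ring.
Qed.

Let mD : measurable D. Proof. exact: measurable_circle. Qed.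

Let intg_cc h k : leb.-integrable D (EFin \o (fun x => a h * (cosn h x * cosn k x))).
Proof.
apply: (@intg_bounded _ _ _ leb D mD _ `|a h| circle_lty).
  apply: measurable_funM; first exact: measurable_cst.
  by apply: measurable_funM; exact: measurable_cosn.
move=> x _; rewrite normrM ler_piMr// normrM mulr_ile1//; exact: cosn_le1.
Qed.

Let intg_fhat_cosn k : leb.-integrable D (EFin \o (fun x => fhat x * cosn k x)).
Proof.
apply: (@intg_eq _ _ _ leb D mD (fun x => \sum_(h < H.+1) a h * (cosn h x * cosn k x))).
  by move=> x _; rewrite fhatE mulr_suml; apply: eq_bigr => h _; rewrite mulrA.
exact: (@intg_sum _ _ _ leb D mD _ _ (fun (h : 'I_H.+1) x => a h * (cosn h x * cosn k x))).
Qed.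

Let fhat_coef k : \int[leb]_(x in D) (fhat x * cosn k x) =
  if (k <= H)%N then g * (if k == 0%N then 1 else r k) else 0.
Proof.
transitivity (\int[leb]_(x in D) (\sum_(h < H.+1) a h * (cosn h x * cosn k x))).
  by apply: eq_Rintegral => x _; rewrite fhatE mulr_suml; apply: eq_bigr => h _; rewrite mulrA.
rewrite (@Rintegral_sum _ _ _ leb D mD _ _ (fun (h : 'I_H.+1) x => a h * (cosn h x * cosn k x)))//.
have e (h : 'I_H.+1) : \int[leb]_(x in D) (a h * (cosn h x * cosn k x)) =
    if (h == k :> nat) then g * (if k == 0%N then 1 else r k) else 0.
  rewrite RintegralZl//; last first.
    apply: (@intg_bounded _ _ _ leb D mD _ 1 circle_lty).
      by apply: measurable_funM; exact: measurable_cosn.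
    by move=> x _; rewrite normrM mulr_ile1//; exact: cosn_le1.
  rewrite Rintegral_cosnM; case: eqP => [->|]; last by rewrite mulr0.
  by rewrite /a divfK// gt_eqF// cosn_weight_gt0.
rewrite (eq_bigr _ (fun h _ => e h)); case: (leqP k H) => kH.
  rewrite (bigD1 (Ordinal (kH : (k < H.+1)%N)))//= eqxx big1 ?addr0// => h /eqP hk.
  by case: eqP => // h'; case: hk; exact/val_inj.
by rewrite big1// => h _; case: eqP => // h'; have := ltn_ord h; rewrite h' ltnNge kH.
Qed.

Let f_cosn k : leb.-integrable D (EFin \o (fun x => f x * cosn k x)).
Proof.
have := @intg_mul_bounded _ _ _ leb D mD f (cosn k) 1 (intg_spectral fF) (@measurable_cosn R k D).
move=> /(_ (fun x _ => cosn_le1 k x)).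
by congr (integrable _ _ _); apply/funext => x /=; rewrite mulrC.
Qed.

Let coef k : \int[leb]_(x in D) ((fhat x - f x) * cosn k x) =
  (if (k <= H)%N then g * (if k == 0%N then 1 else r k) else 0) - acov f k.
Proof.
rewrite -fhat_coef /acov -RintegralB//.
by apply: eq_Rintegral => x _; rewrite mulrBl.
Qed.

Lemma quadratic_loss_le : 0 <= g -> g <= C0 ->
  (L2norm (fun x => (fhat x - f x)%R) ^+ 2 <=
   ((1 + 2 * C1 ^+ 2) * (g - acov f 0) ^+ 2 +
    2 * C0 ^+ 2 * (\sum_(1 <= h < H.+1) (r h - rho h) ^+ 2) +
    C0 ^+ 2 * (C1 ^+ 2 * H.+1%:R `^ (- (2 * s))))%:E)%E.
Proof.
move=> g0 gC; have /andP[gam1 gamC] := acov0_bounds fF.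
have gam0 := acov0_gt0 C01 fF.
have acE k : acov f k = acov f 0 * rho k.
  by rewrite /acorr mulrC divfK// gt_eqF.
apply: L2norm_sqr_le.
- have := @intg_sub _ _ _ leb D mD _ _ (intg_fhat_cosn 0) (f_cosn 0).
  congr (integrable _ _ _); apply/funext => x /=; congr (_%:E).
  by rewrite /cosn mul0r cos0 !mulr1.
- move=> x Dx; rewrite !fhatE; case: fF => -[_ fe _] _ _; rewrite fe ?inE//.
  by congr (_ - _); apply: eq_bigr => h _; rewrite /cosn mulrN cosN.
- move=> n; pose c k := \int[leb]_(x in D) ((fhat x - f x) * cosn k x).

  have w1 k : 1 <= cosn_weight k :> R.
    by rewrite /cosn_weight; have := @pi_ge2 R; case: (k == 0%N); lra.
  have c2 k : c k ^+ 2 / cosn_weight k <= c k ^+ 2.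
    by rewrite ler_pdivrMr ?cosn_weight_gt0// ler_peMr ?sqr_ge0.
  apply: (@le_trans _ _ (\sum_(k < n) c k ^+ 2)); first by apply: ler_sum => k _; exact: c2.
  apply: (@le_trans _ _ (\sum_(k < H.+1 + n) c k ^+ 2)).
    rewrite (big_ord_widen (H.+1 + n) (fun k => c k ^+ 2) (leq_addl _ _)) big_mkcond/=.
    by apply: ler_sum => k _; case: ifP => // _; exact: sqr_ge0.
  rewrite big_split_ord/= lerD//; last first.
    apply: (@le_trans _ _ (C0 ^+ 2 * \sum_(j < n) rho (H.+1 + j) ^+ 2)).
      rewrite mulr_sumr; apply: ler_sum => j _; rewrite /c coef leqNgt addSn ltnS leq_addr/= sub0r.
      rewrite sqrrN acE exprMn ler_wpM2r ?sqr_ge0// ler_sqr ?nnegrE//; lra.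
    by rewrite ler_wpM2l ?sqr_ge0//; exact: acorr_tail.
  rewrite big_ord_recl mulrDl mul1r -addrA lerD//.
    by rewrite /c coef /= mulr1.
  apply: (@le_trans _ _ (\sum_(h < H) (2 * (g - acov f 0) ^+ 2 * rho h.+1 ^+ 2 +
      2 * C0 ^+ 2 * (r h.+1 - rho h.+1) ^+ 2))).
    apply: ler_sum => h _; rewrite /c coef /bump/= ltn_ord/= acE.
    have g2 : g ^+ 2 <= C0 ^+ 2 by rewrite ler_sqr ?nnegrE// (le_trans g0).
    move: g (acov f 0) (r _) (rho _) g2 => G A x y g2.
    have h1 : G ^+ 2 * (x - y) ^+ 2 <= C0 ^+ 2 * (x - y) ^+ 2.
      by rewrite ler_wpM2r ?sqr_ge0.
    have h2 := sqr_ge0 ((G - A) * y - G * (x - y)).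
    by rewrite -(mulrA 2 (C0 ^+ 2)); move: h1 h2; move: (C0 ^+ 2 * _) => q h1 h2; lra.
  rewrite big_split/= -!mulr_sumr big_add1/= big_mkord lerD//.
  rewrite [leRHS]mulrAC; apply: ler_wpM2l; first by rewrite mulr_ge0 ?sqr_ge0.
  exact: acorr_sqr_sum.
Qed.

End loss.

End quadratic_loss.

(** * Risk bound and rates *)

Section risk.
Context {R : realType} {d : measure_display} {T : measurableType d}.
Variables (C0 C1 s alpha : R) (f : R -> R) (P : probability T R) (N H : nat).
Variables (X : int -> {RV P >-> R}) (W : nat * nat -> {RV P >-> R}).
Hypotheses (C01 : 1 <= C0) (C10 : 0 < C1) (s2 : 1 / 2 < s) (HN : (H < N)%N).
Hypothesis fF : spectral_class C0 C1 s f.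
Hypothesis fX : centered_stationary_gaussian f X.
Hypothesis XW : laplace_noise N X W.
Local Notation intg f := (P.-integrable setT (EFin \o f)).
Local Notation J := (@jordan_cst R).
Local Notation m4 := (@laplace_moment4 R).
Local Notation b := (3 / alpha).
Local Notation z := (noisy C0 alpha X W).
Local Notation rho := (acorr f).

Let acorr_bounds h : -1 <= rho h <= 1.
Proof.
case: h => [|h]; first by rewrite (acorr0 C01 fF) lexx andbT; lra.
have := acorr_le C01 C10 s2 fF (ltn0Sn h); have := acorr_gap_gt0 C1.
by rewrite -ler_norml => g0 h1; rewrite (le_trans h1)// gerBl ltW.
Qed.

Let sqr_le (x y : R) : `|x| <= y -> x ^+ 2 <= y ^+ 2.
Proof.
by move=> xy; rewrite -real_normK ?num_real// ler_sqr ?nnegrE// (le_trans _ xy).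
Qed.

Let C12 : 0 <= 1 + 2 * C1 ^+ 2.
Proof. by rewrite addr_ge0// pmulr_rge0// sqr_ge0. Qed.

Definition loss w : \bar R := (L2norm (fun x => (f_hat C0 N H (z w) x - f x)%R) ^+ 2)%E.

Let raw w := N%:R^-1 * \sum_(1 <= i < N.+1) z w (i, 1%N) - exceed_prob C0 X.
Let prods h w := \sum_(1 <= j < (N - h).+1) z w (j, 2%N) * z w ((j + h)%N, 2%N) -
  (N - h)%:R * sign_mean f h.

Lemma loss_ge0 w : (0 <= loss w)%E.
Proof. by rewrite /loss expe_ge0// /L2norm Lnorm_ge0. Qed.

Let C00 : 0 < C0. Proof. exact: lt_le_trans ltr01 C01. Qed.

Lemma loss_le_bounded w : H = 0%N ->
  (loss w <= ((1 + 2 * C1 ^+ 2) * C0 ^+ 2 + C0 ^+ 2 * C1 ^+ 2)%:E)%E.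
Proof.
move=> H0; have /andP[gam1 gamC] := acov0_bounds fF; have gam0 := acov0_gt0 C01 fF.
have [g1 g2 _] := gamma_hat_dist C01 N (z w) (acov0_bounds fF).
have g0 : 0 <= gamma_hat C0 N (z w) by apply: le_trans g1; rewrite invr_ge0 ltW.
apply: (le_trans (quadratic_loss_le C01 s2 fF H g0 g2)).
rewrite lee_fin H0 big_geq// mulr0 addr0 powR1 mulr1 lerD2r.
apply: ler_wpM2l => //; apply: sqr_le; rewrite ler_norml; move: (gamma_hat _ _ _) g1 g2 g0 => g g1 g2 g0; have c00 := C00.
by apply/andP; split; lra.
Qed.

Let G w := (1 + 2 * C1 ^+ 2) * gamma_cst C0 ^+ 2 * raw w ^+ 2 +
  16 * C0 ^+ 2 / N%:R ^+ 2 * (\sum_(h < H) prods h.+1 w ^+ 2) +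
  (16 * C0 ^+ 2 * J ^+ 2 * C1 ^+ 2 / N%:R + C0 ^+ 2 * C1 ^+ 2 * H.+1%:R `^ (- (2 * s))).

Let N0 : 0 < N%:R :> R. Proof. by rewrite ltr0n; lia. Qed.

Let bias_le : \sum_(h < H) (h.+1%:R / N%:R) ^+ 2 * rho h.+1 ^+ 2 <= C1 ^+ 2 / N%:R.
Proof.
have s21 : 1 <= 2 * s by have := s2; lra.
rewrite mulrC; apply: le_trans (ler_wpM2l _ (acorr_sobolev_ord C01 fF 0 H)); last first.
  by rewrite invr_ge0 ltW.
rewrite mulr_sumr; apply: ler_sum => h _; rewrite [leRHS]mulrA; apply: ler_wpM2r; first exact: sqr_ge0.
rewrite expr_div_n [leLHS]mulrC expr2 invfM -mulrA ler_wpM2l ?invr_ge0 ?(ltW N0)//.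
rewrite mulrC ler_pdivrMr// expr2.
apply: ler_pM => //; last by rewrite ler_nat; have := ltn_ord h; have := HN; lia.
by rewrite le1r_powR// ler1n.
Qed.

Lemma loss_le w : (loss w <= (G w)%:E)%E.
Proof.
have /andP[gam1 gamC] := acov0_bounds fF; have gam0 := acov0_gt0 C01 fF.
have [g1 g2] := gamma_hat_dist C01 N (z w) (acov0_bounds fF).
rewrite -(exceed_probE C01 C10 s2 fF fX) -/(raw w) => g3.
have g0 : 0 <= gamma_hat C0 N (z w) by apply: le_trans g1; rewrite invr_ge0 ltW.
apply: (le_trans (quadratic_loss_le C01 s2 fF H g0 g2)).
rewrite lee_fin /G addrA mulrA lerD2r -[leRHS]addrA lerD//.
  rewrite -[leRHS]mulrA; apply: ler_wpM2l => //.
  by rewrite -[X in _ * X](real_normK (num_real _)) -exprMn; exact: sqr_le.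
rewrite big_add1 big_mkord/=.
apply: (@le_trans _ _ (2 * C0 ^+ 2 * \sum_(h < H) 8 / N%:R ^+ 2 *
   (prods h.+1 w ^+ 2 + h.+1%:R ^+ 2 * (J ^+ 2 * rho h.+1 ^+ 2)))).
  apply: ler_wpM2l; first by rewrite mulr_ge0 ?sqr_ge0.
  apply: ler_sum => h _; apply: rho_hat_dist; last exact: acorr_bounds.
  exact: leq_ltn_trans (ltn_ord h) HN.
rewrite -mulr_sumr big_split/= !mulrDr lerD//.
  by rewrite le_eqVlt; apply/orP; left; apply/eqP; field; rewrite gt_eqF.
apply: (@le_trans _ _ (16 * C0 ^+ 2 * J ^+ 2 * (\sum_(h < H) (h.+1%:R / N%:R) ^+ 2 * rho h.+1 ^+ 2))).
  rewrite le_eqVlt; apply/orP; left; apply/eqP; rewrite !mulr_sumr; apply: eq_bigr => h _.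
  by field; rewrite gt_eqF.
rewrite -[leRHS]mulrA; apply: ler_wpM2l; last exact: bias_le.
by apply: mulr_ge0; [rewrite pmulr_rge0// sqr_ge0|exact: sqr_ge0].
Qed.

Definition risk_bound : R :=
  (1 + 2 * C1 ^+ 2) * gamma_cst C0 ^+ 2 *
    ((exceed_cst C1 s + 2 * b ^+ 2 * (1 + m4)) / N%:R) +
  16 * C0 ^+ 2 * (H%:R / N%:R) * (sign_cst C1 s + 8 * b ^+ 2 * (1 + m4) + 4 * b ^+ 4 * m4) +
  (16 * C0 ^+ 2 * J ^+ 2 * C1 ^+ 2 / N%:R + C0 ^+ 2 * C1 ^+ 2 * H.+1%:R `^ (- (2 * s))).

Lemma risk_le : (\int[P]_w loss w <= risk_bound%:E)%E.
Proof.
have Npos : (0 < N)%N by have := HN; lia.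
have [i1 e1] := exceed_frequency_le alpha C01 C10 s2 fF fX XW Npos.
have pr h : (h < H)%N -> intg (fun w => prods h.+1 w ^+ 2) /\
    \int[P]_w prods h.+1 w ^+ 2 <= N%:R * (sign_cst C1 s + 8 * b ^+ 2 * (1 + m4) + 4 * b ^+ 4 * m4).
  by move=> hH; apply: (sign_products_le alpha C01 C10 s2 fF fX XW); have := HN; lia.
have i2 : intg (fun w => \sum_(h < H) prods h.+1 w ^+ 2).
  apply: (@intg_sum _ _ _ P setT measurableT _ _ (fun (h : 'I_H) w => prods h.+1 w ^+ 2)) => h.
  exact: (pr h (ltn_ord h)).1.
have j1 := intg_scale measurableT ((1 + 2 * C1 ^+ 2) * gamma_cst C0 ^+ 2) i1.
have j2 := intg_scale measurableT (16 * C0 ^+ 2 / N%:R ^+ 2) i2.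
have j3 := intg_bm P (bm_cst (16 * C0 ^+ 2 * J ^+ 2 * C1 ^+ 2 / N%:R + C0 ^+ 2 * C1 ^+ 2 * H.+1%:R `^ (- (2 * s)))).
have j12 := intg_add measurableT j1 j2.
have iG : intg G := intg_add measurableT j12 j3.
apply: (le_trans (ge0_integral_le P loss_ge0 loss_le)).
have -> : (\int[P]_w (G w)%:E = (\int[P]_w G w)%:E)%E.
  by rewrite /Rintegral fineK//; exact: integrable_fin_num iG.
rewrite lee_fin (RintegralD measurableT j12 j3) (RintegralD measurableT j1 j2) Ex_cst.
rewrite (RintegralZl _ measurableT i1) (RintegralZl _ measurableT i2) /risk_bound lerD2r lerD//.
  by rewrite ler_wpM2l// mulr_ge0 ?sqr_ge0// addr_ge0// mulr_ge0// sqr_ge0.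
rewrite (@Rintegral_sum _ _ _ P setT measurableT _ _ (fun (h : 'I_H) w => prods h.+1 w ^+ 2)); last first.
  by move=> h; exact: (pr h (ltn_ord h)).1.
set q := _ + 4 * b ^+ 4 * m4.
apply: (@le_trans _ _ (16 * C0 ^+ 2 / N%:R ^+ 2 * \sum_(h < H) (N%:R * q))).
  apply: ler_wpM2l; first by rewrite divr_ge0 ?sqr_ge0// pmulr_rge0 ?sqr_ge0.
  by apply: ler_sum => h _; exact: (pr h (ltn_ord h)).2.
rewrite sumr_const card_ord -[(N%:R * q) *+ H]mulr_natl le_eqVlt; apply/orP; left; apply/eqP.
by move: q => q; field; rewrite gt_eqF.
Qed.

End risk.

Section rates.
Context {R : realType}.
Variables (s alpha : R) (N : nat).
Hypotheses (s2 : 1 / 2 < s) (N2 : (2 <= N)%N) (alpha0 : 0 < alpha).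
Local Notation M := (Num.min (alpha ^+ 4) 1 * N%:R).
Local Notation e := (1 / (2 * s + 1)).
Local Notation H := (cutoff s N alpha).
Local Notation b := (3 / alpha).

Definition rate : R := M `^ (- (2 * s / (2 * s + 1))).

Let N0 : 0 < N%:R :> R. Proof. by rewrite ltr0n; lia. Qed.

Let a0 : 0 < Num.min (alpha ^+ 4) 1.
Proof. by rewrite lt_min ltr01 andbT exprn_gt0. Qed.

Let M0 : 0 < M. Proof. exact: mulr_gt0. Qed.

Let MN : M <= N%:R.
Proof. by rewrite ler_piMl ?(ltW N0)// ge_min lexx orbT. Qed.

Let s1 : 2 < 2 * s + 1. Proof. by have := s2; lra. Qed.

Let e01 : 0 < e < 1.
Proof.
have s1' := s1; have p : 0 < 2 * s + 1 by lra.
by rewrite div1r invr_gt0 p invf_lt1//; lra.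
Qed.

Let cutoffP : H%:R <= M `^ e < H.+1%:R.
Proof. by rewrite /cutoff minC; exact: (truncn_itv (powR_ge0 _ _)). Qed.

Lemma cutoff_lt : (H < N)%N.
Proof.
have /andP[h _] := cutoffP; have /andP[e0 e1] := e01.
rewrite -(ltr_nat R); apply: (le_lt_trans h).
apply: (@le_lt_trans _ _ (N%:R `^ e)).
  by apply: ge0_ler_powR; rewrite ?nnegrE ?(ltW e0) ?(ltW M0) ?(ltW N0)//; exact: MN.
have lnN : 0 < ln (N%:R : R) by rewrite ln_gt0// ltr1n.
rewrite /powR gt_eqF// -[ltRHS]lnK ?posrE// ltr_expR.
by rewrite gtr_pMl.
Qed.

Lemma cutoff_eq0 : M < 1 -> H = 0%N.
Proof.
move=> M1; have /andP[h _] := cutoffP; have /andP[e0 e1] := e01.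
apply/eqP; rewrite -leqn0 -ltnS -(ltr_nat R); apply: (le_lt_trans h); rewrite /powR gt_eqF// expR_lt1 pmulr_rlt0//.
by apply: ln_lt0; rewrite M0.
Qed.

Lemma rate_ge1 : M < 1 -> 1 <= rate.
Proof.
move=> M1; rewrite /rate powRN invf_ge1 ?powR_gt0//.
apply: (@le_trans _ _ (1 `^ (2 * s / (2 * s + 1)))); last by rewrite powR1.
have s1' := s1; apply: ge0_ler_powR; rewrite ?nnegrE ?(ltW M0)//; last exact: ltW.
by rewrite divr_ge0//; lra.
Qed.

Section large_sample.
Hypothesis M1 : 1 <= M.

Let rateE : rate = M `^ (e - 1).
Proof. by rewrite /rate; congr (_ `^ _); have := s1 => h; field; lra. Qed.

Lemma rate_le1 : rate <= 1.
Proof.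
have /andP[e0 e1] := e01.
rewrite rateE -[leRHS](powRr0 M); apply: ler_powR => //; lra.
Qed.

Let invM_le : M^-1 <= rate.
Proof.
have /andP[e0 e1] := e01.
rewrite rateE -(powR_inv1 (ltW M0)); apply: ler_powR => //; lra.
Qed.

Let HM_le : H%:R * M^-1 <= rate.
Proof.
have /andP[h _] := cutoffP.
rewrite rateE powRD; last by apply/implyP => _; rewrite gt_eqF.
by rewrite (powR_inv1 (ltW M0)); apply: ler_wpM2r => //; rewrite invr_ge0 ltW.
Qed.

Lemma cutoff_pow_le : H.+1%:R `^ (- (2 * s)) <= rate.
Proof.
have /andP[_ h] := cutoffP; have s1' := s1.
have -> : rate = (M `^ e) `^ (- (2 * s)).
  by rewrite -powRrM /rate; congr (_ `^ _); field; lra.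
rewrite !powRN lef_pV2 ?posrE ?powR_gt0//.
by apply: ge0_ler_powR; rewrite ?nnegrE ?powR_ge0 ?(ltW h)//; lra.
Qed.

Let pow_noise_le k (c : R) : Num.min (alpha ^+ 4) 1 <= alpha ^+ k -> c = 3 ^+ k ->
  b ^+ k / N%:R <= c * M^-1.
Proof.
move=> h ->; rewrite invfM mulrA; apply: ler_wpM2r; first by rewrite invr_ge0 ltW.
rewrite expr_div_n; apply: ler_wpM2l; first by rewrite exprn_ge0.
by rewrite lef_pV2 ?posrE ?exprn_gt0.
Qed.

Let b2_le : b ^+ 2 / N%:R <= 9 * M^-1.
Proof.
apply: pow_noise_le; last by rewrite -natrX.
have [a1|a1] := leP alpha 1; last first.
  by rewrite ge_min; apply/orP; right; rewrite exprn_ege1// ltW.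
rewrite ge_min; apply/orP; left; apply: ler_wiXn2l => //; exact: ltW.
Qed.

Let b4_le : b ^+ 4 / N%:R <= 81 * M^-1.
Proof. by apply: pow_noise_le; [rewrite ge_min lexx|rewrite -natrX]. Qed.

Lemma noise_rates : [/\ N%:R^-1 <= rate, b ^+ 2 / N%:R <= 9 * rate,
  H%:R / N%:R <= rate, H%:R * (b ^+ 2 / N%:R) <= 9 * rate &
  H%:R * (b ^+ 4 / N%:R) <= 81 * rate].
Proof.
have NM : N%:R^-1 <= M^-1 by rewrite lef_pV2 ?posrE.
have H0 : 0 <= H%:R :> R by [].
split.
- exact: le_trans invM_le.
- by apply: (le_trans b2_le); apply: ler_wpM2l.
- by apply: le_trans HM_le; apply: ler_wpM2l.
- by apply: (le_trans (ler_wpM2l H0 b2_le)); rewrite mulrCA; apply: ler_wpM2l.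
- by apply: (le_trans (ler_wpM2l H0 b4_le)); rewrite mulrCA; apply: ler_wpM2l.
Qed.

End large_sample.

End rates.

Section constant.
Context {R : realType}.
Variables (C0 C1 s : R).
Local Notation J := (@jordan_cst R).
Local Notation m4 := (@laplace_moment4 R).

Definition risk_cst_small : R := (1 + 2 * C1 ^+ 2) * C0 ^+ 2 + C0 ^+ 2 * C1 ^+ 2.

Definition risk_cst : R :=
  (1 + 2 * C1 ^+ 2) * gamma_cst C0 ^+ 2 * (exceed_cst C1 s + 18 * (1 + m4)) +
  16 * C0 ^+ 2 * (sign_cst C1 s + 72 * (1 + m4) + 324 * m4) +
  (16 * C0 ^+ 2 * J ^+ 2 * C1 ^+ 2 + C0 ^+ 2 * C1 ^+ 2).

Let distr4 (u v w t r : R) : (u + v + (w + t)) * r = u * r + v * r + (w * r + t * r).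
Proof. by ring. Qed.

Let csts_ge0 f : 1 <= C0 -> 1 / 2 < s -> spectral_class C0 C1 s f ->
  0 <= exceed_cst C1 s /\ 0 <= sign_cst C1 s.
Proof.
move=> C01 s2 fF; have Lam0 := corr_total_ge0 C01 s2 fF.
have J0 := ltW (@jordan_cst_gt0 R).
have gap0 : 0 <= (acorr_gap C1)^-1 by rewrite invr_ge0 ltW// acorr_gap_gt0.
split; first by rewrite /exceed_cst; apply: mulr_ge0 => //; rewrite pmulr_rge0.
rewrite /sign_cst; apply: mulr_ge0 => //; apply: mulr_ge0 => //.
by rewrite pmulr_rge0.
Qed.

Lemma risk_cst_ge0 f : 1 <= C0 -> 1 / 2 < s -> spectral_class C0 C1 s f -> 0 <= risk_cst.
Proof.
move=> C01 s2 fF; have [ce cs] := csts_ge0 C01 s2 fF.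
have m0 := @laplace_moment4_ge0 R; have m1 := addr_ge0 ler01 m0.
have c1 := sqr_ge0 C1; have c0 := sqr_ge0 C0; have cg := sqr_ge0 (gamma_cst C0).
have cJ := sqr_ge0 J.
rewrite /risk_cst; move: c1 c0 cg cJ ce cs m0 m1.
move: (exceed_cst C1 s) (sign_cst C1 s) (C1 ^+ 2) (C0 ^+ 2) (gamma_cst C0 ^+ 2) (J ^+ 2).
move: (m4) => m E S c1 c0 cg cJ c10 c00 cg0 cJ0 E0 S0 m0 m1.
by rewrite !addr_ge0 ?mulr_ge0 ?addr_ge0 ?mulr_ge0.
Qed.

Lemma risk_bound_le alpha N f : 1 <= C0 -> 0 < C1 -> 1 / 2 < s -> (2 <= N)%N -> 0 < alpha ->
  spectral_class C0 C1 s f -> 1 <= Num.min (alpha ^+ 4) 1 * N%:R ->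
  risk_bound C0 C1 s alpha N (cutoff s N alpha) <= risk_cst * rate s alpha N.
Proof.
move=> C01 C10 s2 N2 alpha0 fF M1.
have [h1 h2 h3 h4 h5] := noise_rates s2 N2 alpha0 M1.
have h6 := cutoff_pow_le s2 N2 alpha0.
have [ce cs] := csts_ge0 C01 s2 fF; have m0 := @laplace_moment4_ge0 R.
have c1 := sqr_ge0 C1; have c0 := sqr_ge0 C0; have cg := sqr_ge0 (gamma_cst C0).
have cJ := sqr_ge0 J.
rewrite /risk_bound /risk_cst; move: h1 h2 h3 h4 h5 h6.
move: (rate _ _ _) (_ `^ _) => r T h1 h2 h3 h4 h5 h6.
rewrite distr4; apply: lerD; first apply: lerD.
- rewrite -[leRHS]mulrA; apply: ler_wpM2l.
    by apply: mulr_ge0 => //; apply: addr_ge0 => //; exact: mulr_ge0.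
  have t1 := ler_wpM2l ce h1; have t2 := ler_wpM2l (addr_ge0 ler01 m0) h2.
  by move: t1 t2; move: ((3 / alpha) ^+ 2) (N%:R^-1) => B n t1 t2; lra.
- rewrite -[leLHS]mulrA -[leRHS]mulrA; apply: ler_wpM2l; first by rewrite pmulr_rge0.
  have t1 := ler_wpM2l cs h3; have t2 := ler_wpM2l (addr_ge0 ler01 m0) h4.
  have t3 := ler_wpM2l m0 h5; move: t1 t2 t3.
  by move: ((3 / alpha) ^+ 2) ((3 / alpha) ^+ 4) (N%:R^-1) (_%:R) => B B4 n h t1 t2 t3; lra.
- apply: lerD; apply: ler_wpM2l => //; last exact: mulr_ge0.
  by apply: mulr_ge0 => //; apply: mulr_ge0 => //; rewrite pmulr_rge0.
Qed.

End constant.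

Theorem theorem3 (R : realType) (C0 C1 s : R) :
  1 <= C0 -> 0 < C1 -> 1 / 2 < s ->
  exists C : R,
    forall (N : nat) (alpha : R), (2 <= N)%N -> 0 < alpha ->
    forall f : R -> R, spectral_class C0 C1 s f ->
    forall (d : measure_display) (T : measurableType d) (P : probability T R)
      (X : int -> {RV P >-> R}) (W : nat * nat -> {RV P >-> R}),
    centered_stationary_gaussian f X -> laplace_noise N X W ->
    (\int[P]_omega
       L2norm (fun lambda =>
         f_hat C0 N (cutoff s N alpha)
           (privatize C0 alpha (fun i => X i%:Z omega) (fun k => W k omega))
           lambda - f lambda)%R ^+ 2
     <= (C * Num.min 1
           ((Num.min (alpha ^+ 4) 1 * N%:R) `^ (- (2 * s / (2 * s + 1)))))%:E)%E.
Proof.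
move=> C01 C10 s2; exists (risk_cst C0 C1 s + risk_cst_small C0 C1).
move=> N alpha N2 alpha0 f fF d T P X W fX XW.
have HN := cutoff_lt s2 N2 alpha0.
have ks0 : 0 <= risk_cst_small C0 C1.
  by rewrite /risk_cst_small addr_ge0// mulr_ge0 ?sqr_ge0// addr_ge0// mulr_ge0// sqr_ge0.
have k0 : 0 <= risk_cst C0 C1 s by exact: risk_cst_ge0 C01 s2 fF.
rewrite -/(rate s alpha N).
change ((\int[P]_w loss C0 alpha f N (cutoff s N alpha) X W w <=
  ((risk_cst C0 C1 s + risk_cst_small C0 C1) * Num.min 1 (rate s alpha N))%:E)%E).
have [M1|M1] := leP 1 (Num.min (alpha ^+ 4) 1 * N%:R).
  apply: (le_trans (risk_le alpha C01 C10 s2 HN fF fX XW)).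
  rewrite lee_fin (min_idPr (rate_le1 s2 M1)).
  apply: (le_trans (risk_bound_le C01 C10 s2 N2 alpha0 fF M1)).
  by rewrite ler_wpM2r ?powR_ge0// lerDl.
have H0 := cutoff_eq0 s2 N2 alpha0 M1.
rewrite (min_idPl (rate_ge1 s2 N2 alpha0 M1)) mulr1.
apply: (@le_trans _ _ (\int[P]_w (risk_cst_small C0 C1)%:E)%E).
  apply: ge0_integral_le => w; first exact: loss_ge0.
  exact: (loss_le_bounded _ _ _ _ C01 s2 fF).
rewrite integral_cst// (_ : _ setT = 1%E) ?mule1 ?lee_fin ?lerDr//.
exact: probability_setT.
Qed.
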